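(* Let $\Omega\subset\mathbb{R}^N$ be a bounded open connected set and $h\in C(\Omega)$ with $h(\Omega)\subset\mathcal{I}_k:=\big((N-2k)\frac{\pi}{2},(N-2(k-1))\frac{\pi}{2}\big)$ for some fixed $k\in\{1,\dots,N\}$. Let $G(A):=\sum_{i=1}^N\arctan(\lambda_i(A))$ and $\Theta(x):=\{(r,A)\in\mathbb{R}\times\mathcal{S}(N):G(A)\ge h(x)\}$. Then $\Theta$ is a Hausdorff continuous proper elliptic map and $\partial\Theta(x)\subset\{(r,A):G(A)=h(x)\}$ for every $x\in\Omega$. Moreover, if $u\in\mathrm{USC}(\overline\Omega)$ restricts to a viscosity subsolution and $v\in\mathrm{LSC}(\overline\Omega)$ restricts to a viscosity supersolution of $G(D^2u(x))=h(x)$ in $\Omega$, then $u\le v$ on $\partial\Omega$ implies $u\le v$ in $\Omega$.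
   Context: $\mathcal{S}(N)$: real symmetric $N\times N$ matrices with usual partial order; $\lambda_1(A)\le\dots\le\lambda_N(A)$ eigenvalues. $\mathcal{Q}:=\{(s,P): s\le0,\ P\ge0\}$. A proper elliptic map assigns to each $x\in\Omega$ a closed, nonempty set $\subsetneq\mathbb{R}\times\mathcal{S}(N)$ invariant under adding elements of $\mathcal Q$. Hausdorff continuity: with norm $\|(r,A)\|=\max\{|r|,\max_i|\lambda_i(A)|\}$ and the induced Hausdorff distance $d_{\mathcal H}$ (possibly $+\infty$), for all $x\in\Omega,\eta>0$ there is $\delta>0$ with $d_{\mathcal H}(\Theta(x),\Theta(y))<\eta$ for $y\in\Omega$, $|x-y|<\delta$. $J^+_{x_0}u:=\{(\varphi(x_0),D^2\varphi(x_0)):\varphi$ is $C^2$ near $x_0$, $u\le\varphi$ near $x_0$, $u(x_0)=\varphi(x_0)\}$, $J^-_{x_0}u$ likewise with $u\ge\varphi$. $u\in\mathrm{USC}(\Omega)$ is a viscosity subsolution if $G(A)\ge h(x_0)$ for all $x_0\in\Omega$, $(r,A)\in J^+_{x_0}u$; $v\in\mathrm{LSC}(\Omega)$ is a viscosity supersolution if $G(A)\le h(x_0)$ for all $x_0\in\Omega$, $(r,A)\in J^-_{x_0}v$. *)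

(* Defs.v *)
From HB Require Import structures.
From mathcomp Require Import all_boot all_order all_algebra.
From mathcomp Require Import all_classical all_reals all_analysis.
Set Implicit Arguments. Unset Strict Implicit. Unset Printing Implicit Defensive.
Import Order.TTheory GRing.Theory Num.Theory.
Import numFieldNormedType.Exports.
Local Open Scope classical_set_scope.
Local Open Scope ring_scope.

Section Defs.
Variables (R : realType) (N : nat).

Definition symmetric (A : 'M[R]_N) : Prop := A^T = A.

Definition psd (P : 'M[R]_N) : Prop :=
  symmetric P /\ forall x : 'cV[R]_N, 0 <= (x^T *m P *m x) 0 0.

(* the increasingly sorted list of eigenvalues, counted with multiplicity
   (for symmetric A the characteristic polynomial splits over R) *)
Definition is_eigseq (A : 'M[R]_N) (s : seq R) : Prop :=
  [/\ size s = N, sorted <=%R s &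
      char_poly A = \prod_(x <- s) ('X - x%:P)].

Definition eigseq (A : 'M[R]_N) : seq R := xget [::] (is_eigseq A).

(* lambda_i(A), i = 0, ..., N-1 (i.e. lambda_1 <= ... <= lambda_N) *)
Definition eig (A : 'M[R]_N) (i : 'I_N) : R := nth 0 (eigseq A) i.

Definition Gop (A : 'M[R]_N) : R := \sum_(i < N) atan (eig A i).

Definition specnorm (A : 'M[R]_N) : R := \big[Num.max/0]_(i < N) `|eig A i|.

Definition pnorm (p : R * 'M[R]_N) : R := Num.max `|p.1| (specnorm p.2).

Definition pdist (p q : R * 'M[R]_N) : R := pnorm (p.1 - q.1, p.2 - q.2).

Definition SN : set (R * 'M[R]_N) := [set p | symmetric p.2].

Definition exc (X Y : set (R * 'M[R]_N)) : \bar R :=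
  ereal_sup [set ereal_inf [set (pdist p q)%:E | q in Y] | p in X].

Definition hausdorff_dist (X Y : set (R * 'M[R]_N)) : \bar R :=
  maxe (exc X Y) (exc Y X).

Definition closedS (X : set (R * 'M[R]_N)) : Prop :=
  X `<=` SN /\
  forall p, SN p -> (forall e : R, 0 < e -> exists2 q, X q & pdist q p < e) -> X p.

Definition boundaryS (X : set (R * 'M[R]_N)) : set (R * 'M[R]_N) :=
  [set p | SN p /\ forall e : R, 0 < e ->
     (exists2 q, X q & pdist q p < e) /\
     (exists2 q, (SN `\` X) q & pdist q p < e)].

Definition Qcone : set (R * 'M[R]_N) := [set p | p.1 <= 0 /\ psd p.2].

Definition proper_elliptic_map (Om : set 'rV[R]_N)
    (Th : 'rV[R]_N -> set (R * 'M[R]_N)) : Prop :=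
  forall x, Om x ->
    [/\ closedS (Th x), Th x !=set0, Th x <> SN &
        forall p q, Th x p -> Qcone q -> Th x (p.1 + q.1, p.2 + q.2)].

Definition enorm (x : 'rV[R]_N) : R := Num.sqrt (\sum_(i < N) x 0 i ^+ 2).

Definition hausdorff_continuous (Om : set 'rV[R]_N)
    (Th : 'rV[R]_N -> set (R * 'M[R]_N)) : Prop :=
  forall x, Om x -> forall eta : R, 0 < eta -> exists2 delta : R, 0 < delta &
    forall y, Om y -> enorm (x - y) < delta ->
      (hausdorff_dist (Th x) (Th y) < eta%:E)%E.

Definition evec (i : 'I_N) : 'rV[R]_N := delta_mx 0 i.

Definition pd (i : 'I_N) (f : 'rV[R]_N -> R) : 'rV[R]_N -> R :=
  fun x => 'D_(evec i) f x.

Definition C2near (phi : 'rV[R]_N -> R) (x0 : 'rV[R]_N) : Prop :=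
  exists2 e : R, 0 < e & forall x, enorm (x - x0) < e ->
    [/\ {for x, continuous phi},
        forall i, derivable phi x (evec i) /\ {for x, continuous (pd i phi)} &
        forall i j, derivable (pd j phi) x (evec i) /\
                    {for x, continuous (pd i (pd j phi))}].

Definition hessian (phi : 'rV[R]_N -> R) (x0 : 'rV[R]_N) : 'M[R]_N :=
  \matrix_(i, j) pd i (pd j phi) x0.

Definition Jplus (u : 'rV[R]_N -> R) (x0 : 'rV[R]_N) : set (R * 'M[R]_N) :=
  [set p | exists phi, [/\ C2near phi x0,
     (exists2 e : R, 0 < e & forall x, enorm (x - x0) < e -> u x <= phi x),
     u x0 = phi x0 & p = (phi x0, hessian phi x0)]].

Definition Jminus (u : 'rV[R]_N -> R) (x0 : 'rV[R]_N) : set (R * 'M[R]_N) :=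
  [set p | exists phi, [/\ C2near phi x0,
     (exists2 e : R, 0 < e & forall x, enorm (x - x0) < e -> phi x <= u x),
     u x0 = phi x0 & p = (phi x0, hessian phi x0)]].

Definition usc_on (D : set 'rV[R]_N) (u : 'rV[R]_N -> R) : Prop :=
  forall x, D x -> forall eps : R, 0 < eps -> exists2 delta : R, 0 < delta &
    forall y, D y -> enorm (y - x) < delta -> u y < u x + eps.

Definition lsc_on (D : set 'rV[R]_N) (v : 'rV[R]_N -> R) : Prop :=
  forall x, D x -> forall eps : R, 0 < eps -> exists2 delta : R, 0 < delta &
    forall y, D y -> enorm (y - x) < delta -> v x - eps < v y.

(* (Om is open, so jets of u|_Om at x0 in Om only involve values in Om) *)
Definition visc_sub (Om : set 'rV[R]_N) (h u : 'rV[R]_N -> R) : Prop :=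
  usc_on Om u /\
  forall x0, Om x0 -> forall p, Jplus u x0 p -> h x0 <= Gop p.2.

Definition visc_super (Om : set 'rV[R]_N) (h v : 'rV[R]_N -> R) : Prop :=
  lsc_on Om v /\
  forall x0, Om x0 -> forall p, Jminus v x0 p -> Gop p.2 <= h x0.

Definition ThetaG (h : 'rV[R]_N -> R) (x : 'rV[R]_N) : set (R * 'M[R]_N) :=
  [set p | symmetric p.2 /\ h x <= Gop p.2].

End Defs.

(* Main.v *)
Require Import Defs.
From HB Require Import structures.
From mathcomp Require Import all_boot all_order all_algebra fingroup perm.
From mathcomp Require Import all_classical all_reals all_analysis.
From mathcomp Require Import ring lra zify.
Set Implicit Arguments. Unset Strict Implicit. Unset Printing Implicit Defensive.
Import Order.TTheory GRing.Theory Num.Theory.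
Import numFieldNormedType.Exports.
Local Open Scope classical_set_scope.
Local Open Scope ring_scope.

(* Adding a small multiple of |x|^2 makes the subsolution strict: inside a phase interval
   some eigenvalue stays bounded, so G increases along the identity by a uniform amount;
   this also gives the Hausdorff continuity.  Near a positive interior maximum one doubles
   the variables with the penalty kappa/2 (|x - xi|^2 + |x - y|^2 + |y - eta|^2) and takes
   the Legendre transform in (x, y), a convex function psi on R^(2N).

   Alexandrov's and Jensen's theorems are replaced by a discrete argument.  The averages
   over lattice cubes of the second differences of psi are nonnegative and each is the mean
   of the averages over the subcubes.  Passing to a subcube as long as the sum of the square
   roots of the averages drops by theta stops at a cube all of whose subcubes have, by strict
   concavity of the square root, nearly the same averages; on it psi is within eps r^2 of a
   quadratic polynomial, r being the size of the cube.  By duality u and -v are bounded above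
   up to eps r^2, on balls of radius comparable to r, by paraboloids whose Hessians X and Y
   satisfy X + Y <= eps.  Sliding these paraboloids produces exact touching points of u and v
   that are close to each other, which contradicts strictness and the continuity of h. *)

(** * Sums over lattice boxes *)

Section BoxSums.
Variables (R : realType) (n : nat).
Implicit Types (ks : seq 'I_n) (m l : nat) (phi : 'rV[R]_n -> R) (j : 'I_n -> nat).

(** Averages of second differences telescope to boundary terms, so on the root cube they are bounded
    through the Lipschitz constant of [psi] and the side of the cube, whatever the mesh. Since this
    bound precedes the precision, the constants of the duality argument can be fixed first. The
    precision is [delta ^+ 2 * r ^+ 2], while the final errors are of order [delta * r ^+ 2]:
    locating a near maximiser costs a square root.

    For an exact Hessian, the mixed block of its inverse would be [- kappa] times the identity,
    because only the term |x - y|^2 couples the two variables. An approximation at one scale does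
    not show this; four values of the doubled function are compared to bound the mixed block from
    above, and positivity of the inverse then bounds X + Y.

    The gain in G is not uniform on [Om], since [h] may approach the ends of the phase interval at
    the boundary. Only pairs of close points at which u exceeds v by a fixed amount are used; these
    stay away from the boundary. *)

Definition natvec j : 'rV[R]_n := \row_k (j k)%:R.

(** Recursion on the list of active directions lets every proof treat one coordinate at a time;
    directions outside [ks] stay at 0. *)
Fixpoint box ks m phi : R :=
  if ks is k :: ks' then
    \sum_(i < m) box ks' m (fun o => phi (i%:R *: delta_mx 0 k + o))
  else phi 0.

Definition in_box ks m j := forall k, if k \in ks then (j k < m)%N else (j k == 0)%N.

Lemma natvec0 : natvec (fun=> 0%N) = 0.
Proof. by apply/rowP => k; rewrite !mxE. Qed.

Lemma natvecD j1 j2 :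
  natvec (fun k => j1 k + j2 k)%N = natvec j1 + natvec j2.
Proof. by apply/rowP => k; rewrite !mxE natrD. Qed.

Lemma eq_box_fun ks m phi phi' : phi =1 phi' -> box ks m phi = box ks m phi'.
Proof. by move=> /funext ->. Qed.

Lemma box_le ks m phi phi' :
  (forall j, in_box ks m j -> phi (natvec j) <= phi' (natvec j)) -> uniq ks ->
  box ks m phi <= box ks m phi'.
Proof.
elim: ks phi phi' => [|k ks IH] phi phi' H /=.
  by move=> _; rewrite -natvec0; apply: H => k.
case/andP => kks uks; apply: ler_sum => i _; apply: IH => // j Hj.
have -> : i%:R *: delta_mx 0 k + natvec j =
          natvec (fun k' => if k' == k then i : nat else j k').
  apply/rowP => k'; rewrite !mxE eqxx /=; case: eqP => [->|_].
    by have := Hj k; rewrite (negbTE kks) => /eqP ->; rewrite mulr1 addr0.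
  by rewrite mulr0 add0r.
apply: H => k'; rewrite in_cons; case: eqP => [->|ne] //=; exact: Hj.
Qed.

Lemma boxD ks m phi phi' :
  box ks m (fun o => phi o + phi' o) = box ks m phi + box ks m phi'.
Proof.
elim: ks phi phi' => [//|k ks IH] phi phi' /=.
by rewrite -big_split; apply: eq_bigr => i _; rewrite IH.
Qed.

Lemma boxZ ks m a phi : box ks m (fun o => a * phi o) = a * box ks m phi.
Proof.
elim: ks phi => [//|k ks IH] phi /=.
by rewrite mulr_sumr; apply: eq_bigr => i _; rewrite IH.
Qed.

Lemma box_cst ks m c : box ks m (fun=> c) = (m ^ size ks)%:R * c.
Proof.
elim: ks => [|k ks IH] /=; first by rewrite mul1r.
by rewrite sumr_const card_ord IH expnS natrM -[LHS]mulr_natl mulrA.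
Qed.

Lemma box_sum (I : finType) ks m (F : I -> 'rV[R]_n -> R) :
  box ks m (fun o => \sum_i F i o) = \sum_i box ks m (F i).
Proof.
elim: ks F => [//|k ks IH] F /=.
by rewrite exchange_big /=; apply: eq_bigr => i _; rewrite IH.
Qed.

Lemma box_ge0 ks m phi : (forall o, 0 <= phi o) -> 0 <= box ks m phi.
Proof.
elim: ks phi => [|k ks IH] phi H /=; first exact: H.
by apply: sumr_ge0 => i _; apply: IH.
Qed.

Lemma box_norm ks m phi b :
  (forall o, `|phi o| <= b) -> `|box ks m phi| <= (m ^ size ks)%:R * b.
Proof.
elim: ks phi => [|k ks IH] phi H /=; first by rewrite mul1r.
apply: (le_trans (ler_norm_sum _ _ _)).
apply: (@le_trans _ _ (\sum_(i < m) (m ^ size ks)%:R * b)).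
  by apply: ler_sum => i _; apply: IH.
by rewrite sumr_const card_ord expnS natrM -[leLHS]mulr_natl mulrA.
Qed.

Lemma box_ge_term ks m phi j : (forall o, 0 <= phi o) ->
  in_box ks m j -> uniq ks -> phi (natvec j) <= box ks m phi.
Proof.
elim: ks phi j => [|k ks IH] phi j H Hj /=.
  suff -> : natvec j = 0 by [].
  by apply/rowP => k; rewrite !mxE; have /= /eqP -> := Hj k.
case/andP => kks uks.
have jk : (j k < m)%N by have := Hj k; rewrite mem_head.
rewrite (bigD1 (Ordinal jk)) //= -[leLHS]addr0; apply: lerD; last first.
  by apply: sumr_ge0 => i _; apply: box_ge0.
set j' := fun k' => if k' == k then 0%N else j k'.
have -> : natvec j = (j k)%:R *: delta_mx 0 k + natvec j'.
  apply/rowP => k'; rewrite !mxE eqxx /= /j'; case: eqP => [->|_].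
    by rewrite mulr1 addr0.
  by rewrite mulr0 add0r.
apply: (IH (fun o => phi (_ + o))) => // k'; rewrite /j'; have := Hj k'.
by rewrite in_cons; case: eqP => [->|_] //=; rewrite (negbTE kks).
Qed.

(** Euclidean division of each index by [l] tiles the large box by boxes of side [l]. *)
Lemma box_mul ks m l phi :
  box ks (m * l) phi =
  box ks m (fun o => box ks l (fun o' => phi (l%:R *: o + o'))).
Proof.
elim: ks phi => [|k ks IH] phi /=; first by rewrite scaler0 addr0.
have -> : \sum_(i < m * l) box ks (m * l) (fun o => phi (i%:R *: delta_mx 0 k + o)) =
    \sum_(i < m) \sum_(j < l) box ks (m * l)
      (fun o => phi ((i * l + j)%:R *: delta_mx 0 k + o)).
  rewrite -(big_mkord xpredT (fun i => box ks (m * l)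
             (fun o => phi (i%:R *: delta_mx 0 k + o)))) big_nat_mul big_mkord.
  apply: eq_bigr => i _.
  by rewrite mulSnr addnC -{1}[(i * l)%N]add0n big_addn addnK big_mkord;
     apply: eq_bigr => j _; rewrite addnC.
apply: eq_bigr => i _; rewrite box_sum; apply: eq_bigr => j _; rewrite IH.
apply: eq_box_fun => I; apply: eq_box_fun => J; congr phi.
by apply/rowP => k'; rewrite !mxE natrD natrM; ring.
Qed.

Lemma box_rev ks m phi :
  box ks m phi =
  box ks m (fun o => phi (m.-1%:R *: \sum_(k <- ks) delta_mx 0 k - o)).
Proof.
elim: ks phi => [|k ks IH] phi /=; first by rewrite big_nil scaler0 subr0.
rewrite (reindex_inj rev_ord_inj) /=; apply: eq_bigr => i _; rewrite IH.
apply: eq_box_fun => o; congr phi; rewrite big_cons.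
have -> : (m - i.+1)%:R = m.-1%:R - i%:R :> R.
  by rewrite -natrB; [congr (_%:R)|]; case: i => i /=; lia.
by apply/rowP => k'; rewrite !mxE; ring.
Qed.

(** Summation along [k] leaves only the values of [E] on two opposite faces. The factor [m] on the
    left avoids the exponent [size ks - 1]. *)
Lemma box_telescope ks m k (E : 'rV[R]_n -> R) (b : R) : k \in ks ->
  (forall o, `|E o| <= b) ->
  `|box ks m (fun o => E (o + delta_mx 0 k) - E o)| * m%:R
  <= 2 * b * (m ^ size ks)%:R.
Proof.
elim: ks E => [//|k' ks IH] E + Eb /=; rewrite in_cons; case: eqP => [<- _|_ /= kks].
  rewrite -(box_sum ks m (fun (i : 'I_m) o => E (i%:R *: delta_mx 0 k + o + delta_mx 0 k)
                                - E (i%:R *: delta_mx 0 k + o))).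
  rewrite (@eq_box_fun _ _ _ (fun o => E (m%:R *: delta_mx 0 k + o) - E o)); last first.
    move=> o; have := telescope_sumr (fun i => E (i%:R *: delta_mx 0 k + o)) (leq0n m).
    rewrite scale0r add0r big_mkord => <-.
    apply: eq_bigr => i _; congr (E _ - _).
    by apply/rowP => q; rewrite !mxE -natr1; ring.
  rewrite expnS natrM [_ * (m%:R * _)]mulrCA mulrC; apply: ler_wpM2l => //.
  rewrite mulrC; apply: box_norm => o; apply: (le_trans (ler_normB _ _)).
  by rewrite mulr2n mulrDl mul1r; apply: lerD.
apply: (@le_trans _ _ ((\sum_(i < m) `|box ks m (fun o =>
     E (i%:R *: delta_mx 0 k' + o + delta_mx 0 k) - E (i%:R *: delta_mx 0 k' + o))|) * m%:R)).
  apply: ler_wpM2r => //; apply: (le_trans _ (ler_norm_sum _ _ _)).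
  by rewrite le_eqVlt; apply/orP; left; apply/eqP; congr `|_|; apply: eq_bigr => i _;
    apply: eq_box_fun => o; rewrite addrA.
rewrite mulr_suml; apply: (@le_trans _ _ (\sum_(i < m) 2 * b * (m ^ size ks)%:R)).
  apply: ler_sum => i _.
  apply: le_trans (IH (fun o => E (i%:R *: delta_mx 0 k' + o)) kks _) => //.
  by rewrite le_eqVlt; apply/orP; left; apply/eqP; congr (`|_| * _);
    apply: eq_box_fun => o; rewrite addrA.
by rewrite sumr_const card_ord expnS natrM -[leLHS]mulr_natl mulrCA.
Qed.

Lemma ler_sum_shift (F : nat -> R) (a m1 m2 : nat) :
  (forall i, 0 <= F i) -> (a + m1 <= m2)%N ->
  \sum_(i < m1) F (a + i)%N <= \sum_(i < m2) F i.
Proof.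
move=> F0 am; have -> : m2 = (a + m1 + (m2 - (a + m1)))%N by lia.
rewrite !big_split_ord /= -[leLHS]add0r -[leLHS]addr0.
by apply: lerD; [apply: lerD|] => //; apply: sumr_ge0.
Qed.

Lemma box_shift_le ks m1 m2 phi j : (forall o, 0 <= phi o) ->
  (forall k, j k + m1 <= m2)%N ->
  box ks m1 (fun o => phi (\sum_(k <- ks) (j k)%:R *: delta_mx 0 k + o))
  <= box ks m2 phi.
Proof.
elim: ks phi => [|k ks IH] phi phi0 Hj /=; first by rewrite big_nil add0r.
apply: le_trans (ler_sum_shift (F := fun i => box ks m2
  (fun o => phi (i%:R *: delta_mx 0 k + o))) _ (Hj k)); last first.
  by move=> i; apply: box_ge0.
apply: ler_sum => i _.
apply: le_trans (IH (fun o => phi ((j k + i)%:R *: delta_mx 0 k + o)) _ Hj); last by [].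
rewrite le_eqVlt; apply/orP; left; apply/eqP; apply: eq_box_fun => o; congr phi.
by rewrite big_cons natrD scalerDl !addrA; congr (_ + _); rewrite addrAC.
Qed.

Lemma natvec_sum j : natvec j = \sum_(k <- enum 'I_n) (j k)%:R *: delta_mx 0 k.
Proof.
apply/rowP => q; rewrite big_enum summxE !mxE (bigD1 q) //= !mxE !eqxx mulr1.
by rewrite big1 ?addr0 // => k kq; rewrite !mxE eq_sym (negbTE kq) andbF mulr0.
Qed.

End BoxSums.

(** * Averages over lattice cubes and stable cubes *)

Section CubeAverages.
Variables (R : realType) (n : nat).
Implicit Types (m l : nat) (phi d : 'rV[R]_n -> R) (j : 'I_n -> nat).

Definition cavg m phi : R := box (enum 'I_n) m phi / (m ^ n)%:R.

Lemma in_box_enum m j : (forall k, (j k < m)%N) -> in_box (enum 'I_n) m j.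
Proof. by move=> H k; rewrite mem_enum /= H. Qed.

Lemma in_box_enumP m j : in_box (enum 'I_n) m j -> forall k, (j k < m)%N.
Proof. by move=> H k; have := H k; rewrite mem_enum. Qed.

Lemma expn_gt0r m : (0 < m)%N -> 0 < (m ^ n)%:R :> R.
Proof. by move=> m0; rewrite ltr0n expn_gt0 m0. Qed.

Lemma cavg_le m phi phi' :
  (forall j, (forall k, (j k < m)%N) -> phi (natvec R j) <= phi' (natvec R j)) ->
  cavg m phi <= cavg m phi'.
Proof.
move=> H; apply: ler_wpM2r; first by rewrite invr_ge0.
by apply: box_le; [move=> j /in_box_enumP; exact: H|exact: enum_uniq].
Qed.

Lemma eq_cavg m phi phi' : phi =1 phi' -> cavg m phi = cavg m phi'.
Proof. by move=> /funext ->. Qed.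

Lemma cavg_ge0 m phi : (forall o, 0 <= phi o) -> 0 <= cavg m phi.
Proof. by move=> H; rewrite divr_ge0 //; apply: box_ge0. Qed.

Lemma cavgD m phi phi' : cavg m (fun o => phi o + phi' o) = cavg m phi + cavg m phi'.
Proof. by rewrite /cavg boxD mulrDl. Qed.

Lemma cavgZ m a phi : cavg m (fun o => a * phi o) = a * cavg m phi.
Proof. by rewrite /cavg boxZ mulrA. Qed.

Lemma cavg_cst m c : (0 < m)%N -> cavg m (fun=> c) = c.
Proof.
move=> m0; rewrite /cavg box_cst size_enum_ord mulrC mulrA mulVf ?mul1r //.
by rewrite gt_eqF // expn_gt0r.
Qed.

Lemma cavg_sum (I : finType) m (F : I -> 'rV[R]_n -> R) :
  cavg m (fun o => \sum_i F i o) = \sum_i cavg m (F i).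
Proof. by rewrite /cavg box_sum mulr_suml. Qed.

Lemma cavg_mul m l phi :
  cavg (m * l) phi = cavg m (fun o => cavg l (fun o' => phi (l%:R *: o + o'))).
Proof.
rewrite /cavg box_mul expnMn natrM invfM; rewrite [in RHS](_ :
  (fun o => _) = (fun o => (l ^ n)%:R^-1 *
     box (enum 'I_n) l (fun o' => phi (l%:R *: o + o')))).
  by rewrite boxZ; ring.
by apply/funext => o; rewrite mulrC.
Qed.

Lemma cavg_sqr m d c : (0 < m)%N -> (forall o, 0 <= d o) ->
  cavg m (fun o => (Num.sqrt (d o) - c) ^+ 2) =
  cavg m d - 2 * c * cavg m (fun o => Num.sqrt (d o)) + c ^+ 2.
Proof.
move=> m0 d0; rewrite -{1}(cavg_cst (c ^+ 2) m0) -mulNr -cavgZ -!cavgD.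
apply: eq_cavg => o; rewrite -[X in _ = X + _ + _](sqr_sqrtr (d0 o)); ring.
Qed.

(** Jensen's inequality, from the nonnegativity of the variance of the square root. *)
Lemma cavg_sqrt_le m d : (0 < m)%N -> (forall o, 0 <= d o) ->
  cavg m (fun o => Num.sqrt (d o)) <= Num.sqrt (cavg m d).
Proof.
move=> m0 d0; set A := cavg m _.
have A0 : 0 <= A by apply: cavg_ge0 => o; exact: sqrtr_ge0.
rewrite -(ger0_norm A0) -sqrtr_sqr ler_wsqrtr //.
have : 0 <= cavg m (fun o => (Num.sqrt (d o) - A) ^+ 2).
  by apply: cavg_ge0 => o; exact: sqr_ge0.
by rewrite cavg_sqr // -/A; nra.
Qed.

(* Quantitative strict concavity of the square root. *)
Lemma sqrt_deviation m d j : (0 < m)%N -> (forall o, 0 <= d o) ->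
  (forall k, (j k < m)%N) ->
  (Num.sqrt (d (natvec R j)) - Num.sqrt (cavg m d)) ^+ 2 <=
  2 * Num.sqrt (cavg m d) * (m ^ n)%:R *
    (Num.sqrt (cavg m d) - cavg m (fun o => Num.sqrt (d o))).
Proof.
move=> m0 d0 Hj; set c := Num.sqrt (cavg m d).
have c2 : c ^+ 2 = cavg m d by rewrite sqr_sqrtr //; apply: cavg_ge0.
apply: (@le_trans _ _ ((m ^ n)%:R * cavg m (fun o => (Num.sqrt (d o) - c) ^+ 2))).
  rewrite /cavg mulrC -mulrA mulVf ?mulr1 ?gt_eqF ?expn_gt0r //.
  apply: (@box_ge_term _ _ _ _ (fun o => (Num.sqrt (d o) - c) ^+ 2)).
  - by move=> o; exact: sqr_ge0.
  - exact: in_box_enum.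
  - exact: enum_uniq.
rewrite cavg_sqr // -c2 le_eqVlt; apply/orP; left; apply/eqP; ring.
Qed.

(** The cube has its lowest corner, not its centre, at [x]; this keeps subdivision on the lattice.
    The offset to the centre is restored later. *)
Definition dens (s : R) (g : 'rV[R]_n -> R) l (x : 'rV[R]_n) : R :=
  cavg l (fun o => g (x + s *: o)).

Definition sqdens (I : finType) (s : R) (g : I -> 'rV[R]_n -> R) l x : R :=
  \sum_i Num.sqrt (dens s (g i) l x).

Lemma dens_mul s g m l x :
  dens s g (m * l) x = cavg m (fun o => dens s g l (x + (s * l%:R) *: o)).
Proof.
rewrite /dens cavg_mul; apply: eq_cavg => o; apply: eq_cavg => o'.
by rewrite scalerDr scalerA addrA.
Qed.

Lemma dens_ge0 s g l x : (forall y, 0 <= g y) -> 0 <= dens s g l x.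
Proof. by move=> g0; apply: cavg_ge0. Qed.

Lemma sqdens_ge0 (I : finType) s (g : I -> 'rV[R]_n -> R) l x : 0 <= sqdens s g l x.
Proof. by apply: sumr_ge0 => i _; exact: sqrtr_ge0. Qed.

(* Stopping-time selection: as long as some child lowers [sqdens] by [theta], pass to it. *)
Lemma stable_cube (I : finType) (s theta : R) (g : I -> 'rV[R]_n -> R) m T x :
  0 <= s -> 0 < theta -> (0 < m)%N ->
  sqdens s g (m ^ T) x < T%:R * theta ->
  exists t y, [/\ (t < T)%N,
    forall k, 0 <= (y - x) 0 k <= s * (m ^ T)%:R - s * (m ^ t.+1)%:R,
    sqdens s g (m ^ t.+1) y <= sqdens s g (m ^ T) x &
    forall j, (forall k, (j k < m)%N) ->
      sqdens s g (m ^ t.+1) y - theta <=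
      sqdens s g (m ^ t) (y + (s * (m ^ t)%:R) *: natvec R j)].
Proof.
move=> s0 th0 m0; elim: T x => [|T IH] x.
  by rewrite mul0r ltNge sqdens_ge0.
move=> Hx; case: (pselect (exists j, (forall k, (j k < m)%N) /\
  sqdens s g (m ^ T) (x + (s * (m ^ T)%:R) *: natvec R j) <
  sqdens s g (m ^ T.+1) x - theta)) => [[j [jm Hj]]|Hn].
  have [|t [y [tT yx yle ych]]] := IH (x + (s * (m ^ T)%:R) *: natvec R j).
    by move: Hx; rewrite -natr1; lra.
  exists t, y; split => //; first exact: leqW.
  - move=> k; have := yx k; rewrite !mxE.
    have jk : (j k)%:R + 1 <= m%:R :> R by rewrite natr1 ler_nat.
    have j0 : 0 <= (j k)%:R :> R by [].
    have M0 : 0 <= s * (m ^ T)%:R by rewrite mulr_ge0.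
    rewrite (expnS m T) natrM; set M := (m ^ T)%:R in M0 *.
    by move=> /andP[h1 h2]; apply/andP; split; nra.
  - by apply: (le_trans yle); lra.
exists T, x; split => //.
  by move=> k; rewrite !mxE subrr lexx /= subrr.
move=> j jm; rewrite leNgt; apply/negP => H; apply: Hn; by exists j.
Qed.

(** Stability controls only the sum over [i] of the deficits in Jensen's inequality. They are
    nonnegative, so each is at most [theta], and [sqrt_deviation] applies to each [i] separately. *)
Lemma stable_cube_dens (I : finType) (s theta : R) (g : I -> 'rV[R]_n -> R) m l x i j :
  (forall i y, 0 <= g i y) -> (0 < m)%N -> 
  (forall j, (forall k, (j k < m)%N) ->
      sqdens s g (m * l) x - theta <= sqdens s g l (x + (s * l%:R) *: natvec R j)) ->
  (forall k, (j k < m)%N) ->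
  (Num.sqrt (dens s (g i) l (x + (s * l%:R) *: natvec R j))
    - Num.sqrt (dens s (g i) (m * l) x)) ^+ 2 <=
  2 * sqdens s g (m * l) x * (m ^ n)%:R * theta.
Proof.
move=> g0 m0 Hch jm.
pose d i o := dens s (g i) l (x + (s * l%:R) *: o).
have d0 i' o : 0 <= d i' o by apply: dens_ge0.
pose a i := Num.sqrt (cavg m (d i)) - cavg m (fun o => Num.sqrt (d i o)).
have a0 i' : 0 <= a i' by rewrite subr_ge0 cavg_sqrt_le.
have sD i' : Num.sqrt (dens s (g i') (m * l) x) = Num.sqrt (cavg m (d i')).
  by rewrite dens_mul.
have asum : \sum_i a i <= theta.
  rewrite sumrB; under eq_bigr do rewrite -sD.
  rewrite -cavg_sum -/(sqdens s g (m * l) x) lerBlDr -lerBlDl.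
  rewrite -[leLHS](cavg_cst _ m0); apply: cavg_le => j' Hj'; exact: Hch.
have ai : a i <= theta.
  apply: le_trans asum; rewrite (bigD1 i) //= lerDl; exact: sumr_ge0.
have si : Num.sqrt (cavg m (d i)) <= sqdens s g (m * l) x.
  rewrite -sD /sqdens (bigD1 i) //= lerDl; apply: sumr_ge0 => *; exact: sqrtr_ge0.
rewrite sD; apply: (le_trans (sqrt_deviation m0 (d0 i) jm)); rewrite -/(a i).
apply: ler_pM => //; rewrite ?mulr_ge0 ?sqrtr_ge0 //.
by apply: ler_wpM2r => //; apply: ler_wpM2l.
Qed.

(** A window of side [w * l] at an arbitrary lattice position lies in an aligned block of [w + 1]
    subcubes per side and contains one of [w - 1]. As [g] is nonnegative, its sums over the three
    are ordered; the ratios of volumes give the factors. *)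
Lemma window_dens s g m l w x (kap tau : R) j :
  (forall y, 0 <= g y) -> (0 < l)%N -> (1 < w)%N ->
  (forall j, (forall k, (j k < m)%N) ->
    `|dens s g l (x + (s * l%:R) *: natvec R j) - kap| <= tau) ->
  (forall k, j k + w.+1 * l <= m * l)%N ->
  (1 - w%:R^-1) ^+ n * (kap - tau) <=
    dens s g (w * l) (x + s *: natvec R j)
  <= (1 + w%:R^-1) ^+ n * (kap + tau).
Proof.
move=> g0 l0 w1 Hch Hj; have w0 : (0 < w)%N := ltnW w1.
have w0r : (0 : R) < w%:R by rewrite ltr0n.
pose q k := (j k %/ l)%N; pose r k := (j k %% l)%N.
have jE k : j k = (l * q k + r k)%N by rewrite mulnC -divn_eq.
have rl k : (r k < l)%N by rewrite ltn_mod.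
have qm k : (q k + w.+1 <= m)%N.
  by rewrite -(leq_pmul2r l0) mulnDl; apply: leq_trans (Hj k); rewrite leq_add2r leq_trunc_div.
have phi0 y o : 0 <= g (y + s *: o) by [].
have block v q' : (forall k, q' k + v <= m)%N -> (0 < v)%N ->
    kap - tau <= dens s g (v * l) (x + (s * l%:R) *: natvec R q') <= kap + tau.
  move=> Hq v0; rewrite dens_mul -{1}(cavg_cst (kap - tau) v0) -(cavg_cst (kap + tau) v0).
  have H j' : (forall k, (j' k < v)%N) ->
      kap - tau <= dens s g l (x + (s * l%:R) *: natvec R q' + (s * l%:R) *: natvec R j')
        <= kap + tau.
    move=> Hj'; rewrite -addrA -scalerDr -natvecD.
    have := Hch (fun k => q' k + j' k)%N _; rewrite ler_distl; apply.
    by move=> k; have := Hq k; have := Hj' k; lia.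
  by apply/andP; split; apply: cavg_le => j' /H /andP[].
have l0r : (0 : R) < l%:R by rewrite ltr0n.
have nwl : ((w * l) ^ n)%:R = w%:R ^+ n * l%:R ^+ n :> R by rewrite natrX natrM exprMn.
have wl_gt0 : 0 < ((w * l) ^ n)%:R :> R by apply: expn_gt0r; rewrite muln_gt0 w0.
apply/andP; split; last first.
  have /andP[_] := block w.+1 q qm isT.
  rewrite /dens /cavg ler_pdivrMr ?expn_gt0r ?muln_gt0 ?l0 // => Hub.
  rewrite ler_pdivrMr //.
  apply: (le_trans _ (le_trans Hub _)); last first.
    rewrite le_eqVlt; apply/orP; left; apply/eqP.
    have -> : ((w.+1 * l) ^ n)%:R = (w%:R + 1) ^+ n * l%:R ^+ n :> R.
      by rewrite natrX natrM exprMn natr1.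
    have -> : (w%:R + 1) = (1 + w%:R^-1) * w%:R :> R by field; rewrite gt_eqF.
    by rewrite nwl exprMn; ring.
  apply: le_trans (box_shift_le (j := r) (m1 := w * l) (m2 := w.+1 * l) _ _ _) => //.
    rewrite -natvec_sum le_eqVlt; apply/orP; left; apply/eqP.
    apply: eq_box_fun => o; congr g.
    by apply/rowP => k; rewrite !mxE jE natrD natrM; ring.
  by move=> k; rewrite mulSn leq_add2r ltnW.
have w1p : (0 < w.-1)%N by lia.
have qm' k : ((q k).+1 + w.-1 <= m)%N by have := qm k; lia.
have /andP[+ _] := block w.-1 (fun k => (q k).+1) qm' w1p.
rewrite /dens /cavg ler_pdivlMr ?expn_gt0r ?muln_gt0 ?w1p // => Hlb.
rewrite ler_pdivlMr //; apply: (le_trans _ (le_trans Hlb _)).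
  rewrite le_eqVlt; apply/orP; left; apply/eqP.
  have -> : ((w.-1 * l) ^ n)%:R = (w%:R - 1) ^+ n * l%:R ^+ n :> R.
    by rewrite natrX natrM exprMn -subn1 natrB.
  have -> : (w%:R - 1) = (1 - w%:R^-1) * w%:R :> R by field; rewrite gt_eqF.
  by rewrite nwl exprMn; ring.
apply: le_trans (box_shift_le (j := fun k => (l - r k)%N) (m1 := w.-1 * l)
   (m2 := w * l) _ (fun o => phi0 _ o) _) => //; last first.
  by move=> k; have := rl k; have -> : w = w.-1.+1 by [lia]; rewrite mulSn /=; lia.
rewrite -natvec_sum le_eqVlt; apply/orP; left; apply/eqP.
apply: eq_box_fun => o; congr g.
apply/rowP => k; rewrite !mxE jE natrD natrM natrB ?(ltnW (rl k)) // -natr1; ring.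
Qed.
End CubeAverages.

(** * Bilinear forms, second differences and polarisation on a lattice *)

Section Quadratics.
Variables (R : realType) (n : nat).
Implicit Types (x y z v : 'rV[R]_n) (H : 'M[R]_n) (k l : 'I_n) (ks : seq 'I_n).

Definition dot x y : R := \sum_k x 0 k * y 0 k.
Definition bil H x y : R := dot (x *m H) y.

Lemma dotC x y : dot x y = dot y x.
Proof. by apply: eq_bigr => k _; rewrite mulrC. Qed.

Lemma dotDl x y z : dot (x + y) z = dot x z + dot y z.
Proof. by rewrite -big_split; apply: eq_bigr => k _; rewrite mxE mulrDl. Qed.

Lemma dotZl a x z : dot (a *: x) z = a * dot x z.
Proof. by rewrite mulr_sumr; apply: eq_bigr => k _; rewrite mxE mulrA. Qed.

Lemma dotNl x z : dot (- x) z = - dot x z.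
Proof. by rewrite -scaleN1r dotZl mulN1r. Qed.

Lemma dotDr x y z : dot x (y + z) = dot x y + dot x z.
Proof. by rewrite dotC dotDl !(dotC x). Qed.

Lemma dotZr a x z : dot x (a *: z) = a * dot x z.
Proof. by rewrite dotC dotZl dotC. Qed.

Lemma dotNr x z : dot x (- z) = - dot x z.
Proof. by rewrite dotC dotNl dotC. Qed.

Lemma dot0l x : dot 0 x = 0.
Proof. by rewrite -(scale0r 0) dotZl mul0r. Qed.

Lemma dot0r x : dot x 0 = 0.
Proof. by rewrite dotC dot0l. Qed.

Definition dotE := (dotDl, dotDr, dotZl, dotZr, dotNl, dotNr, dot0l, dot0r).

Lemma dot_delta x k : dot x (delta_mx 0 k) = x 0 k.
Proof.
rewrite /dot (bigD1 k) //= mxE !eqxx mulr1 big1 ?addr0 // => i ik.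
by rewrite mxE (negbTE ik) andbF mulr0.
Qed.

Lemma dot_ge0 x : 0 <= dot x x.
Proof. by apply: sumr_ge0 => k _; rewrite -expr2 sqr_ge0. Qed.

Lemma dot_eq0 x : dot x x = 0 -> x = 0.
Proof.
move=> /eqP; rewrite psumr_eq0 => [/allP H|k _]; last by rewrite -expr2 sqr_ge0.
apply/rowP => k; rewrite mxE; apply/eqP.
by have := H k; rewrite mem_index_enum -expr2 sqrf_eq0 => /(_ isT).
Qed.

Lemma coord_sqr_le x k : x 0 k ^+ 2 <= dot x x.
Proof.
rewrite /dot (bigD1 k) //= expr2 lerDl; apply: sumr_ge0 => i _.
by rewrite -expr2 sqr_ge0.
Qed.

Lemma cauchy_schwarz x y : dot x y ^+ 2 <= dot x x * dot y y.
Proof.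
have [y0|y0] := eqVneq (dot y y) 0.
  by rewrite (dot_eq0 y0) !dot0r mulr0 expr0n.
have yp : 0 < dot y y by rewrite lt_def y0 dot_ge0.
have := dot_ge0 (dot y y *: x - dot x y *: y).
rewrite !dotE (dotC y x) => h.
have : 0 <= dot y y * (dot x x * dot y y - dot x y ^+ 2).
  by move: h; congr (_ <= _); ring.
by rewrite pmulr_rge0 // subr_ge0.
Qed.

Lemma bilDl H x y z : bil H (x + y) z = bil H x z + bil H y z.
Proof. by rewrite /bil mulmxDl dotDl. Qed.

Lemma bilDr H x y z : bil H x (y + z) = bil H x y + bil H x z.
Proof. by rewrite /bil dotDr. Qed.

Lemma bilZl H a x z : bil H (a *: x) z = a * bil H x z.
Proof. by rewrite /bil -scalemxAl dotZl. Qed.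

Lemma bilZr H a x z : bil H x (a *: z) = a * bil H x z.
Proof. by rewrite /bil dotZr. Qed.

Lemma bilNl H x z : bil H (- x) z = - bil H x z.
Proof. by rewrite /bil mulNmx dotNl. Qed.

Lemma bilNr H x z : bil H x (- z) = - bil H x z.
Proof. by rewrite /bil dotNr. Qed.

Lemma bil0l H x : bil H 0 x = 0.
Proof. by rewrite /bil mul0mx dot0l. Qed.

Lemma bil0r H x : bil H x 0 = 0.
Proof. by rewrite /bil dot0r. Qed.

Definition bilE := (bilDl, bilDr, bilZl, bilZr, bilNl, bilNr, bil0l, bil0r).

Lemma bil_sum H x y : bil H x y = \sum_k \sum_l x 0 k * H k l * y 0 l.
Proof.
rewrite /bil /dot exchange_big; apply: eq_bigr => l _.
by rewrite mxE mulr_suml.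
Qed.

Lemma bil_delta H k l : bil H (delta_mx 0 k) (delta_mx 0 l) = H k l.
Proof. by rewrite /bil dot_delta -rowE mxE. Qed.

Lemma bilC H x y : H^T = H -> bil H x y = bil H y x.
Proof.
move=> HT; rewrite !bil_sum exchange_big; apply: eq_bigr => k _; apply: eq_bigr => l _.
by rewrite -{1}HT mxE; ring.
Qed.

Lemma bil_le H x y (C a b : R) :
  (forall k l, `|H k l| <= C) -> (forall k, `|x 0 k| <= a) ->
  (forall k, `|y 0 k| <= b) -> `|bil H x y| <= n%:R ^+ 2 * C * a * b.
Proof.
move=> HC xa yb; rewrite bil_sum.
have H1 k l : `|x 0 k * H k l * y 0 l| <= a * C * b.
  by rewrite !normrM ler_pM ?mulr_ge0 // ler_pM.
apply: (le_trans (ler_norm_sum _ _ _)).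
apply: (@le_trans _ _ (\sum_(k < n) n%:R * (a * C * b))).
  apply: ler_sum => k _; apply: (le_trans (ler_norm_sum _ _ _)).
  apply: (le_trans (ler_sum _ (fun l _ => H1 k l))).
  by rewrite sumr_const card_ord mulr_natl.
rewrite sumr_const card_ord -[leLHS]mulr_natl le_eqVlt; apply/orP; left; apply/eqP; ring.
Qed.

Definition diff2 (f : 'rV[R]_n -> R) v y : R := f (y + v + v) - 2 * f (y + v) + f y.

Lemma diff2_quad H (c : R) b x v y : H^T = H ->
  diff2 (fun z => c + dot b (z - x) + 2^-1 * bil H (z - x) (z - x)) v y = bil H v v.
Proof.
move=> HT; rewrite /diff2.
have -> : y + v + v - x = (y - x) + v + v by rewrite addrAC (addrAC y).
have -> : y + v - x = (y - x) + v by rewrite addrAC.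
by rewrite !(bilE, dotE) (bilC v _ HT); field.
Qed.

(** Polarisation: the mixed difference is a linear combination of second differences in the
    directions [a + b], [a] and [b] at nearby points. *)
Lemma mixed_diff_le (f : 'rV[R]_n -> R) a b y (eta : R) :
  `|diff2 f (a + b) y| <= eta -> `|diff2 f a y| <= eta ->
  `|diff2 f a (y + b)| <= eta -> `|diff2 f b (y + a)| <= eta ->
  `|diff2 f b (y + a + a)| <= eta ->
  `|f (y + a + b) - f (y + a) - f (y + b) + f y| <= 4 * eta.
Proof.
have E1 : y + (a + b) + (a + b) = y + a + a + b + b.
  by apply/rowP => k; rewrite !mxE; ring.
have E2 : y + b + a = y + a + b by rewrite addrAC.
have E3 : y + a + b + a = y + a + a + b by rewrite addrAC.
rewrite /diff2 E1 (addrA y a b) E2 E3.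
by rewrite !ler_norml => *; apply/andP; split; lra.
Qed.

Definition path_end x (s : R) ks := x + s *: \sum_(k <- ks) delta_mx 0 k.

(** Discrete double integration. Each step of a path changes the slope in direction [k] by at most
    [beta], and adding up the slopes costs a second factor of the length. *)
Lemma affine_along_paths (f : 'rV[R]_n -> R) x (s beta : R) B :
  0 <= beta ->
  (forall k l ks, (size ks < B)%N -> let y := path_end x s ks in
    `|f (y + s *: delta_mx 0 k + s *: delta_mx 0 l) - f (y + s *: delta_mx 0 k)
      - f (y + s *: delta_mx 0 l) + f y| <= beta) ->
  forall ks, (size ks <= B)%N ->
  `|f (path_end x s ks) - f x - \sum_(k <- ks) (f (x + s *: delta_mx 0 k) - f x)|
   <= beta * (size ks)%:R ^+ 2.
Proof.
move=> beta0 Hm.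
have pcons k ks : path_end x s (k :: ks) = path_end x s ks + s *: delta_mx 0 k.
  by rewrite /path_end big_cons scalerDr addrA addrAC.
have Hd k ks : (size ks <= B)%N ->
  `|(f (path_end x s ks + s *: delta_mx 0 k) - f (path_end x s ks))
    - (f (x + s *: delta_mx 0 k) - f x)| <= beta * (size ks)%:R.
  elim: ks => [_|l ks IH lB].
    by rewrite /path_end big_nil scaler0 addr0 subrr normr0 mulr0.
  have := IH (ltnW lB); have := Hm k l ks lB; rewrite pcons /= -natr1.
  rewrite (addrAC _ (s *: delta_mx 0 l)) !ler_norml => /andP[h1 h2] /andP[h3 h4].
  by apply/andP; split; lra.
elim=> [_|l ks IH lB].
  by rewrite /path_end !big_nil scaler0 addr0 !subrr normr0 expr0n mulr0.
have := IH (ltnW lB); have := Hd l ks (ltnW lB); rewrite pcons big_cons /= -natr1.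
set N := (size ks)%:R : R; have N0 : 0 <= N by []; rewrite !ler_norml.
move=> /andP[h1 h2] /andP[h3 h4].
by have h5 : 0 <= beta * N by [rewrite mulr_ge0]; apply/andP; split; lra.
Qed.

Definition path_of (j : 'I_n -> nat) := flatten [seq nseq (j k) k | k <- enum 'I_n].

Lemma size_path_of j : size (path_of j) = (\sum_k j k)%N.
Proof.
rewrite /path_of size_flatten /shape -map_comp sumnE big_map big_enum /=.
by apply: eq_bigr => k _; rewrite size_nseq.
Qed.

Lemma sum_path_of (V : lmodType R) (F : 'I_n -> V) j :
  \sum_(k <- path_of j) F k = \sum_k (j k)%:R *: F k.
Proof.
rewrite /path_of big_flatten /= big_map big_enum /=; apply: eq_bigr => k _.
by rewrite big_nseq scaler_nat; elim: (j k) => [//|m IH]; rewrite iterS IH mulrS.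
Qed.

Lemma path_end_natvec x s ks :
  path_end x s ks = x + s *: natvec R (fun k => count_mem k ks).
Proof.
congr (_ + _ *: _); apply/rowP => q; rewrite mxE summxE.
elim: ks => [|k ks IH]; first by rewrite big_nil.
by rewrite big_cons IH mxE eqxx /= natrD [in RHS]eq_sym.
Qed.

(** The values of a quadratic form at these vectors determine its matrix, which [polar] recovers.
    The diagonal case is e_k and not 2 e_k. *)
Definition dvec k l : 'rV[R]_n := delta_mx 0 k + (k != l)%:R *: delta_mx 0 l.

Lemma dvecC k l : dvec k l = dvec l k.
Proof.
rewrite /dvec eq_sym; case: eqVneq => [->//|_] /=.
by rewrite !scale1r addrC.
Qed.

Lemma dvec_diag k : dvec k k = delta_mx 0 k.
Proof. by rewrite /dvec eqxx scale0r addr0. Qed.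

Definition polar (kap : 'I_n -> 'I_n -> R) : 'M[R]_n :=
  \matrix_(k, l) if k == l then kap k k else (kap k l - kap k k - kap l l) / 2.

Lemma polar_sym kap : (forall k l, kap k l = kap l k) -> (polar kap)^T = polar kap.
Proof.
move=> kC; apply/matrixP => k l; rewrite !mxE eq_sym kC; case: eqVneq => [->//|_]; ring.
Qed.

Lemma polar_dvec kap k l : (forall k l, kap k l = kap l k) ->
  bil (polar kap) (dvec k l) (dvec k l) = kap k l.
Proof.
move=> kC; rewrite /dvec; case: (eqVneq k l) => [->|kl] /=.
  by rewrite scale0r addr0 bil_delta mxE eqxx.
rewrite scale1r !bilE !bil_delta !mxE !eqxx (eq_sym l) (negbTE kl) (kC l k); by field.
Qed.

(** After subtraction of the quadratic form with matrix [polar kap], the second differences are at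
    most [eta], hence the mixed ones at most [4 * eta], and the rest is nearly affine. The margin 2
    is there because polarisation looks up to two steps ahead. *)
Lemma quad_on_lattice (F : 'rV[R]_n -> R) x (s eta : R) kap B :
  0 < s -> 0 <= eta -> (forall k l, kap k l = kap l k) ->
  (forall k l (j : 'I_n -> nat), (forall q, j q <= B + 2)%N ->
    `|diff2 F (s *: dvec k l) (x + s *: natvec R j) - s ^+ 2 * kap k l| <= eta) ->
  exists c b, forall j : 'I_n -> nat, (\sum_k j k <= B)%N ->
    `|F (x + s *: natvec R j) - (c + dot b (s *: natvec R j)
      + 2^-1 * bil (polar kap) (s *: natvec R j) (s *: natvec R j))|
    <= 4 * eta * (\sum_k j k)%:R ^+ 2.
Proof.
move=> s0 eta0 kC HF.
pose H := polar kap; have HT : H^T = H := polar_sym kC.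
pose f z := F z - (0 + dot 0 (z - x) + 2^-1 * bil H (z - x) (z - x)).
have f2 k l (j : 'I_n -> nat) : (forall q, j q <= B + 2)%N ->
    `|diff2 f (s *: dvec k l) (x + s *: natvec R j)| <= eta.
  move=> /HF => /(_ k l); set v := s *: dvec k l; set y := x + _.
  have <- : bil H v v = s ^+ 2 * kap k l.
    by rewrite /v bilZl bilZr /H polar_dvec // mulrA expr2.
  by rewrite -(diff2_quad 0 0 x v y HT) /diff2 /f; congr (`|_| <= _); ring.
have nv1 k : delta_mx 0 k = natvec R (fun q => (q == k) : nat).
  by apply/rowP => q; rewrite !mxE eqxx.
have fm k l ks : (size ks < B)%N -> let y := path_end x s ks in
    `|f (y + s *: delta_mx 0 k + s *: delta_mx 0 l) - f (y + s *: delta_mx 0 k)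
      - f (y + s *: delta_mx 0 l) + f y| <= 4 * eta.
  move=> sB; rewrite path_end_natvec; set j := fun q => _.
  have jB q : (j q <= B)%N by apply: leq_trans (count_size _ _) (ltnW sB).
  have sh i : x + s *: natvec R j + s *: delta_mx 0 i =
      x + s *: natvec R (fun q => j q + (q == i))%N.
    by rewrite nv1 -addrA -scalerDr -natvecD.
  have [<-|kl] := eqVneq k l.
    have := f2 k k j; rewrite dvec_diag /diff2 => /(_ _) h /=.
    apply: (@le_trans _ _ eta); last by lra.
    by move: h; rewrite (_ : _ - _ - _ + _ = f (x + s *: natvec R j + s *: 'e_k + s *: 'e_k) -
      2 * f (x + s *: natvec R j + s *: 'e_k) + f (x + s *: natvec R j)); [apply => q; exact: leq_trans (jB q) (leq_addr _ _)|ring].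
  apply: mixed_diff_le.
  - have -> : s *: 'e_k + s *: 'e_l = s *: dvec k l.
      by rewrite /dvec kl scale1r scalerDr.
    by apply: f2 => q; exact: leq_trans (jB q) (leq_addr _ _).
  - by rewrite -dvec_diag; apply: f2 => q; exact: leq_trans (jB q) (leq_addr _ _).
  - by rewrite sh -dvec_diag; apply: f2 => q; apply: leq_add => //; case: eqP.
  - by rewrite sh -dvec_diag; apply: f2 => q; apply: leq_add => //; case: eqP.
  - rewrite sh (_ : _ + s *: 'e_k = x + s *: natvec R (fun q => j q + ((q == k) + (q == k)))%N); last first.
      rewrite nv1 -addrA -scalerDr -natvecD; congr (_ + _ *: natvec _ _).
      by apply/funext => q; rewrite addnA.
    by rewrite -dvec_diag; apply: f2 => q; apply: leq_add => //; case: eqP.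
have := affine_along_paths (mulr_ge0 _ eta0) fm; move=> /(_ (ler0n _ _)) Hp.
exists (f x), (s^-1 *: \row_k (f (x + s *: delta_mx 0 k) - f x)) => j jB.
have := Hp (path_of j); rewrite size_path_of => /(_ jB).
have -> : path_end x s (path_of j) = x + s *: natvec R j.
  rewrite /path_end; congr (_ + _ *: _); rewrite sum_path_of natvec_sum.
  by rewrite big_enum.
have -> : \sum_(k <- path_of j) (f (x + s *: 'e_k) - f x) =
   dot (s^-1 *: \row_k (f (x + s *: delta_mx 0 k) - f x)) (s *: natvec R j).
  rewrite dotZl dotZr mulrA mulVf ?gt_eqF // mul1r (sum_path_of (V := R^o)).
  by apply: eq_bigr => k _; rewrite !mxE mulrC.
congr (`|_| <= _); rewrite {1}/f (addrC x (s *: natvec R j)) addrK dot0l -/H.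
ring.
Qed.

End Quadratics.

(** * From averages of a convex function to the function itself *)

Section ConvexFromAverages.
Variables (R : realType) (n : nat).
Implicit Types (x y z v : 'rV[R]_n) (H : 'M[R]_n) (k l : 'I_n) (j : 'I_n -> nat).

Definition cvx (psi : 'rV[R]_n -> R) := forall x y (t : R), 0 <= t <= 1 ->
  psi (t *: x + (1 - t) *: y) <= t * psi x + (1 - t) * psi y.

Lemma cvx_midpoint psi z v : cvx psi -> 2 * psi z <= psi (z + v) + psi (z - v).
Proof.
move=> /(_ (z + v) (z - v) 2^-1) H.
have -> : z = 2^-1 *: (z + v) + (1 - 2^-1) *: (z - v).
  by apply/rowP => k; rewrite !mxE; field.
have := H _; rewrite (_ : 2^-1 *: (z + v) + (1 - 2^-1) *: (z - v) = z); last first.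
  by apply/rowP => k; rewrite !mxE; field.
by rewrite invr_ge0 ler0n invf_le1 ?ler1n //= => /(_ isT); lra.
Qed.

Lemma cvx_diff2_ge0 psi v y : cvx psi -> 0 <= diff2 psi v y.
Proof.
move=> /(cvx_midpoint (y + v) v); rewrite addrK /diff2; lra.
Qed.

Lemma cavg_rev m (phi : 'rV[R]_n -> R) :
  cavg m phi = cavg m (fun o => phi (const_mx m.-1%:R - o)).
Proof.
rewrite /cavg box_rev; congr (_ / _); apply: eq_box_fun => o; congr (phi (_ - _)).
rewrite -[in RHS](_ : natvec R (fun=> m.-1) = const_mx m.-1%:R); last first.
  by apply/rowP => k; rewrite !mxE.
by rewrite natvec_sum scaler_sumr.
Qed.

Variables (psi : 'rV[R]_n -> R) (s : R) (x b : 'rV[R]_n) (H : 'M[R]_n).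
Variables (c C E : R) (W M : nat).
Hypotheses (psi_cvx : cvx psi) (s0 : 0 < s) (HT : H^T = H).
Hypotheses (W0 : (0 < W)%N) (C0 : 0 <= C) (HC : forall k l, `|H k l| <= C).

Let Q v : R := c + dot b v + 2^-1 * bil H v v.
(** Offset from the lowest corner to the centre of a cube of [W] points per side; the centre is not
    a lattice point when [W] is even. *)
Let ctr : 'rV[R]_n := const_mx (s * W.-1%:R / 2).

Let QD v d : Q (v + d) + Q (v - d) = 2 * Q v + bil H d d.
Proof.
rewrite /Q !(bilDl, bilDr, bilNl, bilNr, dotDr, dotNr) (bilC d v HT).
by field.
Qed.

Hypothesis F_quad : forall j, (forall k, j k <= M)%N ->
  `|dens s psi W (x + s *: natvec R j) - Q (s *: natvec R j)| <= E.

Let offset_rev o : s *: (const_mx W.-1%:R - o) - ctr = - (s *: o - ctr) :> 'rV[R]_n.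
Proof. by apply/rowP => k; rewrite !mxE; field. Qed.

(** The cube is symmetric about its centre, so midpoint convexity puts the value at the centre below
    the mean. *)
Lemma lattice_upper j : (forall k, j k <= M)%N ->
  psi (x + ctr + s *: natvec R j) <= Q (s *: natvec R j) + E.
Proof.
move=> /F_quad; rewrite ler_distl => /andP[_]; apply: le_trans.
set z := x + ctr + _.
have E1 : dens s psi W (x + s *: natvec R j) = cavg W (fun o => psi (z + (s *: o - ctr))).
  by apply: eq_cavg => o; congr psi; apply/rowP => k; rewrite !mxE; ring.
have E2 : dens s psi W (x + s *: natvec R j) = cavg W (fun o => psi (z - (s *: o - ctr))).
  by rewrite E1 cavg_rev; apply: eq_cavg => o; rewrite offset_rev.
have : 2 * psi z <= dens s psi W (x + s *: natvec R j) + dens s psi W (x + s *: natvec R j).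
  rewrite {1}E1 E2 -cavgD -(cavg_cst n (2 * psi z) W0).
  by apply: cavg_le => i _; exact: cvx_midpoint.
lra.
Qed.

(** The point [z + d] is the midpoint of [z] and [z + 2 *: d], and [2 *: d] is a lattice vector even
    if the centre is not a lattice point, so [lattice_upper] bounds [psi] at the far end. Averaging
    over [d] then bounds [psi z] from below. *)
Lemma lattice_lower j : (forall k, W <= j k)%N -> (forall k, j k + W <= M)%N ->
  Q (s *: natvec R j) - 3 * E - 2 * (n%:R ^+ 2 * C * (s * W%:R) * (s * W%:R)) <=
  psi (x + ctr + s *: natvec R j).
Proof.
move=> Wj jM; have jM' k : (j k <= M)%N := leq_trans (leq_addr _ _) (jM k).
have := F_quad jM'; rewrite ler_distl => /andP[+ _].
set z := x + ctr + _; set v := s *: natvec R j.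
pose d (o : 'rV[R]_n) : 'rV[R]_n := s *: o - ctr.
have E1 : dens s psi W (x + v) = cavg W (fun o => psi (z + d o)).
  by apply: eq_cavg => o; congr psi; apply/rowP => k; rewrite !mxE; ring.
have up i : (forall k, (i k < W)%N) -> 
    psi (z + 2 *: d (natvec R i)) <= Q (v + 2 *: d (natvec R i)) + E.
  move=> Hi; pose i' k := (j k + (i k + i k) - W.-1)%N.
  have i'E k : (i' k)%:R = (j k)%:R + ((i k)%:R + (i k)%:R) - (W.-1)%:R :> R.
    by rewrite /i' natrB ?natrD //; have := Wj k; lia.
  have -> : z + 2 *: d (natvec R i) = x + ctr + s *: natvec R i'.
    by apply/rowP => k; rewrite !mxE i'E; field.
  have -> : v + 2 *: d (natvec R i) = s *: natvec R i'.
    by apply/rowP => k; rewrite !mxE i'E; field.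
  apply: lattice_upper => k; rewrite /i'; have := Wj k; have := jM k; have := Hi k; lia.
have dbound i k : (forall k, (i k < W)%N) -> `|d (natvec R i) 0 k| <= s * W%:R.
  move=> /(_ k) ik; rewrite !mxE.
  have : (i k)%:R <= W%:R :> R by rewrite ler_nat ltnW.
  have : (W.-1)%:R <= W%:R :> R by rewrite ler_nat leq_pred.
  have i0 : 0 <= (i k)%:R :> R by [].
  have w0 : 0 <= (W.-1)%:R :> R by [].
  rewrite -(ler_pM2l s0) => h1; rewrite -(ler_pM2l s0) => h2.
  have h3 := mulr_ge0 (ltW s0) i0; have h4 := mulr_ge0 (ltW s0) w0.
  by rewrite ler_norml; apply/andP; split; lra.
have avgQ : cavg W (fun o => Q (v + 2 *: d o)) <=
    Q v + 2 * (n%:R ^+ 2 * C * (s * W%:R) * (s * W%:R)).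
  have E2 : cavg W (fun o => Q (v + 2 *: d o)) = cavg W (fun o => Q (v - 2 *: d o)).
    by rewrite cavg_rev; apply: eq_cavg => o; rewrite {1}/d offset_rev scalerN.
  suff : cavg W (fun o => Q (v + 2 *: d o)) + cavg W (fun o => Q (v - 2 *: d o)) <=
      2 * (Q v + 2 * (n%:R ^+ 2 * C * (s * W%:R) * (s * W%:R))) by rewrite -E2; lra.
  rewrite -cavgD -(cavg_cst n (2 * (Q v + _)) W0).
  apply: cavg_le => i Hi; rewrite QD bilZl bilZr.
  have := bil_le HC (fun k => dbound i k Hi) (fun k => dbound i k Hi).
  by rewrite ler_norml => /andP[_]; lra.
have : cavg W (fun o => psi (z + d o)) <= 2^-1 * psi z + 2^-1 * (cavg W (fun o => Q (v + 2 *: d o)) + E).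
  rewrite -(cavg_cst n E W0) -cavgD -cavgZ -[X in X + _](cavg_cst n _ W0) -cavgD.
  apply: cavg_le => i Hi; have := up i Hi.
  have := cvx_midpoint (z + d (natvec R i)) (d (natvec R i)) psi_cvx.
  rewrite addrK (_ : z + _ + _ = z + 2 *: d (natvec R i)); first by lra.
  by rewrite -addrA scaler_nat mulr2n.
rewrite -E1; lra.
Qed.

Lemma grid_cell (a : R) (m : nat) : (0 < m)%N -> 0 <= a <= m%:R ->
  exists2 i : nat, (i < m)%N & i%:R <= a <= i.+1%:R.
Proof.
move=> m0 /andP[a0 am]; have [lt|ge] := ltP a m%:R.
  exists (Num.truncn a); last by have /andP[-> /ltW ->] := truncn_itv a0.
  by rewrite -(ltr_nat R); apply: le_lt_trans lt; have /andP[] := truncn_itv a0.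
exists m.-1; first by lia.
by rewrite prednK // am andbT (le_trans _ ge) // ler_nat leq_pred.
Qed.

(** Convex interpolation in one coordinate at a time, [ks] listing those that may be off the
    lattice. In each direction the chord of [Q] over one mesh interval exceeds [Q] by at most
    [C * s ^+ 2]. *)
Lemma box_upper v : (0 < M)%N -> (forall k, 0 <= v 0 k <= s * M%:R) ->
  psi (x + ctr + v) <= Q v + E + n%:R * C * s ^+ 2.
Proof.
move=> M0 Hv.
suff : forall ks v, (forall k, 0 <= v 0 k <= s * M%:R) ->
   (forall k, k \notin ks -> exists2 i : nat, (i <= M)%N & v 0 k = s * i%:R) ->
   psi (x + ctr + v) <= Q v + E + (size ks)%:R * C * s ^+ 2.
  move=> /(_ (enum 'I_n) v Hv); rewrite size_enum_ord; apply=> k.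
  by rewrite mem_enum.
move=> {v Hv}; elim=> [|k ks IH] v Hv Hl.
  have /choice [j jP] : forall k, exists i : nat, (i <= M)%N /\ v 0 k = s * i%:R.
    by move=> k; have [//|i iM vi] := Hl k; exists i.
  have -> : v = s *: natvec R j.
    by apply/rowP => k; rewrite !mxE (jP k).2.
  by rewrite !mul0r addr0; apply: lattice_upper => k; have [] := jP k.
have [i iM /andP[i1 i2]] : exists2 i : nat, (i < M)%N & i%:R <= v 0 k / s <= i.+1%:R.
  apply: grid_cell => //; have /andP[h1 h2] := Hv k.
  by rewrite divr_ge0 ?(ltW s0) //= ler_pdivrMr // mulrC.
pose th := v 0 k / s - i%:R.
pose vm := v + (s * i%:R - v 0 k) *: delta_mx 0 k.
pose vp := vm + s *: delta_mx 0 k.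
have th01 : 0 <= th <= 1 by rewrite /th -natr1 in i2 *; apply/andP; split; lra.
have vE : v = th *: vp + (1 - th) *: vm.
  by apply/rowP => q; rewrite !mxE /th; field; rewrite gt_eqF.
have vmE q : vm 0 q = if q == k then s * i%:R else v 0 q.
  by rewrite !mxE eqxx /=; case: eqP => [->|_] /=; ring.
have vpE q : vp 0 q = if q == k then s * i.+1%:R else v 0 q.
  rewrite [vp 0 q]mxE vmE !mxE eqxx /= -natr1; case: eqP => [_|_] /=; ring.
have inbox (i' : nat) : (i' <= M)%N -> 0 <= s * i'%:R <= s * M%:R.
  by move=> i'M; rewrite mulr_ge0 ?(ltW s0) //= ler_pM2l // ler_nat.
have box_vm : forall q, 0 <= vm 0 q <= s * M%:R.
  by move=> q; rewrite vmE; case: eqP => _; [apply/inbox/ltnW|exact: Hv].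
have box_vp : forall q, 0 <= vp 0 q <= s * M%:R.
  by move=> q; rewrite vpE; case: eqP => _; [exact: inbox|exact: Hv].
have al_vm q : q \notin ks -> exists2 i : nat, (i <= M)%N & vm 0 q = s * i%:R.
  rewrite vmE; case: eqP => [_ _|/eqP qk qks]; first by exists i => //; exact: ltnW.
  by apply: Hl; rewrite in_cons negb_or qk.
have al_vp q : q \notin ks -> exists2 i : nat, (i <= M)%N & vp 0 q = s * i%:R.
  rewrite vpE; case: eqP => [_ _|/eqP qk qks]; first by exists i.+1.
  by apply: Hl; rewrite in_cons negb_or qk.
have Um := IH _ box_vm al_vm; have Up := IH _ box_vp al_vp.
have QE : th * Q vp + (1 - th) * Q vm =
    Q v + 2^-1 * (th * (1 - th) * (s ^+ 2 * H k k)).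
  have QE' u d t : t * Q (u + d) + (1 - t) * Q u =
      Q (t *: (u + d) + (1 - t) *: u) + 2^-1 * (t * (1 - t) * bil H d d).
    rewrite /Q !(bilDl, bilDr, bilZl, bilZr, dotDr, dotZr) (bilC d u HT).
    by field.
  rewrite /vp QE' -/vp -vE bilZl bilZr bil_delta; ring.
have Hkk : th * (1 - th) * (s ^+ 2 * H k k) <= 2 * (C * s ^+ 2).
  have := HC k k; rewrite ler_norml => /andP[h1 h2].
  case/andP: th01 => t0 t1.
  have u0 : 0 <= th * (1 - th) by rewrite mulr_ge0 ?subr_ge0.
  have u1 : th * (1 - th) <= 1 by nra.
  have a0 : 0 <= s ^+ 2 by exact: sqr_ge0.
  have pq : s ^+ 2 * H k k <= C * s ^+ 2 by rewrite mulrC ler_wpM2r.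
  have q0 : 0 <= C * s ^+ 2 by rewrite mulr_ge0.
  apply: (le_trans (ler_wpM2l u0 pq)); apply: (le_trans (ler_piMl q0 u1)).
  by rewrite ler_peMl // ler1n.
have -> : x + ctr + v = th *: (x + ctr + vp) + (1 - th) *: (x + ctr + vm).
  by rewrite {1}vE; apply/rowP => q; rewrite !mxE; ring.
apply: (le_trans (psi_cvx _ _ th01)).
case/andP: th01 => t0 t1; rewrite /= -natr1.
set e := (size ks)%:R * C * s ^+ 2 in Um Up *.
have h1 := ler_wpM2l t0 Up.
have t1' : 0 <= 1 - th by rewrite subr_ge0.
have h2 := ler_wpM2l t1' Um.
have -> : ((size ks)%:R + 1) * C * s ^+ 2 = e + C * s ^+ 2 by rewrite /e; ring.
lra.
Qed.

(** For the lower bound, [v] is reflected in the lattice point [v1] below it: convexity bounds [psi]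
    at [v] by twice the lower bound at [v1] minus the upper bound at the reflected point. This
    accounts for 7 = 2 * 3 + 1; the 6 is 2 * 2, plus 1 for [box_upper] and 1 for the parallelogram
    term. *)
Lemma cvx_quad_approx v : (0 < n)%N ->
  (forall k, s * (W%:R + 1) <= v 0 k <= s * M%:R - s * W%:R) ->
  `|psi (x + ctr + v) - Q v| <= 7 * E + 6 * (n%:R ^+ 2 * C * (s * W%:R) ^+ 2).
Proof.
move=> n0 Hv; have s0' := s0.
have W1 : 1 <= W%:R :> R by rewrite ler1n.
have W0r : 0 <= W%:R :> R by [].
have k0 : 'I_n by exact: (Ordinal n0).
have M0 : (0 < M)%N.
  have /andP[h1 h2] := Hv k0; have h3 : 0 <= s * W%:R by rewrite mulr_ge0 // ltW.
  have : 0 < s * M%:R by lra.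
  by rewrite pmulr_rgt0 // ltr0n.
pose j k := Num.truncn (v 0 k / s).
have vs0 k : 0 <= v 0 k / s.
  have /andP[h1 h2] := Hv k; rewrite divr_ge0 ?(ltW s0) //.
  by apply: le_trans h1; rewrite mulr_ge0 ?(ltW s0) // addr_ge0.
have jP k : (j k)%:R <= v 0 k / s < (j k).+1%:R by rewrite truncn_itv.
have jv k : s * (j k)%:R <= v 0 k < s * (j k)%:R + s.
  have /andP[] := jP k; rewrite ler_pdivlMr // ltr_pdivrMr // -natr1 => h1 h2.
  by apply/andP; split; lra.
have Wj k : (W <= j k)%N.
  rewrite -(ler_nat R); have /andP[h1 h2] := Hv k; have /andP[h3 h4] := jv k.
  by rewrite -(ler_pM2l s0); lra.
have jM k : (j k + W <= M)%N.
  rewrite -(ler_nat R) natrD; have /andP[h1 h2] := Hv k; have /andP[h3 h4] := jv k.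
  by rewrite -(ler_pM2l s0); lra.
pose v1 := s *: natvec R j.
have lo := lattice_lower Wj jM; rewrite -/v1 in lo.
have s2 : 0 <= C * s ^+ 2 by rewrite mulr_ge0 // sqr_ge0.
have nn : n%:R <= n%:R ^+ 2 :> R by rewrite -natrX ler_nat leq_pmull.
have n0r : 0 <= n%:R :> R by [].
have WW : s ^+ 2 <= (s * W%:R) ^+ 2.
  by rewrite exprMn ler_peMr ?sqr_ge0 // expr_ge1.
set K := n%:R ^+ 2 * C * (s * W%:R) ^+ 2.
have K1 : n%:R * C * s ^+ 2 <= K.
  have -> : K = n%:R ^+ 2 * (C * (s * W%:R) ^+ 2) by rewrite /K mulrA.
  rewrite -mulrA; apply: (@ler_pM _ n%:R (n%:R ^+ 2) (C * s ^+ 2)) => //.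
  exact: ler_wpM2l.
have K2 : n%:R ^+ 2 * C * s * s <= K.
  by rewrite /K -mulrA -expr2 ler_wpM2l // mulr_ge0 // sqr_ge0.
have box_v k : 0 <= v 0 k <= s * M%:R.
  have /andP[h1 h2] := Hv k; have h3 : 0 <= s * W%:R by rewrite mulr_ge0 // ltW.
  by apply/andP; split; lra.
have up := box_upper M0 box_v.
pose d := v - v1.
have dk k : `|d 0 k| <= s.
  have /andP[h1 h2] := jv k; rewrite !mxE ler_norml; apply/andP; split; lra.
have box_v' k : 0 <= (v1 - d) 0 k <= s * M%:R.
  have /andP[h1 h2] := jv k; have /andP[h3 h4] := Hv k; rewrite !mxE.
  have h5 : 0 <= s * W%:R by rewrite mulr_ge0 // ltW.
  have h6 : s <= s * W%:R by rewrite ler_peMr // ltW.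
  by apply/andP; split; lra.
have up' := box_upper M0 box_v'.
have mid := cvx_midpoint (x + ctr + v1) d psi_cvx.
have E1 : x + ctr + v1 + d = x + ctr + v by rewrite /d -addrA (addrC v1) subrK.
have E2 : x + ctr + v1 - d = x + ctr + (v1 - d) by rewrite addrA.
rewrite E1 E2 in mid.
have QQ := QD v1 d; have E3 : v1 + d = v by rewrite /d addrC subrK.
rewrite E3 in QQ.
have dd := bil_le HC dk dk; move: dd; rewrite ler_norml => /andP[d1 d2].
have E0 : 0 <= E by apply: le_trans (F_quad (fun k => leq_trans (leq_addr W (j k)) (jM k))).
have K0 : 0 <= K by rewrite /K mulr_ge0 ?sqr_ge0 // mulr_ge0 // sqr_ge0.
have lo' : Q v1 - 3 * E - 2 * K <= psi (x + ctr + v1).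
  by apply: le_trans lo; rewrite /K expr2 !mulrA lexx.
by rewrite ler_norml; apply/andP; split; lra.
Qed.

End ConvexFromAverages.

(** * Bounds on averaged second differences *)

Section SecondOrder.
Variables (R : realType) (n : nat).
Implicit Types (x y z v : 'rV[R]_n) (k l : 'I_n).

Definition coord_lipschitz (L : R) (psi : 'rV[R]_n -> R) :=
  forall y k (t : R), `|psi (y + t *: delta_mx 0 k) - psi y| <= L * `|t|.

Definition sdiff (psi : 'rV[R]_n -> R) (s : R) (kl : 'I_n * 'I_n) y : R :=
  diff2 psi (s *: dvec R kl.1 kl.2) y / s ^+ 2.

Lemma sdiff_ge0 psi s kl y : cvx psi -> 0 <= sdiff psi s kl y.
Proof. by move=> Hc; rewrite divr_ge0 ?sqr_ge0 // cvx_diff2_ge0. Qed.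

(** A discrete form of the finite mass of the Hessian measure: second differences telescope to first
    differences on the faces, each of size at most [2 * (L * s)]. Only the side [s * m] of the cube
    enters the bound. *)
Lemma dens_sdiff_le psi L s kl m x : coord_lipschitz L psi -> 0 < s ->
  (0 < m)%N -> dens s (sdiff psi s kl) m x <= 8 * L / (s * m%:R).
Proof.
move=> HL s0 m0; case: kl => k l.
have m0r : 0 < m%:R :> R by rewrite ltr0n.
pose v := s *: dvec R k l.
pose E (o : 'rV[R]_n) : R := psi (x + s *: o + v) - psi (x + s *: o).
have L0 : 0 <= L by have := le_trans (normr_ge0 _) (HL 0 k 1); rewrite normr1 mulr1.
have Eb o : `|E o| <= 2 * (L * s).
  rewrite /E /v /dvec scalerDr addrA.
  set y := x + s *: o.
  have h1 := HL y k s; have h2 := HL (y + s *: delta_mx 0 k) l (s * (k != l)%:R).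
  have h3 : L * `|s * (k != l)%:R| <= L * s.
    apply: ler_wpM2l => //; rewrite normrM (gtr0_norm s0).
    by case: eqP => _ /=; rewrite ?normr1 ?mulr1 // normr0 mulr0 ltW.
  rewrite (gtr0_norm s0) in h1; move: h1 h2 h3; rewrite scalerA.
  by rewrite !ler_norml => /andP[? ?] /andP[? ?] ?; apply/andP; split; lra.
have tele q E' : (forall o, `|E' o| <= 2 * (L * s)) ->
    box (enum 'I_n) m (fun o => E' (o + delta_mx 0 q) - E' o) <=
    4 * (L * s) * (m ^ n)%:R / m%:R.
  move=> E'b; rewrite ler_pdivlMr //.
  have := @box_telescope R n (enum 'I_n) m q E' _ (mem_enum _ _) E'b.
  rewrite size_enum_ord => h; apply: le_trans (le_trans h _); last by lra.
  by rewrite ler_wpM2r // ler_norm.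
have dE o : sdiff psi s (k, l) (x + s *: o) =
    s ^- 2 * ((E (o + delta_mx 0 k) - E o) +
      (k != l)%:R * (E (o + delta_mx 0 l + delta_mx 0 k) - E (o + delta_mx 0 k))).
  rewrite /sdiff /= mulrC; congr (_ * _); rewrite /diff2 -/v.
  have [kl|kl] := eqVneq k l.
    rewrite mul0r addr0 /E.
    have -> : x + s *: (o + 'e_k) = x + s *: o + v.
      by rewrite /v /dvec kl eqxx scale0r addr0 scalerDr addrA.
    ring.
  rewrite mul1r.
  have -> : E (o + 'e_l + 'e_k) = psi (x + s *: o + v + v) - psi (x + s *: o + v).
    by rewrite /E; congr (psi _ - psi _); apply/rowP => q; rewrite /v /dvec kl !mxE /=; ring.
  have -> : E o = psi (x + s *: o + v) - psi (x + s *: o) by [].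
  ring.
rewrite /dens (eq_cavg m dE) cavgZ /cavg boxD boxZ.
have t1 := tele k E Eb.
have t2 : (k != l)%:R * box (enum 'I_n) m
    (fun o => E (o + 'e_l + 'e_k) - E (o + 'e_k)) <= 4 * (L * s) * (m ^ n)%:R / m%:R.
  case: eqP => _ /=; last by rewrite mul1r; apply: (tele l (fun o => E (o + 'e_k))) => o.
  by rewrite mul0r divr_ge0 // mulr_ge0 // mulr_ge0 // mulr_ge0 // ltW.
have M0 : 0 < (m ^ n)%:R :> R by exact: expn_gt0r.
have -> : 8 * L / (s * m%:R) =
   s ^- 2 * ((4 * (L * s) * (m ^ n)%:R / m%:R + 4 * (L * s) * (m ^ n)%:R / m%:R) / (m ^ n)%:R).
  by field; rewrite !gt_eqF.
apply: ler_wpM2l; first by rewrite invr_ge0 sqr_ge0.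
by apply: ler_wpM2r; [rewrite invr_ge0 ltW|exact: lerD].
Qed.

Lemma pow_1D_le (a : R) d : 0 <= a <= 1 -> (1 + a) ^+ d <= 1 + (2 ^ d)%:R * a.
Proof.
(* The bound with [2 ^ d - 1], an equality at [a = 1], is the one that passes through the
   induction. *)
move=> /andP[a0 a1]; suff : (1 + a) ^+ d <= 1 + ((2 ^ d)%:R - 1) * a by nra.
elim: d => [|d IH]; first by rewrite expr0 subrr mul0r addr0.
have p1 : 1 <= (2 ^ d)%:R :> R by rewrite ler1n expn_gt0.
rewrite exprS expnS natrM; apply: (le_trans (ler_wpM2l _ IH)); first by lra.
move: (2 ^ d)%:R p1 => p p1.
have : (p - 1) * a * a <= (p - 1) * a by apply: ler_piMr => //; rewrite mulr_ge0 ?subr_ge0.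
nra.
Qed.

Lemma pow_1B_ge (a : R) d : 0 <= a <= 1 -> 1 - (2 ^ d)%:R * a <= (1 - a) ^+ d.
Proof.
move=> /andP[a0 a1]; suff : 1 - ((2 ^ d)%:R - 1) * a <= (1 - a) ^+ d by nra.
elim: d => [|d IH]; first by rewrite expr0 subrr mul0r subr0.
have p1 : 1 <= (2 ^ d)%:R :> R by rewrite ler1n expn_gt0.
have a1' : 0 <= 1 - a by rewrite subr_ge0.
rewrite exprS expnS natrM; apply: (le_trans _ (ler_wpM2l a1' IH)).
move: (2 ^ d)%:R p1 => p p1.
have : 0 <= (p - 1) * (a * a) by rewrite !mulr_ge0 ?subr_ge0.
have : 0 <= (p - 1) * a by rewrite !mulr_ge0 ?subr_ge0.
nra.
Qed.

(** The width [w] absorbs the errors of unaligned windows and [tau] those of the subcubes, half of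
    [eta] each, uniformly in [kap]. *)
Lemma window_choice (K eta : R) : 0 <= K -> 0 < eta ->
  exists w (tau : R), [/\ (1 < w)%N, 0 < tau <= 1 &
    forall kap d : R, 0 <= kap <= K ->
      (1 - w%:R^-1) ^+ n * (kap - tau) <= d <= (1 + w%:R^-1) ^+ n * (kap + tau) ->
      `|d - kap| <= eta].
Proof.
move=> K0 eta0; pose P := (2 ^ n)%:R : R.
have P1 : 1 <= P by rewrite ler1n expn_gt0.
pose tau := Num.min 1 (eta / 2).
have tau0 : 0 < tau by rewrite lt_min ltr01 divr_gt0.
have tau1 : tau <= 1 by rewrite ge_min lexx.
have tau2 : tau <= eta / 2 by rewrite ge_min lexx orbT.
pose q := P * (K + 1) / (eta / 2).
have P0 : 0 <= P by apply: le_trans P1.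
have K10 : 0 <= K + 1 by lra.
have e20 : 0 <= eta / 2 by lra.
have q0 : 0 <= q by apply: divr_ge0 => //; exact: mulr_ge0.
exists (Num.truncn q).+2, tau; split => //; first by rewrite tau0.
set w := (Num.truncn q).+2.
have w0 : 0 < w%:R :> R by rewrite ltr0n.
have qw : q <= w%:R.
  by have /andP[_ /ltW h] := truncn_itv q0; apply: (le_trans h); rewrite ler_nat.
have a01 : 0 <= (w%:R^-1 : R) <= 1.
  by rewrite invr_ge0 ltW //= invf_le1 // ler1n.
have Pw : P * w%:R^-1 * (K + 1) <= eta / 2.
  move: qw; rewrite /q ler_pdivrMr ?divr_gt0 // => h.
  by rewrite mulrAC ler_pdivrMr // mulrC [_ * w%:R]mulrC mulrC.
have up := pow_1D_le n a01; have lo := pow_1B_ge n a01; rewrite -/P in up lo.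
have lo1 : (1 - w%:R^-1) ^+ n <= 1 :> R.
  by case/andP: a01 => h1 h2; apply: exprn_ile1; lra.
have lo0 : 0 <= (1 - w%:R^-1) ^+ n :> R.
  by case/andP: a01 => h1 h2; apply: exprn_ge0; lra.
have e0 : 0 <= P * w%:R^-1 by rewrite mulr_ge0 //; case/andP: a01.
set a := P * w%:R^-1 in up lo Pw e0.
move=> kap d /andP[k0 kK] /andP[d1 d2].
move: up lo lo1 lo0 d1 d2; move: (_ ^+ n) => u; move: (_ ^+ n) => u'.
move=> up lo lo1 lo0 d1 d2.
have h1 : u * (kap + tau) <= (1 + a) * (kap + tau) by apply: ler_wpM2r => //; lra.
have h2 : a * (kap + tau) <= a * (K + 1) by apply: ler_wpM2l => //; lra.
have h3 : kap - tau - a * (K + 1) <= u' * (kap - tau).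
  have h4 : (1 - a) * kap <= u' * kap by apply: ler_wpM2r.
  have h5 : a * kap <= a * (K + 1) by apply: ler_wpM2l => //; lra.
  have h6 : u' * tau <= 1 * tau by apply: ler_wpM2r => //; lra.
  lra.
by rewrite ler_norml; apply/andP; split; lra.
Qed.

End SecondOrder.

(** * Quadratic approximation of a convex function at one scale *)

Section Alexandrov.
Variables (R : realType) (n : nat).
Implicit Types (x y z v : 'rV[R]_n) (k l : 'I_n).

Lemma dens_diff2 psi (s : R) kl W y : 0 < s ->
  diff2 (dens s psi W) (s *: dvec R kl.1 kl.2) y =
  s ^+ 2 * dens s (sdiff psi s kl) W y :> R.
Proof.
move=> s0; rewrite /dens -cavgZ /diff2 -mulNr -cavgZ -!cavgD.
apply: eq_cavg => o; rewrite /sdiff [in RHS]mulrC divfK ?expf_neq0 ?gt_eqF // /diff2.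
set v := s *: dvec _ _ _; rewrite -!(addrAC _ _ (s *: o)).
by rewrite mulNr.
Qed.

Lemma close_of_sqrt (a b c rho : R) : 0 <= a -> 0 <= b -> 0 <= rho <= 1 ->
  Num.sqrt b <= c -> (Num.sqrt a - Num.sqrt b) ^+ 2 <= rho ^+ 2 ->
  `|a - b| <= rho * (2 * c + 1).
Proof.
move=> a0 b0 /andP[r0 r1] bc; rewrite -[X in X <= _]real_normK ?num_real // ler_sqr ?nnegrE // => h.
rewrite -{1}(sqr_sqrtr a0) -{1}(sqr_sqrtr b0) subr_sqr normrM.
have sa := sqrtr_ge0 a; have sb := sqrtr_ge0 b.
apply: ler_pM => //; move: h; rewrite ler_norml => /andP[h1 h2].
by rewrite ger0_norm ?addr_ge0 //; lra.
Qed.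

Lemma polar_le (kap : 'I_n -> 'I_n -> R) (K : R) k l :
  (forall k l, 0 <= kap k l <= K) -> `|polar kap k l| <= 2 * K.
Proof.
move=> H; rewrite mxE; have /andP[? ?] := H k l; have /andP[? ?] := H k k.
have /andP[? ?] := H l l.
by rewrite ler_norml; case: eqP => _; apply/andP; split; lra.
Qed.

(* Replaces Alexandrov's theorem: second-order differentiability up to [eps], at a single
   scale [r]; it matters that [C] does not depend on [eps]. *)
Lemma cvx_almost_quadratic (psi : 'rV[R]_n -> R) (L R0 : R) : (0 < n)%N ->
  cvx psi -> coord_lipschitz L psi -> 0 < R0 ->
  exists2 C : R, 0 <= C & forall eps : R, 0 < eps ->
  exists (p : 'rV[R]_n) (r : R) (H : 'M[R]_n) (b : 'rV[R]_n), [/\ 0 < r <= R0, forall k, 0 <= p 0 k <= R0,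
    H^T = H, forall k l, `|H k l| <= C &
    forall z, (forall k, `|z 0 k| <= r) ->
      `|psi (p + z) - psi p - dot b z - 2^-1 * bil H z z| <= eps * r ^+ 2].
Proof.
move=> n0 psi_cvx psiL R00.
have k0 : 'I_n := Ordinal n0.
have L0 : 0 <= L by have := le_trans (normr_ge0 _) (psiL 0 k0 1); rewrite normr1 mulr1.
(* Bound for [sqdens] on a root cube of side [R0]. It depends on neither the mesh nor [eps], and
   [sqdens] does not increase along the descent. *)
pose C2 := \sum_(kl : 'I_n * 'I_n) Num.sqrt (8 * L / R0).
have C20 : 0 <= C2 by apply: sumr_ge0 => *; exact: sqrtr_ge0.
have C22 : 0 <= C2 ^+ 2 by exact: sqr_ge0.
pose C := 2 * C2 ^+ 2.
have C0 : 0 <= C by rewrite mulr_ge0.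
exists C => // eps eps0.
have n0r : 0 < n%:R :> R by rewrite ltr0n.
have nn0 : 0 < n%:R ^+ 2 :> R by rewrite exprn_gt0.
(* The lattice error [E] below is [64 * n%:R ^+ 2 * eta * r ^+ 2], so that [7 * E] is a quarter of
   [eps * r ^+ 2]. *)
pose eta := eps / (28 * (64 * n%:R ^+ 2)).
have eta0 : 0 < eta by rewrite divr_gt0 // mulr_gt0 ?ltr0n // mulr_gt0 ?ltr0n.
have [w [tau [w1 /andP[tau0 tau1] Hw]]] := window_choice n C22 eta0.
have w0 : (0 < w)%N := ltnW w1.
(* [q] is the ratio of the final radius [r] to the side of the averaging window; this size makes the
   second error of [cvx_quad_approx] at most another quarter of [eps * r ^+ 2]. *)
pose q0 := 24 * n%:R ^+ 2 * C / eps.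
have q00 : 0 <= q0 by rewrite divr_ge0 ?(ltW eps0) // mulr_ge0 // mulr_ge0 // ltW.
pose q := (Num.truncn q0).+2.
have q0q : q0 <= q%:R.
  by have /andP[_ /ltW h] := truncn_itv q00; apply: (le_trans h); rewrite ler_nat.
pose A := (w * q)%N.
(* Number of subcubes per side. The lattice indices go up to [B + 2], with [B = n * (4 * A * l)],
   and a block of [w + 1] subcubes must still fit beyond them; two more subcubes absorb the 2. *)
pose m := (n * (4 * A) + w + 3)%N.
have m0 : (0 < m)%N by rewrite /m addn_gt0 orbT.
pose rho := tau / (2 * C2 + 1).
have den0 : 0 < 2 * C2 + 1 by lra.
have rho0 : 0 < rho by rewrite divr_gt0.
have rho1 : rho <= 1 by rewrite ler_pdivrMr // mul1r; lra.
have rhotau : rho * (2 * C2 + 1) = tau by rewrite divfK // gt_eqF.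
have mn0 : 0 < (m ^ n)%:R :> R by exact: expn_gt0r.
(* Chosen so that [stable_cube_dens] brings square roots within [rho], and then [close_of_sqrt]
   brings the averages themselves within [tau]. *)
pose theta := rho ^+ 2 / (2 * (C2 + 1) * (m ^ n)%:R).
have den2 : 0 < 2 * (C2 + 1) * (m ^ n)%:R by rewrite mulr_gt0 //; lra.
have theta0 : 0 < theta by rewrite divr_gt0 // exprn_gt0.
have Ctheta : 2 * C2 * (m ^ n)%:R * theta <= rho ^+ 2.
  rewrite /theta mulrA ler_pdivrMr // mulrC ler_wpM2l ?sqr_ge0 //.
  by rewrite ler_wpM2r // ?ltW //; lra.
pose T := (Num.truncn (C2 / theta)).+1.
have CT : C2 < T%:R * theta.
  have h : 0 <= C2 / theta by rewrite divr_ge0 // ltW.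
  by have /andP[_] := truncn_itv h; rewrite ltr_pdivrMr.
(* The mesh is fixed last: after at most [T] subdivisions of a cube of side [R0], the descent must
   have stopped. *)
pose s := R0 / (m ^ T)%:R.
have mT0 : 0 < (m ^ T)%:R :> R by rewrite ltr0n expn_gt0 m0.
have s0 : 0 < s by rewrite divr_gt0.
have smT : s * (m ^ T)%:R = R0 by rewrite divfK // gt_eqF.
pose g := sdiff psi s.
have g0 kl y : 0 <= g kl y by exact: sdiff_ge0.
have root : sqdens s g (m ^ T) 0 <= C2.
  apply: ler_sum => kl _; apply: ler_wsqrtr.
  by rewrite -[in leRHS]smT; apply: dens_sdiff_le => //; rewrite expn_gt0 m0.
have [t [x [tT xR xle xch]]] := stable_cube (ltW s0) theta0 m0 (le_lt_trans root CT).
pose l := (m ^ t)%N.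
have l0 : (0 < l)%N by rewrite expn_gt0 m0.
rewrite expnS -/l in xle xch xR; rewrite smT in xR.
have PhiC : sqdens s g (m * l) x <= C2 by exact: le_trans xle root.
pose kap k k' := dens s (g (k, k')) (m * l) x.
have kapC k k' : kap k k' = kap k' k.
  by apply: eq_cavg => o; rewrite /g /sdiff /= dvecC.
have kap0 k k' : 0 <= kap k k' by apply: dens_ge0.
have kapsq k k' : Num.sqrt (kap k k') <= C2.
  apply: le_trans PhiC; rewrite /sqdens (bigD1 (k, k')) //= lerDl.
  by apply: sumr_ge0 => *; exact: sqrtr_ge0.
have kapK k k' : kap k k' <= C2 ^+ 2.
  rewrite -[leLHS](sqr_sqrtr (kap0 k k')).
  by rewrite ler_pXn2r ?nnegrE ?sqrtr_ge0 // kapsq.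
have child k k' (j : 'I_n -> nat) : (forall i, (j i < m)%N) ->
    `|dens s (g (k, k')) l (x + (s * l%:R) *: natvec R j) - kap k k'| <= tau.
  move=> jm; rewrite -rhotau; apply: close_of_sqrt => //.
  - by apply: dens_ge0.
  - by rewrite ltW.
  - have := stable_cube_dens (k, k') g0 m0 xch jm; move/le_trans; apply.
    apply: le_trans Ctheta; apply: ler_wpM2r; first exact: ltW.
    by apply: ler_wpM2r; [exact: ltW|rewrite ler_wpM2l].
pose W := (w * l)%N; pose M := (4 * A * l)%N; pose B := (n * M)%N.
have W0 : (0 < W)%N by rewrite muln_gt0 w0.
pose sig := s * l%:R.
have sig0 : 0 < sig by rewrite mulr_gt0 // ltr0n.
have win k k' (j : 'I_n -> nat) : (forall i, j i <= B + 2)%N ->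
   `|diff2 (dens s psi W) (s *: dvec R k k') (x + s *: natvec R j) - s ^+ 2 * kap k k'|
   <= eta * s ^+ 2.
  move=> jB; rewrite (dens_diff2 psi (k, k')) // -mulrBr normrM ger0_norm ?sqr_ge0 //.
  rewrite [leRHS]mulrC; apply: ler_wpM2l; first exact: sqr_ge0.
  apply: Hw; first by rewrite kap0 kapK.
  apply: (@window_dens _ _ _ _ m) => //; first exact: child.
  move=> i; have := jB i; rewrite /B /M /m; move: l0; clear; nia.
have [c [b Hq]] := quad_on_lattice s0 (mulr_ge0 (ltW eta0) (sqr_ge0 s)) kapC win.
pose H := polar kap; have HT : H^T = H := polar_sym kapC.
have HC k k' : `|H k k'| <= C.
  by apply: polar_le => i i'; rewrite kap0 kapK.
pose r := sig * A%:R.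
have A0 : (0 < A)%N by rewrite muln_gt0 w0.
have r0 : 0 < r by rewrite mulr_gt0 // ltr0n.
pose E := 4 * (eta * s ^+ 2) * B%:R ^+ 2.
have Fq j : (forall k, j k <= M)%N ->
   `|dens s psi W (x + s *: natvec R j) - (c + dot b (s *: natvec R j)
      + 2^-1 * bil H (s *: natvec R j) (s *: natvec R j))| <= E.
  move=> jM; have sB : (\sum_k j k <= B)%N.
    apply: (@leq_trans (\sum_(k < n) M)%N); first by apply: leq_sum => k _.
    by rewrite sum_nat_const card_ord.
  apply: le_trans (Hq j sB) _; rewrite /E ler_wpM2l //.
    by rewrite mulr_ge0 // mulr_ge0 ?sqr_ge0 // ltW.
  by rewrite ler_pXn2r ?nnegrE // ler_nat.
have approx := cvx_quad_approx psi_cvx s0 HT W0 C0 HC Fq.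
pose ctr : 'rV[R]_n := const_mx (s * W.-1%:R / 2).
(* Centre of the box of side [4 * r]. A displacement of at most [r] leaves a margin of [r] to each
   face, which exceeds the window since [q] is at least 2. *)
pose v0 : 'rV[R]_n := const_mx (2 * r).
pose Q v := c + dot b v + 2^-1 * bil H v v.
have ME : s * M%:R = 4 * r by rewrite /M /r /sig !natrM; ring.
have WE : s * W%:R = sig * w%:R by rewrite /W /sig !natrM; ring.
have wA : 2 * (sig * w%:R) <= r.
  rewrite /r /A natrM [leRHS]mulrA [leLHS]mulrC ler_wpM2l ?ler_nat // mulr_ge0 //.
  exact: ltW.
have s_sigw : s <= sig * w%:R.
  rewrite -WE ler_peMr ?(ltW s0) // ler1n //.
have close z : (forall k, `|z 0 k| <= r) ->
    `|psi (x + ctr + (v0 + z)) - Q (v0 + z)| <= 2^-1 * eps * r ^+ 2.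
  move=> zr; apply: le_trans (approx (v0 + z) n0 _) _.
    move=> k; have := zr k; rewrite !mxE mulrDr mulr1 ME WE ler_norml => /andP[z1 z2].
    move: wA s_sigw z1 z2; move: (z 0 k) (sig * w%:R) (r) (s); clear=> a b c d *.
    by apply/andP; split; lra.
  have -> : E = 64 * n%:R ^+ 2 * eta * r ^+ 2.
    by rewrite /E /B /M /r /sig !natrM; ring.
  have -> : 7 * (64 * n%:R ^+ 2 * eta * r ^+ 2) = 4^-1 * eps * r ^+ 2.
    rewrite /eta; field; by rewrite gt_eqF.
  suff : n%:R ^+ 2 * C * (s * W%:R) ^+ 2 <= 24^-1 * eps * r ^+ 2.
    by move: (_ * (s * W%:R) ^+ 2) (r ^+ 2); clear=> a b; lra.
  rewrite WE; have -> : r ^+ 2 = q%:R ^+ 2 * (sig * w%:R) ^+ 2.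
    by rewrite /r /A natrM; ring.
  rewrite [leRHS]mulrA; apply: ler_wpM2r; first exact: sqr_ge0.
  have : q0 <= q%:R ^+ 2.
    by apply: (le_trans q0q); rewrite expr2 ler_peMl // ler1n.
  rewrite /q0 ler_pdivrMr // -mulrA; move: (n%:R ^+ 2 * C) (q%:R ^+ 2); clear=> a b'; lra.
have ctr0 k : 0 <= ctr 0 k <= sig * w%:R.
  rewrite mxE -WE.
  have h1 : 0 <= s * W.-1%:R by rewrite mulr_ge0 // ltW.
  have h2 : s * W.-1%:R <= s * W%:R by rewrite ler_pM2l // ler_nat leq_pred.
  by move: h1 h2; move: (s * W.-1%:R) (s * W%:R); clear=> a b *; apply/andP; split; lra.
have mE : s * (m * l)%:R = n%:R * 4 * r + sig * w%:R + 3 * sig.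
  by rewrite /m /r /sig !(natrM, natrD); ring.
have n1r : 1 <= n%:R :> R by rewrite ler1n.
have nr : r <= n%:R * r by rewrite ler_peMl // ltW.
exists (x + ctr + v0), r, H, (b + v0 *m H); split => //.
- rewrite r0 /=; have /andP[h1 h2] := xR k0; rewrite mE in h2.
  have /andP[h3 h4] := ctr0 k0.
  move: (le_trans h1 h2) nr r0 sig0 (le_trans h3 h4).
  rewrite -[n%:R * 4 * r]mulrA (mulrCA n%:R).
  by move: (sig * w%:R) (n%:R * r); clear=> a b *; lra.
- move=> k; have /andP[h1 h2] := xR k; have /andP[h3 h4] := ctr0 k.
  rewrite mE !mxE subr0 in h1 h2; rewrite ![_ 0 k]mxE -[const_mx _ 0 k]/(ctr 0 k).
  rewrite [v0 0 k]mxE.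
  move: h1 h2 h3 h4 nr r0 sig0; rewrite -[n%:R * 4 * r]mulrA (mulrCA n%:R).
  move: (x 0 k) (ctr 0 k) (sig * w%:R) (n%:R * r); clear=> a b c d *.
  by apply/andP; split; lra.
- move=> z zr; have c1 := close z zr.
  have {close} c2 : `|psi (x + ctr + v0) - Q v0| <= 2^-1 * eps * r ^+ 2.
    by have := close 0; rewrite addr0; apply => k; rewrite mxE normr0 ltW.
  have QE : Q (v0 + z) - Q v0 = dot (b + v0 *m H) z + 2^-1 * bil H z z.
    rewrite dotDl -/(bil H v0 z) /Q !(bilDl, bilDr, dotDr) (bilC z v0 HT).
    by field.
  have <- : x + ctr + (v0 + z) = x + ctr + v0 + z by rewrite addrA.
  move: c1 c2 QE; rewrite -[2^-1 * eps * _]mulrA.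
  move: (psi _) (psi _) (Q _) (Q _) (dot _ _) (bil _ _ _) (eps * _); clear.
  move=> a b c d e f g.
  by rewrite !ler_norml => /andP[? ?] /andP[? ?] ?; apply/andP; split; lra.
Qed.

End Alexandrov.

(** * The Euclidean norm *)

Section EuclideanNorm.
Variables (R : realType) (n : nat).
Implicit Types (x y z : 'rV[R]_n) (H : 'M[R]_n).

Lemma enorm_dot x : enorm x = Num.sqrt (dot x x).
Proof. by congr Num.sqrt; apply: eq_bigr => k _; rewrite expr2. Qed.

Lemma enorm_ge0 x : 0 <= enorm x.
Proof. exact: sqrtr_ge0. Qed.

Lemma enorm_sqr x : enorm x ^+ 2 = dot x x.
Proof. by rewrite enorm_dot sqr_sqrtr // dot_ge0. Qed.

Lemma enormZ a x : enorm (a *: x) = `|a| * enorm x.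
Proof.
by rewrite !enorm_dot dotZl dotZr mulrA -expr2 sqrtrM ?sqr_ge0 // sqrtr_sqr.
Qed.

Lemma enormN x : enorm (- x) = enorm x.
Proof. by rewrite -scaleN1r enormZ normrN normr1 mul1r. Qed.

Lemma enorm0 : enorm (0 : 'rV[R]_n) = 0.
Proof. by rewrite -(scale0r 0) enormZ normr0 mul0r. Qed.

Lemma enorm_eq0 x : enorm x = 0 -> x = 0.
Proof. by move=> x0; apply: dot_eq0; rewrite -enorm_sqr x0 expr0n. Qed.

Lemma enorm_le x (a : R) : 0 <= a -> dot x x <= a ^+ 2 -> enorm x <= a.
Proof. by move=> a0 h; rewrite -(ler_sqr (enorm_ge0 x) a0) enorm_sqr. Qed.

Lemma dot_le_enorm x y : `|dot x y| <= enorm x * enorm y.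
Proof.
rewrite -ler_sqr ?nnegrE ?mulr_ge0 ?enorm_ge0 // real_normK ?num_real //.
by rewrite exprMn !enorm_sqr cauchy_schwarz.
Qed.

Lemma enormD x y : enorm (x + y) <= enorm x + enorm y.
Proof.
apply: enorm_le; first by rewrite addr_ge0 ?enorm_ge0.
rewrite !dotE (dotC y x) sqrrD -!enorm_sqr.
by have := le_trans (ler_norm _) (dot_le_enorm x y); lra.
Qed.

Lemma enormB x y : enorm (x - y) <= enorm x + enorm y.
Proof. by rewrite -(enormN y) enormD. Qed.

Lemma coord_le_enorm x k : `|x 0 k| <= enorm x.
Proof.
rewrite -ler_sqr ?nnegrE ?enorm_ge0 // real_normK ?num_real // enorm_sqr.
exact: coord_sqr_le.
Qed.

Lemma enorm_le_sup x (a : R) : 0 <= a -> (forall k, `|x 0 k| <= a) ->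
  enorm x <= n%:R * a.
Proof.
move=> a0 xa; apply: enorm_le; first by rewrite mulr_ge0.
apply: (@le_trans _ _ (\sum_(k < n) a ^+ 2)).
  apply: ler_sum => k _; rewrite -expr2 -[leLHS]real_normK ?num_real //.
  by rewrite ler_sqr ?nnegrE.
rewrite sumr_const card_ord -[leLHS]mulr_natl exprMn ler_wpM2r ?sqr_ge0 //.
by case: n => [|m]; rewrite ?expr0n // expr2 ler_peMl // ler1n.
Qed.

Lemma bil_le_enorm H (C : R) x y : (forall k l, `|H k l| <= C) ->
  `|bil H x y| <= n%:R ^+ 2 * C * enorm x * enorm y.
Proof. by move=> HC; apply: bil_le => // k; exact: coord_le_enorm. Qed.

Lemma enorm_le_dual x (a t : R) : 0 <= a -> 0 < t ->
  (forall d, enorm d <= t -> dot d x <= a) -> t * enorm x <= a.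
Proof.
move=> a0 t0 H; have [x0|x0] := eqVneq (enorm x) 0; first by rewrite x0 mulr0.
have xp : 0 < enorm x by rewrite lt_def x0 enorm_ge0.
have := H ((t / enorm x) *: x); rewrite enormZ ger0_norm ?divr_ge0 ?(ltW t0) ?enorm_ge0 //.
rewrite divfK // lexx dotZl -enorm_sqr expr2 mulrA divfK // => h; exact: h.
Qed.

End EuclideanNorm.

(** * Suprema of affine functions *)

Section SupportFunction.
Variables (R : realType) (n : nat).

(** Source of the convex function to which the quadratic approximation is applied. Near maximisers
    replace maximisers, so attainment is never at issue. *)
Lemma sup_affine (T : Type) (S : set T) (a : T -> R) (z : T -> 'rV[R]_n) (M L : R) :
  S !=set0 -> (forall i, S i -> a i <= M) -> (forall i k, S i -> `|z i 0 k| <= L) ->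
  exists Psi : 'rV[R]_n -> R, [/\ cvx Psi, coord_lipschitz L Psi,
    forall i P, S i -> a i + dot P (z i) <= Psi P &
    forall P (e : R), 0 < e -> exists2 i, S i & Psi P - e < a i + dot P (z i)].
Proof.
move=> [i0 Si0] aM zL.
pose A P := [set a i + dot P (z i) | i in S].
have hsA P : has_sup (A P).
  split; first by exists (a i0 + dot P (z i0)), i0.
  exists (M + enorm P * (n%:R * L)) => _ [i Si <-]; apply: lerD; first exact: aM.
  apply: (le_trans (ler_norm _)); apply: (le_trans (dot_le_enorm _ _)).
  apply: ler_wpM2l; first exact: enorm_ge0.
  case: (posnP n) => [n0|n0].
    have -> : z i = 0 by apply/rowP => k; exfalso; move: k; rewrite n0 => -[].
    by rewrite enorm0 n0 mul0r.
  apply: enorm_le_sup => [|k]; last exact: zL.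
  exact: le_trans (normr_ge0 _) (zL i (Ordinal n0) Si).
have ub i P : S i -> a i + dot P (z i) <= sup (A P).
  by move=> Si; apply: ub_le_sup; [exact: (hsA P).2|exists i].
have near P (e : R) : 0 < e -> exists2 i, S i & sup (A P) - e < a i + dot P (z i).
  by move=> e0; have [_ [i Si <-] h] := sup_adherent e0 (hsA P); exists i.
have le_sup P (b : R) : (forall i, S i -> a i + dot P (z i) <= b) -> sup (A P) <= b.
  by move=> h; apply: ge_sup; [exact: (hsA P).1|move=> _ [i Si <-]; exact: h].
exists (fun P => sup (A P)); split => //.
- move=> x y t /andP[t0 t1]; apply: le_sup => i Si; rewrite dotDl !dotZl.
  have t1' : 0 <= 1 - t by rewrite subr_ge0.
  have := ler_wpM2l t0 (ub i x Si); have := ler_wpM2l t1' (ub i y Si); lra.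
- have half y k t : sup (A (y + t *: 'e_k)) - sup (A y) <= L * `|t|.
    rewrite lerBlDr; apply: le_sup => i Si; rewrite dotDl dotZl (dotC 'e_k) dot_delta.
    have := ub i y Si.
    have : t * z i 0 k <= L * `|t|.
      by apply: (le_trans (ler_norm _)); rewrite normrM mulrC ler_wpM2r // zL.
    lra.
  move=> y k t; rewrite ler_norml half andbT lerNl opprB.
  by have := half (y + t *: 'e_k) k (- t); rewrite scaleNr addrK normrN.
Qed.

End SupportFunction.

(** * Block vectors and positive definite matrices *)

Section Blocks.
Variables (R : realType) (N : nat).
Implicit Types (x y p q : 'rV[R]_N) (S : 'M[R]_(N + N)).

Lemma dot_row x y p q : dot (row_mx x y) (row_mx p q) = dot x p + dot y q.
Proof.
by rewrite /dot big_split_ord /=; congr (_ + _); apply: eq_bigr => k _;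
  rewrite ?row_mxEl ?row_mxEr.
Qed.

Lemma enorm_row x y : enorm (row_mx x y) ^+ 2 = enorm x ^+ 2 + enorm y ^+ 2.
Proof. by rewrite !enorm_sqr dot_row. Qed.

Lemma enorm_row0 x : enorm (row_mx x (0 : 'rV[R]_N)) = enorm x.
Proof. by rewrite !enorm_dot dot_row dot0r addr0. Qed.

Lemma enorm_0row x : enorm (row_mx (0 : 'rV[R]_N) x) = enorm x.
Proof. by rewrite !enorm_dot dot_row dot0r add0r. Qed.

Lemma enorm_row_le x y : enorm (row_mx x y) <= enorm x + enorm y.
Proof.
have -> : row_mx x y = row_mx x 0 + row_mx 0 y by rewrite add_row_mx addr0 add0r.
by rewrite -(enorm_row0 x) -(enorm_0row y) enormD.
Qed.

Lemma enorm_lsub_le x y : enorm x <= enorm (row_mx x y).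
Proof.
by apply: enorm_le; rewrite ?enorm_ge0 // enorm_row -enorm_sqr lerDl sqr_ge0.
Qed.

Lemma enorm_rsub_le x y : enorm y <= enorm (row_mx x y).
Proof.
by apply: enorm_le; rewrite ?enorm_ge0 // enorm_row -enorm_sqr lerDr sqr_ge0.
Qed.

Lemma bil_ul S x y : bil S (row_mx x 0) (row_mx y 0) = bil (ulsubmx S) x y.
Proof.
rewrite /bil -{1}(submxK S) mul_row_block !mul0mx !addr0 dot_row dot0r addr0.
by [].
Qed.

Lemma bil_dr S x y : bil S (row_mx 0 x) (row_mx 0 y) = bil (drsubmx S) x y.
Proof.
rewrite /bil -{1}(submxK S) mul_row_block !mul0mx !add0r dot_row dot0r add0r.
by [].
Qed.

End Blocks.

Section PositiveDefinite.
Variables (R : realType) (n : nat) (H : 'M[R]_n) (alpha : R).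
Hypotheses (alpha0 : 0 < alpha) (HT : H^T = H).
Hypothesis H_pos : forall x, alpha * dot x x <= bil H x x.

Lemma posdef_unitmx : H \in unitmx.
Proof.
rewrite -row_free_unit; apply: inj_row_free => x xH.
apply/dot_eq0/eqP; rewrite eq_le dot_ge0 andbT.
by have := H_pos x; rewrite /bil xH dot0l pmulr_rle0.
Qed.

Lemma posdef_inv_sym : (invmx H)^T = invmx H.
Proof. by rewrite trmx_inv HT. Qed.

Lemma enorm_inv_le x : enorm (x *m invmx H) <= enorm x / alpha.
Proof.
set y := x *m invmx H; have yH : y *m H = x by rewrite /y mulmxKV // posdef_unitmx.
have [y0|y0] := eqVneq (enorm y) 0; first by rewrite y0 divr_ge0 ?enorm_ge0 // ltW.
have yp : 0 < enorm y by rewrite lt_def y0 enorm_ge0.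
rewrite ler_pdivlMr // -(ler_pM2l yp).
have := H_pos y; rewrite /bil yH -enorm_sqr.
have := le_trans (ler_norm _) (dot_le_enorm x y).
by rewrite expr2 => h1 h2; rewrite mulrA [leLHS]mulrC [leRHS]mulrC; exact: le_trans h2 h1.
Qed.

Lemma bil_inv x : bil H (x *m invmx H) (x *m invmx H) = bil (invmx H) x x.
Proof. by rewrite {1}/bil mulmxKV ?posdef_unitmx // dotC. Qed.

Lemma bil_inv_ge0 x : 0 <= bil (invmx H) x x.
Proof.
by rewrite -bil_inv; apply: le_trans (H_pos _); rewrite mulr_ge0 ?dot_ge0 // ltW.
Qed.

End PositiveDefinite.

(** * Doubling of variables and Legendre duality *)

Section TheoremOnSums.
Variables (R : realType) (N : nat) (kappa : R) (D : set 'rV[R]_N) (u v : 'rV[R]_N -> R).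
Implicit Types (x y p q xi eta om ta : 'rV[R]_N).
Local Notation n := (N + N)%N.

(** The supremum over [xi] and [eta] would be the sum of the sup-convolutions of u at [x] and of -v
    at [y], minus the coupling of [x] and [y]. Keeping all four points visible lets u and v
    themselves be estimated. *)
Definition doubled xi eta x y : R := u xi - v eta
  - kappa / 2 * (dot (x - xi) (x - xi) + dot (x - y) (x - y) + dot (y - eta) (y - eta)).

(* Completing the square in [(x, y)]. *)
Lemma doubled_dual p q x y xi eta : kappa != 0 ->
  let dx := x - ((2 / 3) *: xi + (1 / 3) *: eta + (2 / (3 * kappa)) *: p + (1 / (3 * kappa)) *: q) in
  let dy := y - ((1 / 3) *: xi + (2 / 3) *: eta + (1 / (3 * kappa)) *: p + (2 / (3 * kappa)) *: q) in
  u xi - v eta - kappa / 6 * dot (xi - eta) (xi - eta)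
  + dot p ((2 / 3) *: xi + (1 / 3) *: eta) + dot q ((1 / 3) *: xi + (2 / 3) *: eta)
  + (dot p p + dot p q + dot q q) / (3 * kappa)
  = dot p x + dot q y + doubled xi eta x y
    + kappa / 2 * (dot dx dx + dot (dx - dy) (dx - dy) + dot dy dy).
Proof.
move=> k0 /=; rewrite /doubled !dotE.
rewrite ?(dotC q p) ?(dotC x p) ?(dotC y p) ?(dotC xi p) ?(dotC eta p).
rewrite ?(dotC x q) ?(dotC y q) ?(dotC xi q) ?(dotC eta q).
rewrite ?(dotC y x) ?(dotC xi x) ?(dotC eta x) ?(dotC xi y) ?(dotC eta y) ?(dotC eta xi).
by field.
Qed.

(** Only the term |x - y|^2 links the pair [(xi, x)] to the pair [(eta, y)], so the mixed difference
    is its polar form. *)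
Lemma doubled_cross xi eta x y xi0 eta0 x0 y0 :
  doubled xi eta0 x y0 + doubled xi0 eta x0 y =
  doubled xi eta x y + doubled xi0 eta0 x0 y0 - kappa * dot (x - x0) (y - y0).
Proof.
rewrite /doubled !dotE.
rewrite ?(dotC y x) ?(dotC xi x) ?(dotC eta x) ?(dotC xi y) ?(dotC eta y) ?(dotC eta xi).
rewrite ?(dotC x0 x) ?(dotC y0 x) ?(dotC x0 y) ?(dotC y0 y) ?(dotC y0 x0).
rewrite ?(dotC xi0 x) ?(dotC eta0 x) ?(dotC eta0 y) ?(dotC xi0 y) ?(dotC eta0 y0).
rewrite ?(dotC xi x0) ?(dotC xi y0) ?(dotC eta0 x0) ?(dotC xi0 x0) ?(dotC eta x0).
by rewrite ?(dotC eta y0) ?(dotC eta0 xi) ?(dotC xi0 eta) ?(dotC xi0 y0); field.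
Qed.

Section Core.
Variables (psi : 'rV[R]_n -> R) (alpha C delta r : R) (p0 b : 'rV[R]_n) (H : 'M[R]_n).
Hypothesis psi_ge : forall xi eta x y P, D xi -> D eta ->
  dot P (row_mx x y) + doubled xi eta x y <= psi P.
Hypothesis psi_quad : forall p : 'rV[R]_n, enorm p <= r ->
  `|psi (p0 + p) - psi p0 - dot b p - 2^-1 * bil H p p| <= delta ^+ 2 * r ^+ 2.
Hypotheses (kappa0 : 0 < kappa) (alpha0 : 0 < alpha) (r0 : 0 < r) (C0 : 0 <= C).
Hypotheses (delta0 : 0 < delta) (delta1 : delta <= 2^-1).
Hypotheses (HT : H^T = H) (HC : forall k l, `|H k l| <= C).
Hypothesis H_pos : forall z : 'rV[R]_n, alpha * dot z z <= bil H z z.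

Definition contact (p : 'rV[R]_n) xi eta x y := [/\ D xi, D eta &
  psi (p0 + p) - delta ^+ 2 * r ^+ 2 <= dot (p0 + p) (row_mx x y) + doubled xi eta x y].

(** The 3 counts two uses of [psi_quad] and one contact tolerance; the other term bounds half the
    quadratic form of [H]. *)
Let c1 : R := n%:R ^+ 2 * C / 2 + 3.
Let S := invmx H.

Let c1_ge3 : 3 <= c1.
Proof. by rewrite /c1 lerDr divr_ge0 // mulr_ge0 // sqr_ge0. Qed.

(** At a near maximiser, [row_mx x y] is almost a subgradient of [psi], and so almost the gradient
    [b + p *m H] of the model. Testing with increments of length [delta * r] balances errors of
    order [delta ^+ 2 * r ^+ 2], which leaves [delta * r]. *)
Lemma contact_gradient (p : 'rV[R]_n) xi eta x y : enorm p <= r / 2 -> contact p xi eta x y ->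
  enorm (row_mx x y - b - p *m H) <= c1 * delta * r.
Proof.
move=> pr [Dxi Deta Hc]; set z := row_mx x y in Hc *; set g := z - b - _.
have r0' := r0; have d0' := delta0; have d1' := delta1.
have t0 : 0 < delta * r by rewrite mulr_gt0.
have d2 : 0 <= delta ^+ 2 * r ^+ 2 by rewrite mulr_ge0 ?sqr_ge0.
have C2 : 0 <= n%:R ^+ 2 * C by rewrite mulr_ge0 // sqr_ge0.
rewrite -(ler_pM2l t0); apply: (@le_trans _ _ (c1 * (delta ^+ 2 * r ^+ 2))); last first.
  by rewrite le_eqVlt; apply/orP; left; apply/eqP; ring.
apply: enorm_le_dual => //.
- by rewrite mulr_ge0 // (le_trans _ c1_ge3).
- move=> d dt.
  have dr : enorm d <= r / 2.
    by apply: (le_trans dt); rewrite [leRHS]mulrC ler_pM2r.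
  have pdr : enorm (p + d) <= r by apply: (le_trans (enormD _ _)); lra.
  have pr' : enorm p <= r by lra.
  have := psi_ge x y (p0 + p + d) Dxi Deta; rewrite -/z.
  have := psi_quad pdr; have := psi_quad pr'; move: Hc.
  rewrite -(addrA p0 p d); move: (doubled xi eta x y) => dbl.
  rewrite !(dotDl, dotDr, bilDl, bilDr) (bilC d p HT) !ler_norml.
  move=> h1 /andP[h2 h3] /andP[h4 h5] h6.
  have := bil_le_enorm d d HC; rewrite ler_norml => /andP[_ h7].
  have h8 : n%:R ^+ 2 * C * enorm d * enorm d <= n%:R ^+ 2 * C * (delta ^+ 2 * r ^+ 2).
    rewrite -mulrA -expr2 -exprMn ler_wpM2l // ler_sqr ?nnegrE ?enorm_ge0 //.
    exact: ltW.
  rewrite /g !(dotDr, dotNr) (dotC d b) (dotC d (p *m H)) -/(bil H p d).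
  rewrite /c1; move: h1 h2 h3 h4 h5 h6 h7 h8 d2.
  lra.
Qed.

(** The Fenchel-Young inequality with [psi] replaced by its quadratic model; at contact points
    [doubled_lower] is the near equality. *)
Lemma doubled_upper (p : 'rV[R]_n) xi eta x y : D xi -> D eta -> enorm p <= r ->
  doubled xi eta x y <= psi p0 - dot p0 (row_mx x y) - dot p (row_mx x y - b)
    + 2^-1 * bil H p p + delta ^+ 2 * r ^+ 2.
Proof.
move=> Dxi Deta pr; have := psi_ge x y (p0 + p) Dxi Deta; have := psi_quad pr.
rewrite ler_norml => /andP[_]; rewrite !(dotDl, dotDr, dotNr) (dotC p b).
move: (psi _) (psi _) (dot _ _) (dot _ _) (dot _ _) (bil _ _ _) => *; lra.
Qed.

Lemma doubled_lower (p : 'rV[R]_n) xi eta x y : enorm p <= r -> contact p xi eta x y ->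
  psi p0 - dot p0 (row_mx x y) - dot p (row_mx x y - b)
    + 2^-1 * bil H p p - 2 * (delta ^+ 2 * r ^+ 2) <= doubled xi eta x y.
Proof.
move=> pr [_ _]; have := psi_quad pr.
rewrite ler_norml => /andP[+ _]; rewrite !(dotDl, dotDr, dotNr) (dotC p b).
move: (psi _) (psi _) (dot _ _) (dot _ _) (dot _ _) (bil _ _ _) => *; lra.
Qed.

Let enorm_S (z : 'rV[R]_n) : enorm z <= alpha * r / 2 -> enorm (z *m S) <= r / 2.
Proof.
move=> zr; apply: (le_trans (enorm_inv_le alpha0 H_pos z)).
by rewrite ler_pdivrMr // [leRHS]mulrC mulrA.
Qed.

Let delta_sqr : delta ^+ 2 * r ^+ 2 <= delta * r ^+ 2 / 2.
Proof.
rewrite [leRHS]mulrAC ler_wpM2r ?sqr_ge0 // expr2; apply: ler_wpM2l => //; exact: ltW.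
Qed.

Let dot_grad_le (z g : 'rV[R]_n) (a : R) : 0 <= a -> enorm z <= r / 2 ->
  enorm g <= a * (c1 * delta * r) -> `|dot z g| <= a / 2 * c1 * (delta * r ^+ 2).
Proof.
move=> a0 zr gr; apply: (le_trans (dot_le_enorm _ _)).
apply: (le_trans (ler_pM (enorm_ge0 _) (enorm_ge0 _) zr gr)).
by rewrite le_eqVlt; apply/orP; left; apply/eqP; ring.
Qed.

(** [xi0] and [x0] are moved together: |x - xi|^2 is unchanged, so the increment of u is read off
    from [doubled], whose Hessian in [(x, y)] is modelled by [- S]. The term [kappa%:M] compensates
    for |x - y|^2. *)
Lemma upper_touch_left xi0 eta0 x0 y0 ta : contact 0 xi0 eta0 x0 y0 ->
  enorm ta <= alpha * r / 2 -> D (xi0 + ta) ->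
  u (xi0 + ta) <= u xi0 + dot (kappa *: (x0 - y0) - lsubmx p0) ta
    + 2^-1 * bil (kappa%:M - ulsubmx S) ta ta + (c1 + 2) * (delta * r ^+ 2).
Proof.
move=> ct tar Dta; have [Dxi Deta _] := ct.
(* The dual variable at which the gradient of the model is [b + T], so that the Fenchel-Young bound
   is nearly sharp at the moved point. *)
pose T := row_mx ta (0 : 'rV[R]_N); pose p := T *m S.
have pr : enorm p <= r / 2 by apply: enorm_S; rewrite enorm_row0.
have r0' := r0; have pr' : enorm p <= r by lra.
have zr : enorm (0 : 'rV[R]_n) <= r / 2 by rewrite enorm0 divr_ge0 // ltW.
have zr' : enorm (0 : 'rV[R]_n) <= r by rewrite enorm0 ltW.
have up := doubled_upper (x0 + ta) y0 Dta Deta pr'.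
have lo := doubled_lower zr' ct.
have gr := contact_gradient zr ct.
set z0 := row_mx x0 y0 in lo gr.
have zE : row_mx (x0 + ta) y0 = z0 + T by rewrite add_row_mx addr0.
have dE : doubled (xi0 + ta) eta0 (x0 + ta) y0 = doubled xi0 eta0 x0 y0
    + (u (xi0 + ta) - u xi0) - kappa * dot (x0 - y0) ta - kappa / 2 * dot ta ta.
  rewrite /doubled.
  have -> : x0 + ta - (xi0 + ta) = x0 - xi0.
    by apply/rowP => k; rewrite !mxE; ring.
  have -> : x0 + ta - y0 = (x0 - y0) + ta by rewrite addrAC.
  rewrite [dot (x0 - y0 + ta) _]dotDl !(dotDr _ (x0 - y0) ta) (dotC ta (x0 - y0)).
  by field.
rewrite zE dE in up; move: up lo; move: (doubled xi0 eta0 x0 y0) => dbl up lo.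
have pT : dot p T = bil S T T by [].
have pp : bil H p p = bil S T T by rewrite /p (bil_inv alpha0 H_pos).
have p0T : dot p0 T = dot (lsubmx p0) ta.
  by rewrite /T -{1}(hsubmxK p0) dot_row dot0r addr0.
have g0 : z0 - b - 0 *m H = z0 - b by rewrite mul0mx subr0.
have pg := @dot_grad_le p (z0 - b) 1 ler01 pr; rewrite mul1r -g0 in pg.
have := pg gr; rewrite g0 ler_norml => /andP[pg1 _].
have SE : bil S T T = bil (ulsubmx S) ta ta by rewrite bil_ul.
have XE : bil (kappa%:M - ulsubmx S) ta ta = kappa * dot ta ta - bil S T T.
  by rewrite SE /bil mulmxBr mul_mx_scalar dotDl dotNl dotZl.
have dd := delta_sqr.
have t0 : 0 <= delta * r ^+ 2 by rewrite mulr_ge0 ?sqr_ge0 // ltW.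
have c0 : 0 <= c1 * (delta * r ^+ 2).
  by rewrite mulr_ge0 // (le_trans _ c1_ge3).
rewrite XE dotDl dotZl dotNl -p0T.
move: up lo; rewrite dot0l bil0l (addrAC z0) !dotDr dotNr pT pp.
move: (psi p0) (bil S T T) (dot p0 T) pg1 dd t0 c0 => a1 a2 a3.
rewrite dotDr dotNr.
move: (dot p z0) (dot p b) (dot p0 z0) (dot (x0 - y0) ta) (dot ta ta) => b1 b2 b3 b4 b5.
move: (delta ^+ 2 * r ^+ 2) (delta * r ^+ 2) (u _) (u _) => e1 e2 u1 u2.
lra.
Qed.

Lemma upper_touch_right xi0 eta0 x0 y0 ta : contact 0 xi0 eta0 x0 y0 ->
  enorm ta <= alpha * r / 2 -> D (eta0 + ta) ->
  - v (eta0 + ta) <= - v eta0 + dot (kappa *: (y0 - x0) - rsubmx p0) ta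
    + 2^-1 * bil (kappa%:M - drsubmx S) ta ta + (c1 + 2) * (delta * r ^+ 2).
Proof.
move=> ct tar Dta; have [Dxi Deta _] := ct.
pose T := row_mx (0 : 'rV[R]_N) ta; pose p := T *m S.
have pr : enorm p <= r / 2 by apply: enorm_S; rewrite enorm_0row.
have r0' := r0; have pr' : enorm p <= r by lra.
have zr : enorm (0 : 'rV[R]_n) <= r / 2 by rewrite enorm0 divr_ge0 // ltW.
have zr' : enorm (0 : 'rV[R]_n) <= r by rewrite enorm0 ltW.
have up := doubled_upper x0 (y0 + ta) Dxi Dta pr'.
have lo := doubled_lower zr' ct.
have gr := contact_gradient zr ct.
set z0 := row_mx x0 y0 in lo gr.
have zE : row_mx x0 (y0 + ta) = z0 + T by rewrite add_row_mx addr0.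
have dE : doubled xi0 (eta0 + ta) x0 (y0 + ta) = doubled xi0 eta0 x0 y0
    + (v eta0 - v (eta0 + ta)) - kappa * dot (y0 - x0) ta - kappa / 2 * dot ta ta.
  rewrite /doubled.
  have -> : y0 + ta - (eta0 + ta) = y0 - eta0.
    by apply/rowP => k; rewrite !mxE; ring.
  have -> : x0 - (y0 + ta) = - ((y0 - x0) + ta).
    by apply/rowP => k; rewrite !mxE; ring.
  have -> : x0 - y0 = - (y0 - x0) by rewrite opprB.
  rewrite !(dotNl, dotNr) !opprK [dot (y0 - x0 + ta) _]dotDl.
  rewrite !(dotDr _ (y0 - x0) ta) (dotC ta (y0 - x0)).
  by field.
rewrite zE dE in up; move: up lo; move: (doubled xi0 eta0 x0 y0) => dbl up lo.
have pT : dot p T = bil S T T by [].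
have pp : bil H p p = bil S T T by rewrite /p (bil_inv alpha0 H_pos).
have p0T : dot p0 T = dot (rsubmx p0) ta.
  by rewrite /T -{1}(hsubmxK p0) dot_row dot0r add0r.
have g0 : z0 - b - 0 *m H = z0 - b by rewrite mul0mx subr0.
have pg := @dot_grad_le p (z0 - b) 1 ler01 pr; rewrite mul1r -g0 in pg.
have := pg gr; rewrite g0 ler_norml => /andP[pg1 _].
have SE : bil S T T = bil (drsubmx S) ta ta by rewrite bil_dr.
have XE : bil (kappa%:M - drsubmx S) ta ta = kappa * dot ta ta - bil S T T.
  by rewrite SE /bil mulmxBr mul_mx_scalar dotDl dotNl dotZl.
have dd := delta_sqr.
have t0 : 0 <= delta * r ^+ 2 by rewrite mulr_ge0 ?sqr_ge0 // ltW.
have c0 : 0 <= c1 * (delta * r ^+ 2).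
  by rewrite mulr_ge0 // (le_trans _ c1_ge3).
rewrite XE dotDl dotZl dotNl -p0T.
move: up lo; rewrite dot0l bil0l (addrAC z0) !dotDr dotNr pT pp.
move: (psi p0) (bil S T T) (dot p0 T) pg1 dd t0 c0 => a1 a2 a3.
rewrite dotDr dotNr.
move: (dot p z0) (dot p b) (dot p0 z0) (dot (y0 - x0) ta) (dot ta ta) => b1 b2 b3 b4 b5.
move: (delta ^+ 2 * r ^+ 2) (delta * r ^+ 2) (v _) (v _) => e1 e2 u1 u2.
lra.
Qed.

(** The first term collects the three gradient errors, the second the error in the coupling term,
    and 3 the six tolerances [delta ^+ 2 * r ^+ 2], each at most [delta * r ^+ 2 / 2]. *)
Let K1 : R := 5 / 2 * c1 + kappa * (alpha * c1 + 2 * c1 ^+ 2) + 3.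

(* Exchanging the second components of two contact points is admissible in the doubled
   problem; this decouples the Hessians in [x] and in [y]. *)
Lemma contact_cross xi0 eta0 x0 y0 om :
  (forall p : 'rV[R]_n, enorm p <= r / 2 -> exists xi eta x y, contact p xi eta x y) ->
  contact 0 xi0 eta0 x0 y0 -> enorm om <= alpha * r / 4 ->
  bil (kappa%:M - ulsubmx S) om om + bil (kappa%:M - drsubmx S) om om
  <= 2 * K1 * (delta * r ^+ 2).
Proof.
move=> exct ct0 omr; have [Dxi0 Deta0 _] := ct0.
have r0' := r0; have a0' := alpha0; have k0' := kappa0; have d0' := delta0.
have ar : 0 < alpha * r by rewrite mulr_gt0.
(* The contact point for [p] is near [b + T1 - T2] and the one for 0 near [b], so the exchanged
   pairs are near [b + T1] and [b - T2], where [q1] and [- q2] are the natural dual variables. *)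
pose T1 := row_mx om (0 : 'rV[R]_N); pose T2 := row_mx (0 : 'rV[R]_N) om.
pose q1 := T1 *m S; pose q2 := T2 *m S; pose p := q1 - q2.
have q1r : enorm q1 <= r / 2 by apply: enorm_S; rewrite enorm_row0; lra.
have q2r : enorm q2 <= r / 2 by apply: enorm_S; rewrite enorm_0row; lra.
have pr : enorm p <= r / 2.
  rewrite /p /q1 /q2 -mulmxBl; apply: enorm_S; apply: (le_trans (enormB _ _)).
  by rewrite enorm_row0 enorm_0row; lra.
have zr : enorm (0 : 'rV[R]_n) <= r / 2 by rewrite enorm0 divr_ge0 // ltW.
have [xi [eta [x [y ct]]]] := exct p pr; have [Dxi Deta _] := ct.
have gr := contact_gradient pr ct; have gr0 := contact_gradient zr ct0.
have pH : p *m H = T1 - T2.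
  by rewrite /p /q1 /q2 -mulmxBl mulmxKV // (posdef_unitmx alpha0 H_pos).
rewrite pH in gr; rewrite mul0mx subr0 in gr0.
have q2N : enorm (- q2) <= r / 2 by rewrite enormN.
have half a : enorm (a : 'rV[R]_n) <= r / 2 -> enorm a <= r by move=> ?; lra.
have up1 := doubled_upper x y0 Dxi Deta0 (half _ q1r).
have up2 := doubled_upper x0 y Dxi0 Deta (half _ q2N).
have lo := doubled_lower (half _ pr) ct; have lo0 := doubled_lower (half _ zr) ct0.
have cr := doubled_cross xi eta x y xi0 eta0 x0 y0.
pose b1 := lsubmx b; pose b2 := rsubmx b.
have bE : b = row_mx b1 b2 by rewrite hsubmxK.
pose g1 := x - b1 - om; pose g2 := y - b2 + om.
pose h1 := x0 - b1; pose h2 := y0 - b2.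
have gE : row_mx x y - b - (T1 - T2) = row_mx g1 g2.
  by rewrite bE !(opp_row_mx, add_row_mx) !oppr0 addr0 sub0r opprK.
have hE : row_mx x0 y0 - b = row_mx h1 h2 by rewrite bE opp_row_mx add_row_mx.
rewrite gE in gr; rewrite hE in gr0.
have e1E : row_mx x y0 - b = T1 + row_mx g1 h2.
  by rewrite bE opp_row_mx !add_row_mx; congr row_mx; apply/rowP => k; rewrite !mxE; ring.
have e2E : row_mx x0 y - b = - T2 + row_mx h1 g2.
  by rewrite bE !opp_row_mx !add_row_mx; congr row_mx; apply/rowP => k; rewrite !mxE; ring.
have eE : row_mx x y - b = (T1 - T2) + row_mx g1 g2.
  by rewrite -gE [in RHS]addrC subrK.
set t := c1 * delta * r in gr gr0.
have t0 : 0 <= t by rewrite /t !mulr_ge0 ?(ltW r0) ?(ltW delta0) // (le_trans _ c1_ge3).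
have cross_g (a1 a2 a3 a4 : 'rV[R]_N) : enorm (row_mx a1 a2) <= t -> enorm (row_mx a3 a4) <= t ->
    enorm (row_mx a1 a4 : 'rV[R]_n) <= 2 * t.
  move=> h3 h4; apply: (le_trans (enorm_row_le _ _)).
  by have := enorm_lsub_le a1 a2; have := enorm_rsub_le a3 a4; lra.
have n1 : `|dot p (row_mx g1 g2)| <= 1 / 2 * c1 * (delta * r ^+ 2).
  by apply: (dot_grad_le ler01 pr); rewrite mul1r.
move: n1; rewrite ler_norml => /andP[_ n1].
have n2 : `|dot q1 (row_mx g1 h2)| <= 2 / 2 * c1 * (delta * r ^+ 2).
  by apply: (dot_grad_le (ler0n _ 2) q1r); exact: cross_g gr gr0.
have n3 : `|dot (- q2) (row_mx h1 g2)| <= 2 / 2 * c1 * (delta * r ^+ 2).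
  by apply: (dot_grad_le (ler0n _ 2) q2N); exact: cross_g gr0 gr.
move: n2 n3; rewrite !ler_norml => /andP[n2 _] /andP[n3 _].
have m1 : enorm (g1 - h1) <= 2 * t.
  apply: (le_trans (enormB _ _)).
  by have := enorm_lsub_le g1 g2; have := enorm_lsub_le h1 h2; lra.
have m2 : enorm (g2 - h2) <= 2 * t.
  apply: (le_trans (enormB _ _)).
  by have := enorm_rsub_le g1 g2; have := enorm_rsub_le h1 h2; lra.
have prodE (a c e f : R) : 0 <= a -> 0 <= c -> a <= e -> c <= f -> a * c <= e * f.
  by move=> *; apply: ler_pM.
have k1 : `|dot om (g2 - h2)| <= alpha * r / 4 * (2 * t).
  by apply: (le_trans (dot_le_enorm _ _)); apply: prodE; rewrite ?enorm_ge0.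
have k2 : `|dot (g1 - h1) om| <= alpha * r / 4 * (2 * t).
  by apply: (le_trans (dot_le_enorm _ _)); rewrite mulrC; apply: prodE; rewrite ?enorm_ge0.
have k3 : `|dot (g1 - h1) (g2 - h2)| <= 2 * t * (2 * t).
  by apply: (le_trans (dot_le_enorm _ _)); apply: prodE; rewrite ?enorm_ge0.
have xyE : dot (x - x0) (y - y0) = - dot om om + dot om (g2 - h2)
    - dot (g1 - h1) om + dot (g1 - h1) (g2 - h2).
  have -> : x - x0 = om + (g1 - h1) by apply/rowP => k; rewrite !mxE; ring.
  have -> : y - y0 = - om + (g2 - h2) by apply/rowP => k; rewrite !mxE; ring.
  by move: (g1 - h1) (g2 - h2) => a c; rewrite !dotE; ring.
have p0E : dot p0 (row_mx x y) + dot p0 (row_mx x0 y0) =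
    dot p0 (row_mx x y0) + dot p0 (row_mx x0 y).
  by rewrite -(hsubmxK p0) !dot_row; ring.
have S1 : dot q1 T1 = bil S T1 T1 by [].
have S2 : dot q2 T2 = bil S T2 T2 by [].
have S12 : dot q1 T2 = bil S T1 T2 by [].
have S21 : dot q2 T1 = bil S T1 T2.
  by rewrite -/(bil S T2 T1) bilC // (posdef_inv_sym HT).
have H1 : bil H q1 q1 = bil S T1 T1 by rewrite (bil_inv alpha0 H_pos).
have H2 : bil H q2 q2 = bil S T2 T2 by rewrite (bil_inv alpha0 H_pos).
have H12 : bil H q1 q2 = bil S T1 T2.
  by rewrite -S21 /bil /q1 mulmxKV ?(posdef_unitmx alpha0 H_pos) // dotC.
have S0 := bil_inv_ge0 alpha0 H_pos (T1 + T2); rewrite -/S in S0.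
have XE : bil (kappa%:M - ulsubmx S) om om = kappa * dot om om - bil S T1 T1.
  by rewrite bil_ul /bil mulmxBr mul_mx_scalar dotDl dotNl dotZl.
have YE : bil (kappa%:M - drsubmx S) om om = kappa * dot om om - bil S T2 T2.
  by rewrite bil_dr /bil mulmxBr mul_mx_scalar dotDl dotNl dotZl.
have pp : bil H p p = bil S T1 T1 - 2 * bil S T1 T2 + bil S T2 T2.
  by rewrite /p !(bilDl, bilDr, bilNl, bilNr) H1 H2 (bilC q2 q1 HT) H12; ring.
have pT : dot p (T1 - T2) = bil S T1 T1 - 2 * bil S T1 T2 + bil S T2 T2.
  by rewrite /p !(dotDl, dotDr, dotNl, dotNr) S1 S2 S12 S21; ring.
have nq : bil H (- q2) (- q2) = bil H q2 q2 by rewrite bilNl bilNr opprK.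
have nqT : dot (- q2) (- T2) = bil S T2 T2 by rewrite dotNl dotNr opprK.
(* The mixed block of [S] is at most [- kappa], up to the error. Together with [S0], the
   nonnegativity of [S] on [T1 + T2], this makes the diagonal blocks sum to at least [2 * kappa],
   which is the claim. *)
have key : bil S T1 T2 + kappa * dot om om <= K1 * (delta * r ^+ 2).
  move: up1 up2 lo lo0 cr; rewrite e1E e2E eE hE xyE.
  move: (doubled _ _ _ _) (doubled _ _ _ _) (doubled _ _ _ _) (doubled _ _ _ _).
  move=> d1 d2 d3 d4.
  rewrite (dotDr p) (dotDr q1) (dotDr (- q2)) dot0l bil0l.
  rewrite pp pT nq nqT S1 H2.
  move: n1 n2 n3; move: (dot p _) (dot q1 _) (dot (- q2) _) => f1 f2 f3 n1 n2 n3.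
  move: k1 k2 k3; move: (dot om (g2 - h2)) (dot (g1 - h1) om) (dot (g1 - h1) (g2 - h2)) => j1 j2 j3.
  rewrite !ler_norml => /andP[_ k1] /andP[k2 _] /andP[_ k3].
  have dd := delta_sqr.
  have J : kappa * (j1 - j2 + j3) <=
      kappa * (alpha * c1 + 2 * c1 ^+ 2) * (delta * r ^+ 2).
    rewrite -[leRHS]mulrA; apply: ler_wpM2l; first exact: ltW.
    apply: (@le_trans _ _ (alpha * c1 * (delta * r ^+ 2) + 4 * c1 ^+ 2 * (delta ^+ 2 * r ^+ 2))).
      have -> : alpha * c1 * (delta * r ^+ 2) = 2 * (alpha * r / 4 * (2 * t)).
        by rewrite /t; field.
      have -> : 4 * c1 ^+ 2 * (delta ^+ 2 * r ^+ 2) = 2 * t * (2 * t) by rewrite /t; ring.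
      lra.
    have : c1 ^+ 2 * (delta ^+ 2 * r ^+ 2) <= c1 ^+ 2 * (delta * r ^+ 2 / 2).
      by apply: ler_wpM2l => //; exact: sqr_ge0.
    lra.
  move: n1 n2 n3 dd J p0E; rewrite H1 /K1.
  move: (kappa * (_ + _)) => ka.
  move: (bil S _ _) (bil S _ _) (bil S _ _) (psi _) (dot om om) => a1 a2 a3 a4 a5.
  move: (dot p0 _) (dot p0 _) (dot p0 _) (dot p0 _) => a6 a7 a8 a9.
  move=> n1 n2 n3 dd J p0E up1 up2 lo lo0 cr.
  lra.
move: S0; rewrite !(bilDl, bilDr) (bilC T2 T1 (posdef_inv_sym HT)) -/S XE YE.
move: key; move: (bil S T1 T1) (bil S T2 T2) (bil S T1 T2) => a1 a2 a3.
lra.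
Qed.

End Core.
End TheoremOnSums.

(** * The approximate theorem on sums *)

Section TheoremOnSumsStatement.
Variables (R : realType) (N : nat).
Implicit Types (xi eta ta om p q : 'rV[R]_N).
Local Notation n := (N + N)%N.

Lemma dot_le_coord (m : nat) (x y : 'rV[R]_m) (a b : R) :
  (forall k, `|x 0 k| <= a) -> (forall k, `|y 0 k| <= b) -> `|dot x y| <= m%:R * (a * b).
Proof.
move=> xa yb; apply: (le_trans (ler_norm_sum _ _ _)).
apply: (@le_trans _ _ (\sum_(k < m) a * b)).
  by apply: ler_sum => k _; rewrite normrM; apply: ler_pM.
by rewrite sumr_const card_ord mulr_natl.
Qed.

(* The inverse of [[2, -1], [-1, 2]] * kappa, the Hessian in [(x, y)] of the penalty in
   [doubled]. *)
Definition spring (kappa : R) : 'M[R]_n :=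
  block_mx (2 / (3 * kappa))%:M (1 / (3 * kappa))%:M
           (1 / (3 * kappa))%:M (2 / (3 * kappa))%:M.

Lemma spring_sym kappa : (spring kappa)^T = spring kappa.
Proof. by rewrite /spring tr_block_mx !tr_scalar_mx. Qed.

Lemma bil_spring kappa p q : kappa != 0 ->
  2^-1 * bil (spring kappa) (row_mx p q) (row_mx p q) =
  (dot p p + dot p q + dot q q) / (3 * kappa).
Proof.
move=> k0; rewrite /bil mul_row_block !mul_mx_scalar dot_row !dotE (dotC q p).
by field.
Qed.

Lemma spring_pos kappa (z : 'rV[R]_n) : 0 < kappa ->
  1 / (3 * kappa) * dot z z <= bil (spring kappa) z z.
Proof.
move=> k0; rewrite -(hsubmxK z); set p := lsubmx z; set q := rsubmx z.
rewrite dot_row; have := bil_spring p q (lt0r_neq0 k0) => h.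
have -> : bil (spring kappa) (row_mx p q) (row_mx p q) =
   (dot p p + dot p q + dot q q) / (3 * kappa) * 2 by rewrite -h; field.
have i0 : 0 <= (3 * kappa)^-1 by rewrite invr_ge0 mulr_ge0 // ltW.
have pq : dot p p + dot q q <= 2 * (dot p p + dot p q + dot q q).
  by have := dot_ge0 (p + q); rewrite !dotE (dotC q p); lra.
by have := ler_wpM2l i0 pq; lra.
Qed.

Lemma spring_le kappa k l : 0 < kappa -> `|spring kappa k l| <= 2 / (3 * kappa).
Proof.
move=> k0; have k3 : 0 < (3 * kappa)^-1 by rewrite invr_gt0 mulr_gt0.
have H2 (i j : 'I_N) (a : R) : 0 <= a <= 2 / (3 * kappa) ->
    `|(a%:M : 'M[R]_N) i j| <= 2 / (3 * kappa).
  move=> /andP[a0 a1]; rewrite mxE; case: eqP => _ /=; rewrite ?mulr1n ?mulr0n ?normr0.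
    by rewrite ger0_norm.
  by apply: le_trans a1.
have b1 : 0 <= 1 / (3 * kappa) <= 2 / (3 * kappa) by apply/andP; split; lra.
have b2 : 0 <= 2 / (3 * kappa) <= 2 / (3 * kappa) by apply/andP; split; lra.
rewrite /spring; case: (split_ordP k) => i ->; case: (split_ordP l) => j ->.
- by rewrite block_mxEul; apply: H2.
- by rewrite block_mxEur; apply: H2.
- by rewrite block_mxEdl; apply: H2.
- by rewrite block_mxEdr; apply: H2.
Qed.

(* The Crandall-Ishii lemma in approximate form. *)
Lemma approximate_sums (kappa : R) (D : set 'rV[R]_N) (u v : 'rV[R]_N -> R) (M L R0 eps : R) :
  (0 < N)%N -> 1 <= kappa -> D !=set0 ->
  (forall xi eta, D xi -> D eta -> u xi - v eta <= M) ->
  (forall xi k, D xi -> `|xi 0 k| <= L) -> 0 < R0 <= 1 -> 0 < eps ->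
  exists (r : R) xi0 eta0 (l1 l2 : 'rV[R]_N) (X Y : 'M[R]_N),
  [/\ [/\ 0 < r <= R0, D xi0, D eta0, X^T = X & Y^T = Y],
    forall xi, D xi -> u xi - v xi - eps - 4 * N%:R * R0 * L <=
      u xi0 - v eta0 - kappa / 6 * dot (xi0 - eta0) (xi0 - eta0),
    forall ta, enorm ta <= r -> D (xi0 + ta) ->
      u (xi0 + ta) <= u xi0 + dot l1 ta + 2^-1 * bil X ta ta + eps * r ^+ 2,
    forall ta, enorm ta <= r -> D (eta0 + ta) ->
      - v (eta0 + ta) <= - v eta0 + dot l2 ta + 2^-1 * bil Y ta ta + eps * r ^+ 2 &
    forall om, bil X om om + bil Y om om <= eps * dot om om].
Proof.
move=> N0 k1 [xi1 Dxi1] uvM DL /andP[R00 R01] eps0.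
have k0 : 0 < kappa by exact: lt_le_trans k1.
have kn0 : kappa != 0 by rewrite gt_eqF.
pose T := ('rV[R]_N * 'rV[R]_N)%type.
pose S0 : set T := [set i | D i.1 /\ D i.2].
pose a (i : T) : R := u i.1 - v i.2 - kappa / 6 * dot (i.1 - i.2) (i.1 - i.2).
pose zx (i : T) : 'rV[R]_N := (2 / 3) *: i.1 + (1 / 3) *: i.2.
pose zy (i : T) : 'rV[R]_N := (1 / 3) *: i.1 + (2 / 3) *: i.2.
pose z (i : T) : 'rV[R]_n := row_mx (zx i) (zy i).
have aM i : S0 i -> a i <= M.
  move=> [D1 D2]; apply: le_trans (uvM _ _ D1 D2); rewrite /a gerBl mulr_ge0 ?dot_ge0 //.
  by rewrite divr_ge0 // ltW.
have zL i k : S0 i -> `|z i 0 k| <= L.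
  move=> [D1 D2]; rewrite /z; case: (split_ordP k) => j ->; rewrite ?row_mxEl ?row_mxEr !mxE.
    by have := DL _ j D1; have := DL _ j D2; rewrite !ler_norml => /andP[? ?] /andP[? ?];
      apply/andP; split; lra.
  by have := DL _ j D1; have := DL _ j D2; rewrite !ler_norml => /andP[? ?] /andP[? ?];
    apply/andP; split; lra.
have S0n : S0 !=set0 by exists (xi1, xi1).
have [Psi [Pcvx PL Pge Pnear]] := sup_affine S0n aM zL.
have n0 : (0 < n)%N by rewrite addn_gt0 N0.
have [C C0 HC] := cvx_almost_quadratic n0 Pcvx PL R00.
pose C' := C + 2 / (3 * kappa).
have s0 : 0 < 2 / (3 * kappa) by rewrite divr_gt0 // mulr_gt0.
have C'0 : 0 <= C' by rewrite addr_ge0 // ltW.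
(* [spring kappa] is bounded below by twice this value; the other half pays for [H'] being only
   almost positive. *)
pose alpha := 1 / (6 * kappa).
have alpha0 : 0 < alpha by rewrite divr_gt0 // mulr_gt0.
have alpha1 : alpha <= 1 by rewrite ler_pdivrMr ?mulr_gt0 // mul1r; lra.
pose c1 : R := n%:R ^+ 2 * C' / 2 + 3.
pose K1 : R := 5 / 2 * c1 + kappa * (alpha * c1 + 2 * c1 ^+ 2) + 3.
have c13 : 3 <= c1 by rewrite /c1 lerDr divr_ge0 // mulr_ge0 // sqr_ge0.
have c10 : 0 <= c1 by apply: le_trans c13.
have K10 : 0 <= K1.
  rewrite /K1 !addr_ge0 // mulr_ge0 ?(ltW k0) // ?addr_ge0 // mulr_ge0 ?sqr_ge0 //.
  exact: ltW.
pose K2 := 2 * K1 + c1 + 2.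
have K20 : 0 < K2 by rewrite /K2; lra.
have cK2 : 0 <= c1 + 2 <= K2 by rewrite /K2; apply/andP; split; lra.
have KK2 : 0 <= 2 * K1 <= K2 by rewrite /K2; apply/andP; split; lra.
(* The last entry turns errors [K2 * (delta * r ^+ 2)] into [eps * r' ^+ 2]. There is no
   circularity: [K2] comes from [C], which was obtained before the precision [delta ^+ 2]. *)
pose delta := Num.min (Num.min 2^-1 alpha) (Num.min eps (eps * alpha ^+ 2 / (16 * K2))).
have delta0 : 0 < delta.
  rewrite !lt_min alpha0 eps0 invr_gt0 ltr0n /= divr_gt0 // mulr_gt0 //.
  exact: exprn_gt0.
have delta1 : delta <= 2^-1 by rewrite !ge_min lexx.
have delta2 : delta <= alpha by rewrite !ge_min lexx !orbT.
have delta3 : delta <= eps by rewrite !ge_min lexx !orbT.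
have delta4 : delta <= eps * alpha ^+ 2 / (16 * K2) by rewrite !ge_min lexx !orbT.
have d2 : 0 < delta ^+ 2 by rewrite exprn_gt0.
have d2le : 2 * delta ^+ 2 <= delta.
  by have := ler_wpM2l (ltW delta0) delta1; rewrite expr2; lra.
have [p0 [r [H' [b' [/andP[r0 rR0] p0R H'T H'C H'q]]]]] := HC _ d2.
pose psi P := Psi P + 2^-1 * bil (spring kappa) P P.
pose H := H' + spring kappa; pose b := b' + p0 *m spring kappa.
have psiE p q : psi (row_mx p q) =
    Psi (row_mx p q) + (dot p p + dot p q + dot q q) / (3 * kappa).
  by rewrite /psi bil_spring.
have star i p q x y : S0 i ->
    dot (row_mx p q) (row_mx x y) + doubled kappa u v i.1 i.2 x y <=
    a i + dot (row_mx p q) (z i) + (dot p p + dot p q + dot q q) / (3 * kappa).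
  move=> _; rewrite /z !dot_row; have := doubled_dual u v p q x y i.1 i.2 kn0 => /=.
  move: (doubled _ _ _ _ _ _ _) => d; set dx := x - _; set dy := y - _ => h.
  have nn : 0 <= kappa / 2 * (dot dx dx + dot (dx - dy) (dx - dy) + dot dy dy).
    by rewrite mulr_ge0 ?divr_ge0 ?(ltW k0) // !addr_ge0 // dot_ge0.
  rewrite -/(zx i) -/(zy i) in h; rewrite /a; move: h nn.
  move: (kappa / 2 * _) (dot p (zx i)) (dot q (zy i)) => t1 t2 t3.
  lra.
have psi_ge xi eta x y P : D xi -> D eta ->
    dot P (row_mx x y) + doubled kappa u v xi eta x y <= psi P.
  move=> Dxi Deta; rewrite -(hsubmxK P) psiE.
  have Si : S0 (xi, eta) by [].
  apply: (le_trans (star (xi, eta) (lsubmx P) (rsubmx P) x y Si)).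
  by rewrite lerD2r; exact: Pge.
have psi_quad P : enorm P <= r ->
    `|psi (p0 + P) - psi p0 - dot b P - 2^-1 * bil H P P| <= delta ^+ 2 * r ^+ 2.
  move=> Pr; have := H'q P (fun k => le_trans (coord_le_enorm P k) Pr).
  congr (`|_| <= _); rewrite /psi /b /H dotDl -/(bil (spring kappa) p0 P).
  have -> : bil (H' + spring kappa) P P = bil H' P P + bil (spring kappa) P P.
    by rewrite /bil mulmxDr dotDl.
  by rewrite !(bilDl, bilDr) (bilC P p0 (spring_sym kappa)); field.
have HT : H^T = H by rewrite /H linearD /= H'T spring_sym.
have HC' k l : `|H k l| <= C'.
  by rewrite mxE; apply: (le_trans (ler_normD _ _)); apply: lerD => //; exact: spring_le.
(* Midpoint convexity of [Psi] at [p0] gives this for vectors of length [r], with two approximation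
   errors; homogeneity extends it to all lengths. *)
have H'pos (w : 'rV[R]_n) : - (2 * delta ^+ 2) * dot w w <= bil H' w w.
  have [w0|w0] := eqVneq (enorm w) 0.
    by rewrite (enorm_eq0 w0) dot0l mulr0 bil0l.
  have wp : 0 < enorm w by rewrite lt_def w0 enorm_ge0.
  pose s := r / enorm w; have s0' : 0 < s by rewrite divr_gt0.
  have es : enorm (s *: w) <= r by rewrite enormZ gtr0_norm // divfK.
  have h1 := H'q (s *: w) (fun k => le_trans (coord_le_enorm _ k) es).
  have es' : enorm (- (s *: w)) <= r by rewrite enormN.
  have h2 := H'q (- (s *: w)) (fun k => le_trans (coord_le_enorm _ k) es').
  have h3 := cvx_midpoint p0 (s *: w) Pcvx.
  have : - (2 * (delta ^+ 2 * r ^+ 2)) <= bil H' (s *: w) (s *: w).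
    move: h1 h2; rewrite !(bilNl, bilNr, dotNr) opprK !ler_norml => /andP[? ?] /andP[? ?].
    lra.
  have rE : r ^+ 2 = s ^+ 2 * dot w w by rewrite -enorm_sqr -exprMn divfK.
  rewrite bilZl bilZr rE => h4.
  have s2 : 0 < s ^+ 2 by rewrite exprn_gt0.
  by rewrite -(ler_pM2l s2); move: h4; congr (_ <= _); ring.
have H_pos (w : 'rV[R]_n) : alpha * dot w w <= bil H w w.
  have -> : bil H w w = bil H' w w + bil (spring kappa) w w.
    by rewrite /H /bil mulmxDr dotDl.
  have h1 := H'pos w; have h2 := spring_pos w k0.
  have h3 : 1 / (3 * kappa) = 2 * alpha by rewrite /alpha; field.
  rewrite h3 in h2.
  have h4 : 2 * delta ^+ 2 * dot w w <= alpha * dot w w.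
    by apply: ler_wpM2r; rewrite ?dot_ge0 //; apply: le_trans delta2.
  lra.
have e0 : 0 < delta ^+ 2 * r ^+ 2 by rewrite mulr_gt0 // exprn_gt0.
have mkct P i : S0 i -> Psi (p0 + P) - delta ^+ 2 * r ^+ 2 < a i + dot (p0 + P) (z i) ->
    exists x y, contact kappa D u v psi delta r p0 P i.1 i.2 x y.
  move=> Si Hi; set Q := p0 + P in Hi *; set p := lsubmx Q; set q := rsubmx Q.
  exists (zx i + (2 / (3 * kappa)) *: p + (1 / (3 * kappa)) *: q).
  exists (zy i + (1 / (3 * kappa)) *: p + (2 / (3 * kappa)) *: q).
  case: (Si) => D1 D2; split => //.
  rewrite -/Q; have QE : Q = row_mx p q by rewrite hsubmxK.
  rewrite {1 2}QE psiE -QE.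
  have := doubled_dual u v p q (zx i + (2 / (3 * kappa)) *: p + (1 / (3 * kappa)) *: q)
    (zy i + (1 / (3 * kappa)) *: p + (2 / (3 * kappa)) *: q) i.1 i.2 kn0 => /=.
  rewrite -/(zx i) -/(zy i) !subrr !dot0l !addr0 mulr0 addr0.
  rewrite {2}QE dot_row => <-.
  move: Hi; rewrite [in dot Q _]QE dot_row /a; move: (dot q (zy i)) (dot p (zx i)) => t1 t2.
  lra.
have exct P : enorm P <= r / 2 ->
    exists xi eta x y, contact kappa D u v psi delta r p0 P xi eta x y.
  move=> _; have [i Si Hi] := Pnear (p0 + P) _ e0.
  by have [x [y ct]] := mkct P i Si Hi; exists i.1, i.2, x, y.
have [i Si Hi] := Pnear p0 _ e0.
have [x0 [y0 ct0]] : exists x y, contact kappa D u v psi delta r p0 0 i.1 i.2 x y.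
  by apply: mkct => //; rewrite addr0.
(* The radius allowed by [contact_cross], smaller than the one allowed by the two touching
   lemmas. *)
pose r' := alpha * r / 4.
have ar0 : 0 < alpha * r by rewrite mulr_gt0.
have r'0 : 0 < r' by rewrite divr_gt0.
have r'r : r' <= alpha * r / 2 by rewrite /r'; move: (alpha * r) ar0; clear=> t; lra.
have r'R0 : r' <= R0.
  apply: le_trans rR0; apply: (@le_trans _ _ (alpha * r)); last by rewrite ler_piMl // ltW.
  by rewrite /r'; move: (alpha * r) ar0; clear=> t; lra.
have errE (K : R) : 0 <= K <= K2 -> K * (delta * r ^+ 2) <= eps * r' ^+ 2.
  move=> /andP[Ka Kb]; have -> : r' ^+ 2 = alpha ^+ 2 / 16 * r ^+ 2 by rewrite /r'; field.
  rewrite mulrA [leRHS]mulrA; apply: ler_wpM2r; first exact: sqr_ge0.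
  apply: (@le_trans _ _ (K2 * delta)); first by apply: ler_wpM2r => //; exact: ltW.
  move: delta4; rewrite ler_pdivlMr ?mulr_gt0 //; lra.
have [D1 D2 _] := ct0.
have ST := posdef_inv_sym HT.
exists r', i.1, i.2, (kappa *: (x0 - y0) - lsubmx p0), (kappa *: (y0 - x0) - rsubmx p0).
exists (kappa%:M - ulsubmx (invmx H)), (kappa%:M - drsubmx (invmx H)); split.
- split => //.
  + by rewrite r'0.
  + by rewrite linearB /= tr_scalar_mx trmx_ulsub ST.
  + by rewrite linearB /= tr_scalar_mx trmx_drsub ST.
(* The slope [p0] plays the part of the small linear perturbation in Jensen's lemma: its coordinates
   are at most [R0] and two slopes [z] differ by at most [2 * L] in each of the [N + N]
   coordinates. *)
- move=> xi Dxi; have Sx : S0 (xi, xi) by [].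
  have := Pge (xi, xi) p0 Sx; rewrite {1}/a /= subrr dot0l mulr0 subr0.
  have z2 k : `|(z i - z (xi, xi)) 0 k| <= 2 * L.
    rewrite mxE [X in _ + X]mxE; apply: (le_trans (ler_normB _ _)).
    by rewrite mulr2n mulrDl mul1r; apply: lerD; exact: zL.
  have p2 k : `|p0 0 k| <= R0 by have /andP[? ?] := p0R k; rewrite ger0_norm.
  have := dot_le_coord p2 z2; rewrite dotDr dotNr natrD ler_norml => /andP[_].
  have e1 : delta ^+ 2 * r ^+ 2 <= eps.
    apply: (@le_trans _ _ (delta ^+ 2 * 1)).
      by apply: ler_wpM2l; [exact: ltW|rewrite exprn_ile1 ?(ltW r0) // (le_trans rR0)].
    by rewrite mulr1; apply: le_trans delta3; apply: le_trans d2le; rewrite ler_peMl // ?ler1n // ltW.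
  move: Hi e1; rewrite /a; move: (dot p0 _) (dot p0 _) (Psi p0) (dot _ _) => t1 t2 t3 t4.
  move: (delta ^+ 2 * _) (u _) (v _) (u _) (v _); clear=> *; lra.
- move=> ta tar Dta.
  have h := upper_touch_left psi_ge psi_quad alpha0 r0 C'0 delta0 delta1 HT HC' H_pos ct0 _ Dta.
  have tar' := le_trans tar r'r.
  apply: (le_trans (h tar')).
  by rewrite lerD2l; exact: (errE (c1 + 2)).
- move=> ta tar Dta.
  have h := upper_touch_right psi_ge psi_quad alpha0 r0 C'0 delta0 delta1 HT HC' H_pos ct0 _ Dta.
  have tar' := le_trans tar r'r.
  apply: (le_trans (h tar')).
  by rewrite lerD2l; exact: (errE (c1 + 2)).
- move=> om; have [w0|w0] := eqVneq (enorm om) 0.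
    by rewrite (enorm_eq0 w0) !bil0l dot0l mulr0 addr0.
  have wp : 0 < enorm om by rewrite lt_def w0 enorm_ge0.
  pose s := r' / enorm om; have s0' : 0 < s by rewrite divr_gt0.
  have es : enorm (s *: om) <= r' by rewrite enormZ gtr0_norm // divfK.
  have := contact_cross psi_ge psi_quad k0 alpha0 r0 C'0 delta0 delta1 HT HC' H_pos exct ct0 es.
  rewrite -/c1 -/K1 => h.
  have {}h : bil (kappa%:M - ulsubmx (invmx H)) (s *: om) (s *: om) +
    bil (kappa%:M - drsubmx (invmx H)) (s *: om) (s *: om) <= eps * r' ^+ 2.
    by apply: (le_trans h); exact: (errE (2 * K1)).
  have rE : r' ^+ 2 = s ^+ 2 * dot om om by rewrite -enorm_sqr -exprMn divfK.
  have s2 : 0 < s ^+ 2 by rewrite exprn_gt0.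
  rewrite rE !bilZl !bilZr in h.
  by rewrite -(ler_pM2l s2); move: h; congr (_ <= _); ring.
Qed.

End TheoremOnSumsStatement.

(** * Continuity of linear and quadratic forms *)

Section ContinuityOfForms.
Variables (R : realType) (n : nat).

Lemma continuous_bigsum (T : topologicalType) (I : Type) (s : seq I) (F : I -> T -> R) :
  (forall i, continuous (F i)) -> continuous (fun x => \sum_(i <- s) F i x).
Proof.
move=> cF; elim: s => [|i s IH].
  rewrite (_ : (fun _ => _) = fun=> 0); first by move=> x; exact: cst_continuous.
  by apply/funext => x; rewrite big_nil.
rewrite (_ : (fun _ => _) = fun x => F i x + \sum_(j <- s) F j x).
  by move=> x; apply: continuousD; [exact: cF|exact: IH].
by apply/funext => x; rewrite big_cons.
Qed.

Lemma continuous_dot (b : 'rV[R]_n) : continuous (dot b).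
Proof.
apply: continuous_bigsum => k x; apply: continuousM; first exact: cst_continuous.
exact: coord_continuous.
Qed.

Lemma continuous_bil (A : 'M[R]_n) : continuous (fun x => bil A x x).
Proof.
rewrite (_ : (fun _ => _) = fun x : 'rV[R]_n => \sum_k \sum_l x 0 k * A k l * x 0 l).
  apply: continuous_bigsum => k; apply: continuous_bigsum => l x.
  have c1 : {for x, continuous (fun x : 'rV[R]_n => x 0 k * A k l)}.
    by apply: continuousM; [exact: coord_continuous|exact: cst_continuous].
  exact: (continuousM c1 (@coord_continuous R 1 n 0 l x)).
by apply/funext => x; rewrite bil_sum.
Qed.

Lemma mx_norm_le (x : 'rV[R]_n) (a : R) : 0 <= a ->
  (forall k, `|x 0 k| <= a) -> `|x| <= a.
Proof.
move=> a0 xa; rewrite [leLHS]/Num.Def.normr /= mx_normrE; apply: bigmax_le => //= -[i j] _.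
by rewrite ord1 /=.
Qed.

Lemma coord_le_norm (x : 'rV[R]_n) k : `|x 0 k| <= `|x|.
Proof.
rewrite [leRHS]/Num.Def.normr /= mx_normrE.
by apply: le_trans (le_bigmax _ _ (0, k)).
Qed.

End ContinuityOfForms.

(** * Diagonalisation of real symmetric matrices *)

Section Spectral.
Variable R : realType.

Lemma bil_psd_kernel n (B : 'M[R]_n) v : B^T = B -> (forall x, 0 <= bil B x x) ->
  bil B v v = 0 -> v *m B = 0.
Proof.
move=> BT B0 vB; apply: dot_eq0; set y := v *m B.
have H t : 0 <= 2 * t * dot y y + t ^+ 2 * bil B y y.
  have := B0 (v + t *: y); rewrite !(bilDl, bilDr, bilZl, bilZr) vB (bilC y v BT).
  by rewrite -[bil B v y]/(dot y y); congr (_ <= _); ring.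
have [b0|b0] := eqVneq (bil B y y) 0.
  have := H (- 1); rewrite b0 mulr0 addr0; have := dot_ge0 y.
  by move=> h1 h2; apply/eqP; rewrite eq_le h1 andbT; lra.
have bp : 0 < bil B y y by rewrite lt_def b0 B0.
have := H (- (dot y y / bil B y y)).
rewrite (_ : _ + _ = - (dot y y ^+ 2 / bil B y y)); last by field.
rewrite oppr_ge0 pmulr_lle0 ?invr_gt0 // => h.
by apply/eqP; rewrite -sqrf_eq0 eq_le h sqr_ge0.
Qed.

(** A maximiser [v] of the quadratic form on the unit sphere: for the maximum [lam], the matrix
    [lam%:M - A] is positive semidefinite and its form vanishes at [v], so [v] is in its kernel. *)
Lemma symmetric_eigenvector n (A : 'M[R]_n.+1) : A^T = A ->
  exists v (lam : R), dot v v = 1 /\ v *m A = lam *: v.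
Proof.
move=> AT; pose Sph := [set x : 'rV[R]_n.+1 | dot x x = 1].
have dot1 x : dot x x = bil 1%:M x x by rewrite /bil mulmx1.
have Sn0 : Sph !=set0 by exists (delta_mx 0 0); rewrite /Sph /= dot_delta mxE !eqxx.
have cS : compact Sph.
  apply: bounded_closed_compact.
    exists 1; split; first exact: num_real.
    move=> M M1 x Sx; apply: mx_norm_le; first by rewrite (le_trans ler01) // ltW.
    move=> k; apply: le_trans (ltW M1); have := coord_sqr_le x k; rewrite Sx.
    by rewrite -[X in X <= _]real_normK ?num_real // expr_le1.
  rewrite (_ : Sph = (fun x => bil 1%:M x x) @^-1` [set 1]).
    apply: closed_comp => [x _|]; first exact: continuous_bil.
    exact: closed_eq.
  by apply/seteqP; split => x /=; rewrite /Sph /= dot1.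
have [v /set_mem Sv vmax] : exists2 c, c \in Sph & forall t, t \in Sph -> bil A t t <= bil A c c.
  apply: compact_EVT_max => //; apply: continuous_subspaceT; exact: continuous_bil.
exists v, (bil A v v); split => //; set lam := bil A v v.
pose B := lam%:M - A.
have BE x : bil B x x = lam * dot x x - bil A x x.
  by rewrite /B /bil mulmxBr mul_mx_scalar dotDl dotNl dotZl.
have : v *m B = 0.
  apply: bil_psd_kernel.
  - by rewrite /B linearB /= tr_scalar_mx AT.
  - move=> x; rewrite BE subr_ge0; have [x0|x0] := eqVneq (enorm x) 0.
      by rewrite (enorm_eq0 x0) dot0l mulr0 bil0l.
    have xp : 0 < enorm x by rewrite lt_def x0 enorm_ge0.
    have := vmax ((enorm x)^-1 *: x); rewrite inE /Sph /= dotZl dotZr -enorm_sqr.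
    have -> : (enorm x)^-1 * ((enorm x)^-1 * enorm x ^+ 2) = 1 by field.
    move=> /(_ erefl); rewrite bilZl bilZr -/lam => /(ler_wpM2l (sqr_ge0 (enorm x))).
    have -> : enorm x ^+ 2 * ((enorm x)^-1 * ((enorm x)^-1 * bil A x x)) = bil A x x by field.
    by rewrite enorm_sqr mulrC.
  - by rewrite BE Sv mulr1 subrr.
rewrite /B mulmxBr mul_mx_scalar => /eqP; rewrite subr_eq0 => /eqP ->.
by [].
Qed.

(** Householder reflection along [v - e], or the identity if [v] is already the first basis
    vector. *)
Lemma unit_vector_reflection n (v : 'rV[R]_n.+1) : dot v v = 1 ->
  exists Q : 'M[R]_n.+1, [/\ Q^T = Q, Q *m Q = 1%:M & delta_mx 0 0 *m Q = v].
Proof.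
move=> v1; pose e : 'rV[R]_n.+1 := delta_mx 0 0; pose w := v - e.
have ee : dot e e = 1 by rewrite dot_delta mxE !eqxx.
have [w0|w0] := eqVneq (dot w w) 0.
  exists 1%:M; rewrite trmx1 mulmx1; split => //; rewrite mulmx1.
  by apply/eqP; rewrite eq_sym -subr_eq0; apply/eqP/dot_eq0.
pose c := 2 / dot w w; exists (1%:M - c *: (w^T *m w)).
have mulw (x : 'rV[R]_n.+1) : x *m (1%:M - c *: (w^T *m w)) = x - (c * dot x w) *: w.
  rewrite mulmxBr mulmx1 -scalemxAr mulmxA [x *m w^T]mx11_scalar mul_scalar_mx scalerA.
  congr (_ - (_ * _) *: _); rewrite mxE; apply: eq_bigr => k _; by rewrite mxE.
have cw : c * dot w w = 2 by rewrite /c divfK.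
split.
- by rewrite linearB /= linearZ /= trmx_mul trmxK trmx1.
- apply/row_matrixP => i; rewrite !rowE mulmxA mulw mulw mulmx1.
  set x : 'rV[R]_n.+1 := delta_mx 0 i.
  rewrite dotDl dotNl dotZl -addrA -opprD -scalerDl.
  have -> : c * dot x w + c * (dot x w - c * dot x w * dot w w) =
     c * dot x w * (2 - c * dot w w) by ring.
  by rewrite cw subrr mulr0 scale0r subr0.
- rewrite mulw -/e; have ew : dot e w = dot e v - 1 by rewrite /w dotDr dotNr ee.
  have ww : dot w w = - 2 * dot e w.
    by rewrite ew /w !(dotDl, dotDr, dotNl, dotNr) v1 ee (dotC v e); ring.
  have -> : c * dot e w = - 1.
    rewrite /c ww; field; apply: contraNneq w0; rewrite ww => ->; by rewrite mulr0.
  by rewrite scaleN1r opprK /w addrC subrK.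
Qed.

(** Conjugation by the reflection sends the eigenvector to the first basis vector; symmetry then
    splits off a block of size 1 and the induction treats the rest. *)
Lemma symmetric_diag n (A : 'M[R]_n) : A^T = A ->
  exists (P : 'M[R]_n) d, P *m P^T = 1%:M /\ A = P^T *m diag_mx d *m P.
Proof.
elim: n A => [|n IH] A AT.
  by exists 1%:M, 0; rewrite trmx1 mulmx1; split => //; apply/matrixP => -[].
have [v [lam [v1 vA]]] := symmetric_eigenvector AT.
have [Q [QT QQ eQ]] := unit_vector_reflection v1.
have [B BD] : exists B : 'M[R]_(1 + n), B = Q *m A *m Q by eexists.
have BT : B^T = B by rewrite BD !trmx_mul AT QT mulmxA.
have eB : delta_mx 0 0 *m B = lam *: delta_mx 0 0 :> 'rV[R]_(1 + n).
  rewrite BD !mulmxA eQ vA -scalemxAl; congr (_ *: _).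
  by rewrite -eQ -mulmxA QQ mulmx1.
have B0 j : B 0 j = lam * (j == 0)%:R.
  have := congr1 (fun M : 'rV[R]_(1 + n) => M 0 j) eB; rewrite -rowE !mxE => ->.
  by rewrite eqxx.
have BE : B = block_mx lam%:M 0 0 (drsubmx B).
  rewrite -{1}(submxK B); congr block_mx.
  - by apply/matrixP => i j; rewrite !ord1 !mxE (_ : lshift n 0 = 0) ?B0 ?mulr1 //; apply/val_inj.
  - by apply/matrixP => i j; rewrite !ord1 !mxE (_ : lshift n 0 = 0) ?B0 ?mulr0 //; apply/val_inj.
  - apply/matrixP => i j; rewrite !ord1 !mxE -BT mxE (_ : lshift n 0 = 0); last exact/val_inj.
    by rewrite B0 mulr0.
have CT : (drsubmx B)^T = drsubmx B by rewrite trmx_drsub BT.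
have [P [d [PP PE]]] := IH _ CT.
have Q2 : A = Q *m B *m Q.
  by rewrite BD !mulmxA QQ mul1mx -mulmxA QQ mulmx1.
pose U : 'M[R]_(1 + n) := block_mx (1%:M : 'M[R]_1) 0 0 P.
pose D : 'M[R]_(1 + n) := diag_mx (row_mx (lam%:M : 'M[R]_1) d).
have UT : U^T = block_mx (1%:M : 'M[R]_1) 0 0 P^T.
  by rewrite /U tr_block_mx !trmx0 trmx1.
have UU : U *m U^T = 1%:M.
  rewrite UT /U mulmx_block !mulmx0 !mul0mx !mulmx1 !addr0 !add0r PP.
  by rewrite -scalar_mx_block.
have UB : U^T *m D *m U = B.
  rewrite UT /U /D diag_mx_row !mulmx_block !mulmx0 !mul0mx !mulmx1 !mul1mx !addr0 !add0r.
  rewrite [RHS]BE PE !mul0mx ?addr0; congr block_mx.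
  by apply/matrixP => i j; rewrite !ord1 !mxE.
exists (U *m Q), (row_mx (lam%:M : 'M[R]_1) d); split.
  have -> : (U *m Q)^T = Q *m U^T by rewrite trmx_mul QT.
  by rewrite mulmxA -(mulmxA U Q Q) QQ mulmx1.
have -> : (U *m Q)^T = Q *m U^T by rewrite trmx_mul QT.
by rewrite -/D Q2 -UB !mulmxA.
Qed.

End Spectral.

(** * Ordered eigenvalues and their monotonicity *)

Section Eigenvalues.
Variables (R : realType) (N : nat).
Implicit Types (A B P Q : 'M[R]_N) (a b : 'I_N -> R) (i j k : 'I_N).

Definition diag_form a P : 'M[R]_N := P^T *m diag_mx (\row_k a k) *m P.

Lemma diag_formE a P i j : diag_form a P i j = \sum_k P k i * a k * P k j.
Proof.
rewrite mxE; apply: eq_bigr => k _; rewrite mul_mx_diag !mxE; ring.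
Qed.

Lemma bil_diag_form a P x :
  bil (diag_form a P) x x = \sum_k a k * (x *m P^T) 0 k ^+ 2.
Proof.
rewrite /bil /diag_form !mulmxA /dot.
have -> : \sum_k (x *m P^T *m diag_mx (\row_k0 a k0) *m P) 0 k * x 0 k =
  ((x *m P^T *m diag_mx (\row_k0 a k0)) *m (x *m P^T)^T) 0 0.
  by rewrite trmx_mul trmxK mulmxA [RHS]mxE; apply: eq_bigr => k _; congr (_ * _); rewrite [RHS]mxE.
rewrite mxE; apply: eq_bigr => k _; rewrite mul_mx_diag !mxE; ring.
Qed.

Lemma dot_orthogonal P x : P *m P^T = 1%:M -> dot x x = \sum_k (x *m P^T) 0 k ^+ 2.
Proof.
move=> PP; have PP' := mulmx1C PP; rewrite -{1}(mulmx1 x) -PP' mulmxA.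
rewrite -[dot _ _]/(bil P (x *m P^T) x) /bil /dot.
have -> : \sum_k (x *m P^T *m P) 0 k * x 0 k = ((x *m P^T) *m (x *m P^T)^T) 0 0.
  by rewrite trmx_mul trmxK mulmxA [RHS]mxE; apply: eq_bigr => k _; congr (_ * _); rewrite [RHS]mxE.
by rewrite [LHS]mxE; apply: eq_bigr => k _; rewrite expr2; congr (_ * _); rewrite [LHS]mxE.
Qed.

(* Courant-Fischer, with a vector orthogonal to [i] eigenvectors of one matrix and to
   [N - 1 - i] of the other. *)
Lemma diag_form_le a b P Q i : P *m P^T = 1%:M -> Q *m Q^T = 1%:M ->
  {homo a : j k / (j <= k)%N >-> j <= k} -> {homo b : j k / (j <= k)%N >-> j <= k} ->
  (forall x, bil (diag_form a P) x x <= bil (diag_form b Q) x x) -> a i <= b i.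
Proof.
move=> PP QQ ha hb le_ab.
(* Column [i] is zero, so [T] is singular and some nonzero [x] satisfies all [N - 1] orthogonality
   conditions. *)
pose T := \matrix_(q, j) (if (j < i)%N then P j q else if (i < j)%N then Q j q else 0).
have : \det T = 0.
  by rewrite (expand_det_col _ i) big1 // => q _; rewrite mxE ltnn mul0r.
move/eqP/det0P => [x x0 xT].
have xTj j : (x *m T) 0 j = 0 by rewrite xT mxE.
have xP j : (j < i)%N -> (x *m P^T) 0 j = 0.
  by move=> ji; rewrite -[RHS](xTj j) !mxE; apply: eq_bigr => q _; rewrite !mxE ji.
have xQ j : (i < j)%N -> (x *m Q^T) 0 j = 0.
  move=> ij; rewrite -[RHS](xTj j) !mxE; apply: eq_bigr => q _; rewrite !mxE ij.
  by rewrite ltnNge (ltnW ij).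
have x1 : 0 < dot x x.
  by rewrite lt_def dot_ge0 andbT; apply: contra x0 => /eqP/dot_eq0 ->.
rewrite -(ler_pM2r x1) {1}(dot_orthogonal x PP) (dot_orthogonal x QQ).
apply: (le_trans _ (le_trans (le_ab x) _)); rewrite bil_diag_form mulr_sumr.
  apply: ler_sum => k _; have [ki|ik] := ltnP k i; first by rewrite xP // expr0n !mulr0.
  by rewrite ler_wpM2r ?sqr_ge0 // ha.
apply: ler_sum => k _; have [ik|ki] := ltnP i k; first by rewrite xQ // expr0n !mulr0.
by rewrite ler_wpM2r ?sqr_ge0 // hb.
Qed.

Lemma char_poly_diag_form a P : P *m P^T = 1%:M ->
  char_poly (diag_form a P) = \prod_k ('X - (a k)%:P).
Proof.
move=> PP; have PP' := mulmx1C PP.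
pose p := map_mx polyC P; pose D := diag_mx (\row_k a k).
have pp : p^T *m p = 1%:M by rewrite /p map_trmx -map_mxM PP' map_mx1.
have -> : char_poly (diag_form a P) = char_poly D.
  rewrite /char_poly.
  have -> : char_poly_mx (diag_form a P) = p^T *m char_poly_mx D *m p.
    rewrite /char_poly_mx mulmxBr mulmxBl mul_mx_scalar -scalemxAl pp scalemx1.
    by rewrite /diag_form !map_mxM -map_trmx.
  by rewrite !det_mulmx mulrAC -det_mulmx pp det1 mul1r.
rewrite char_poly_trig; last by rewrite diag_mx_is_trig.
by apply: eq_bigr => k _; rewrite !mxE eqxx mulr1n.
Qed.

Lemma eigseq_diag_form a P : P *m P^T = 1%:M ->
  is_eigseq (diag_form a P) (sort <=%R [seq a k | k <- enum 'I_N]).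
Proof.
move=> PP; split.
- by rewrite size_sort size_map size_enum_ord.
- exact/sort_sorted/le_total.
- rewrite char_poly_diag_form // (perm_big [seq a k | k <- enum 'I_N]) /=.
    by rewrite big_map big_enum.
  by rewrite perm_sort.
Qed.

(** Links the definition of [eig] by factorisation of the characteristic polynomial to an
    orthonormal basis: equal products of linear factors have the same roots up to a permutation,
    which is applied to the rows of [P]. *)
Lemma eig_diag A : A^T = A -> exists P, [/\ P *m P^T = 1%:M,
  A = diag_form (eig A) P & {homo eig A : j k / (j <= k)%N >-> j <= k}].
Proof.
move=> AT; have [P [d [PP AE]]] := symmetric_diag AT.
pose a k := d 0 k.
have {}AE : A = diag_form a P.
  by rewrite {1}AE /diag_form; congr (_ *m diag_mx _ *m _); apply/rowP => k; rewrite mxE.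
have [] : is_eigseq A (eigseq A).
  apply: xgetPex; exists (sort <=%R [seq a k | k <- enum 'I_N]).
  by rewrite {1}AE; exact: eigseq_diag_form.
move=> sz srt cpE.
pose t := [tuple a k | k < N].
have pt : perm_eq (eigseq A) t.
  apply: prod_XsubC_eq; rewrite -cpE AE char_poly_diag_form //= big_map.
  by rewrite enumT.
have /tuple_permP [s sE] := pt.
have eE i : eig A i = a (s i).
  rewrite /eig sE -tnth_nth tnth_mktuple tnth_mktuple; by [].
exists (row_perm s P); split.
- rewrite row_permE trmx_mul mulmxA -(mulmxA _ P) PP mulmx1 tr_perm_mx -perm_mxM.
  by rewrite mulgV perm_mx1.
- apply/matrixP => i j; rewrite {1}AE !diag_formE (reindex_inj (@perm_inj _ s)).
  by apply: eq_bigr => k _; rewrite !mxE eE.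
- move=> j k jk; rewrite /eig; apply: sorted_leq_nth => //; rewrite ?inE ?sz //.
  exact: le_trans.
Qed.

Lemma eig_le A B i : A^T = A -> B^T = B ->
  (forall x, bil A x x <= bil B x x) -> eig A i <= eig B i.
Proof.
move=> AT BT AB; have [P [PP AE hA]] := eig_diag AT; have [Q [QQ BE hB]] := eig_diag BT.
apply: diag_form_le PP QQ hA hB _ => x; by rewrite -AE -BE.
Qed.

Lemma diag_form_sym a P : (diag_form a P)^T = diag_form a P.
Proof. by rewrite /diag_form !trmx_mul trmxK tr_diag_mx mulmxA. Qed.

Lemma eig_diag_form a P i : P *m P^T = 1%:M ->
  {homo a : j k / (j <= k)%N >-> j <= k} -> eig (diag_form a P) i = a i.
Proof.
move=> PP ha; have [Q [QQ BE hB]] := eig_diag (diag_form_sym a P).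
apply/eqP; rewrite eq_le; apply/andP; split.
  by apply: diag_form_le QQ PP hB ha _ => x; rewrite -BE.
by apply: diag_form_le PP QQ ha hB _ => x; rewrite -BE.
Qed.

Lemma eig_shift A (t : R) i : A^T = A -> eig (A + t%:M) i = eig A i + t.
Proof.
move=> AT; have [P [PP AE hA]] := eig_diag AT.
have -> : A + t%:M = diag_form (fun k => eig A k + t) P.
  rewrite {1}AE /diag_form.
  have -> : diag_mx (\row_k (eig A k + t)) = diag_mx (\row_k eig A k) + t%:M :> 'M[R]_N.
    by apply/matrixP => q j; rewrite !mxE -mulrnDl.
  rewrite mulmxDr mulmxDl mul_mx_scalar -scalemxAl (mulmx1C PP) scalemx1.
  by [].
rewrite eig_diag_form // => j k jk; by rewrite lerD2r hA.
Qed.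

Lemma eig_scalar (t : R) i : eig (t%:M : 'M[R]_N) i = t.
Proof.
have -> : t%:M = diag_form (fun=> t) 1%:M.
  by rewrite /diag_form trmx1 mul1mx mulmx1; apply/matrixP => q j; rewrite !mxE.
by rewrite eig_diag_form ?trmx1 ?mulmx1.
Qed.

Lemma specnorm_lt A (e : R) x : A^T = A -> specnorm A < e ->
  bil A x x <= e * dot x x /\ - (e * dot x x) <= bil A x x.
Proof.
move=> AT sA; have [P [PP AE hA]] := eig_diag AT.
have eb k : `|eig A k| <= e by apply: le_trans (ltW sA); apply: le_bigmax.
rewrite AE bil_diag_form (dot_orthogonal x PP) mulr_sumr -sumrN; split; apply: ler_sum => k _.
  by apply: ler_wpM2r; [exact: sqr_ge0|exact: le_trans (ler_norm _) (eb k)].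
rewrite -mulNr; apply: ler_wpM2r; first exact: sqr_ge0.
by have := eb k; rewrite ler_norml => /andP[].
Qed.

Lemma specnorm_scalar (t : R) : specnorm (t%:M : 'M[R]_N) <= `|t|.
Proof. by apply: bigmax_le => // i _; rewrite eig_scalar. Qed.

End Eigenvalues.

(** * Monotonicity and strict increase of the phase *)

Section Phase.
Variables (R : realType) (N : nat).
Implicit Types (A B : 'M[R]_N).

Lemma Gop_le A B : A^T = A -> B^T = B ->
  (forall x, bil A x x <= bil B x x) -> Gop A <= Gop B.
Proof. by move=> AT BT AB; apply: ler_sum => i _; apply/le_atan/eig_le. Qed.

Lemma Gop_shift A (t : R) : A^T = A -> Gop (A + t%:M) = \sum_(i < N) atan (eig A i + t).
Proof. by move=> AT; apply: eq_bigr => i _; rewrite eig_shift. Qed.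

Lemma atan_lipschitz (x t : R) : 0 <= t -> atan (x + t) <= atan x + t.
Proof.
move=> t0; have xt : x <= x + t by rewrite lerDl.
have [c _ E] := @MVT_segment R atan (fun y => (1 + y ^+ 2)^-1) x (x + t) xt
  (fun y _ => is_derive1_atan y) (continuous_subspaceT (@continuous_atan R)).
rewrite -lerBlDl E (addrC x) addrK ler_piMl // invf_le1 ?lerDl ?sqr_ge0 //.
by rewrite ltr_pwDl ?sqr_ge0.
Qed.

Lemma Gop_shift_le A (t : R) : A^T = A -> 0 <= t -> Gop (A + t%:M) <= Gop A + N%:R * t.
Proof.
move=> AT t0; rewrite Gop_shift //.
apply: (@le_trans _ _ (\sum_(i < N) (atan (eig A i) + t))).
  by apply: ler_sum => i _; exact: atan_lipschitz.
by rewrite big_split /= sumr_const card_ord mulr_natl.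
Qed.

Lemma scalar_shift_sym A (t : R) : A^T = A -> (A + t%:M)^T = A + t%:M.
Proof. by move=> AT; rewrite linearD /= tr_scalar_mx AT. Qed.

Lemma bil_shift A (t : R) x : bil (A + t%:M) x x = bil A x x + t * dot x x.
Proof. by rewrite /bil mulmxDr mul_mx_scalar dotDl dotZl. Qed.

Lemma atan_increment_ge (M e : R) : 0 < e -> 0 <= M ->
  exists2 c : R, 0 < c & forall x, `|x| <= M -> atan x + c <= atan (x + e).
Proof.
move=> e0 M0; pose f x : R := atan (x + e) - atan x.
have NMM : - M <= M by lra.
have cf : {within `[- M, M], continuous f}.
  apply: continuous_subspaceT => x; apply: continuousB; last exact: continuous_atan.
  apply: (@continuous_comp _ _ _ (fun y : R => y + e) (@atan R)); last exact: continuous_atan.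
  by apply: continuousD; [exact: cvg_id|exact: cst_continuous].
have [x0 _ Hmin] := EVT_min NMM cf.
exists (f x0); first by rewrite subr_gt0; apply: lt_atan; rewrite ltrDl.
move=> x xM; have : f x0 <= f x by apply: Hmin; rewrite in_itv /= -ler_norml.
by rewrite /f; lra.
Qed.

Lemma atan_near_pihalf (tau : R) : 0 < tau -> exists2 M : R, 0 <= M &
  forall x, M <= x -> pi / 2 - tau <= atan x.
Proof.
move=> t0; have pi0 : 0 < pi / 2 :> R by rewrite divr_gt0 // pi_gt0.
pose y : R := Num.max 0 (pi / 2 - tau).
have y0 : 0 <= y by rewrite le_max lexx.
have yt : pi / 2 - tau <= y by rewrite le_max lexx orbT.
have ypi : y < pi / 2 by rewrite gt_max pi0 /=; lra.
have yin : y \in `](- (pi / 2)), (pi / 2)[ by rewrite in_itv /= ypi andbT; lra.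
have zin : (0 : R) \in `](- (pi / 2)), (pi / 2)[ by rewrite in_itv /= pi0 andbT; lra.
exists (tan y).
  have [->|yn0] := eqVneq y 0; first by rewrite tan0.
  by rewrite -tan0 ltW // ltr_tan // lt_def yn0.
move=> x xy; apply: (le_trans yt); rewrite -{1}(tanK yin).
exact: le_atan.
Qed.

(* Eigenvalues of large modulus contribute nearly [pi / 2] or [- pi / 2], so a phase away
   from the values [(N - 2 * j) * pi / 2] forces some eigenvalue to be bounded. *)
Lemma Gop_strict (h e : R) (k : nat) : (1 <= k <= N)%N ->
  (N%:R - 2 * k%:R) * pi / 2 < h -> h < (N%:R - 2 * (k%:R - 1)) * pi / 2 -> 0 < e ->
  exists2 c : R, 0 < c & forall A, A^T = A -> h - c <= Gop A -> h + c <= Gop (A + e%:M).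
Proof.
move=> /andP[k1 kN] hlo hhi e0.
have N0 : (0 < N)%N by exact: leq_trans kN.
have N0r : 0 < N%:R :> R by rewrite ltr0n.
set lo := (N%:R - 2 * k%:R) * pi / 2 in hlo; set hi := _ * pi / 2 in hhi.
have hiE : hi = lo + pi by rewrite /hi /lo; field.
pose d := Num.min (h - lo) (hi - h).
have d0 : 0 < d by rewrite lt_min !subr_gt0 hlo.
have d1 : d <= h - lo by rewrite ge_min lexx.
have d2 : d <= hi - h by rewrite ge_min lexx orbT.
pose tau := d / (4 * N%:R).
have tau0 : 0 < tau by rewrite divr_gt0 // mulr_gt0.
have Ntau : N%:R * tau = d / 4 by rewrite /tau; field; rewrite gt_eqF.
have [M M0 HM] := atan_near_pihalf tau0.
have [cM cM0 HcM] := atan_increment_ge e0 M0.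
(* A gain below [2 * c] is less than [cM], so no eigenvalue lies in [-M, M]; and [d / 4], with the
   same amount from [N%:R * tau], is less than the distance [d] from [h] to the ends of its
   interval. *)
pose c := Num.min (d / 4) (cM / 4).
have c0 : 0 < c by rewrite lt_min !divr_gt0.
have c1 : c <= d / 4 by rewrite ge_min lexx.
have c2 : c <= cM / 4 by rewrite ge_min lexx orbT.
exists c; first exact: c0.
move=> A AT GA; rewrite leNgt; apply/negP => Gs.
rewrite Gop_shift // in Gs.
pose inc i := atan (eig A i + e) - atan (eig A i).
have inc0 i : 0 <= inc i by rewrite subr_ge0; apply: le_atan; rewrite lerDl ltW.
have incs : \sum_(i < N) inc i < 2 * c by rewrite sumrB -/(Gop A); lra.
have big i : M < `|eig A i|.
  rewrite ltNge; apply/negP => /HcM h1.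
  have : inc i <= \sum_(i < N) inc i by rewrite (bigD1 i) //= lerDl; apply: sumr_ge0.
  by rewrite {1}/inc; lra.
have Gub : Gop A < h + c.
  apply: le_lt_trans Gs; apply: ler_sum => i _; apply: le_atan; by rewrite lerDl ltW.
pose neg := [pred i | eig A i < 0].
(* With every eigenvalue large in modulus, the phase is within [d / 4] of
   [N%:R * (pi / 2) - j%:R * pi]. Such values lie at or below [lo], or at or above [hi], too far
   from [h] in both cases. *)
pose j := #|neg|.
have near i : `|atan (eig A i) - (pi / 2 - (neg i)%:R * pi)| <= tau.
  have := big i; rewrite /neg /=; case: (ltP (eig A i) 0) => l0.
    rewrite ltr0_norm // => /ltW /HM; rewrite atanN.
    have := atan_gtNpi2 (eig A i); rewrite ler_norml mul1r => *.
    by apply/andP; split; lra.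
  rewrite ger0_norm // => /ltW /HM; have := atan_ltpi2 (eig A i).
  by rewrite ler_norml mul0r subr0 => *; apply/andP; split; lra.
have sumE : \sum_(i < N) (pi / 2 - (neg i)%:R * pi) = N%:R * (pi / 2) - j%:R * pi :> R.
  rewrite big_split /= sumr_const card_ord -[X in X + _]mulr_natl sumrN -mulr_suml.
  have -> : j = (\sum_(i < N) neg i)%N.
    by rewrite /j -sum1_card big_mkcond; apply: eq_bigr => i _; rewrite inE /=; case: ltP.
  by rewrite natr_sum.
have tot : `|Gop A - (N%:R * (pi / 2) - j%:R * pi)| <= N%:R * tau.
  rewrite -sumE -sumrB; apply: (le_trans (ler_norm_sum _ _ _)).
  apply: (le_trans (ler_sum _ (fun i _ => near i))).
  by rewrite sumr_const card_ord mulr_natl.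
have pi0 : 0 < pi :> R := pi_gt0 R.
have loE : lo = N%:R * (pi / 2) - k%:R * pi by rewrite /lo; field.
move: tot; rewrite Ntau ler_norml => /andP[t1 t2].
have [kj|jk] := leqP k j.
  have : k%:R * pi <= j%:R * pi :> R by rewrite ler_wpM2r ?ler_nat // ltW.
  by lra.
have : (j%:R + 1) * pi <= k%:R * pi :> R by rewrite ler_wpM2r ?natr1 ?ler_nat // ltW.
lra.
Qed.

End Phase.

(** * Topology through the Euclidean norm; maxima of semicontinuous functions *)

Section EuclideanTopology.
Variables (R : realType) (N : nat).
Implicit Types (x y : 'rV[R]_N) (D K : set 'rV[R]_N).

Lemma norm_le_enorm x : `|x| <= enorm x.
Proof. by apply: mx_norm_le; [exact: enorm_ge0|exact: coord_le_enorm]. Qed.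

Lemma enorm_le_norm x : enorm x <= N%:R * `|x|.
Proof. by apply: enorm_le_sup => // k; exact: coord_le_norm. Qed.

Lemma enormC x y : enorm (x - y) = enorm (y - x).
Proof. by rewrite -enormN opprB. Qed.

Lemma nbhs_enormP x (P : set 'rV[R]_N) :
  nbhs x P <-> exists2 d : R, 0 < d & forall y, enorm (y - x) < d -> P y.
Proof.
split=> [/nbhs_normP[d /= d0 HP]|[d d0 HP]].
  exists d => // y yx; apply: HP; rewrite /ball_ /=; apply: le_lt_trans yx.
  by rewrite enormC norm_le_enorm.
apply: (iffRL (nbhs_normP x P)); have N1 : 0 < N%:R + 1 :> R by rewrite ltr_wpDl.
exists (d / (N%:R + 1)); first by rewrite /= divr_gt0.
move=> y; rewrite /ball_ /= ltr_pdivlMr // => yx; apply: HP; rewrite enormC.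
apply: le_lt_trans (enorm_le_norm _) _; apply: le_lt_trans yx.
by rewrite mulrC ler_wpM2l // lerDl.
Qed.

Lemma open_enorm D x : open D -> D x ->
  exists2 d : R, 0 < d & forall y, enorm (y - x) < d -> D y.
Proof. by move=> oD Dx; apply/nbhs_enormP; apply: open_nbhs_nbhs. Qed.

Lemma continuous_enorm D (h : 'rV[R]_N -> R) x (e : R) :
  open D -> {within D, continuous h} -> D x -> 0 < e ->
  exists2 d : R, 0 < d & forall y, enorm (y - x) < d -> `|h y - h x| < e.
Proof.
move=> oD; rewrite continuous_open_subspace // => hc Dx e0.
have := hc x (mem_set Dx) => /cvgrPdist_lt /(_ _ e0) /nbhs_enormP[d d0 Hd].
by exists d => // y /Hd; rewrite distrC.
Qed.

Lemma usc_max K (f : 'rV[R]_N -> R) : K !=set0 -> compact K -> usc_on K f ->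
  exists2 x, K x & forall y, K y -> f y <= f x.
Proof.
move=> [x0 Kx0] cK uf; apply: contrapT => nomax.
have up x : K x -> exists2 y, K y & f x < f y.
  move=> Kx; apply: contrapT => Hn; apply: nomax; exists x => // y Ky.
  by rewrite leNgt; apply/negP => xy; apply: Hn; exists y.
(* The filter of superlevel sets of [f] on [K]. If no maximum is attained, compactness yields a
   superlevel set every point of which has a value above all values of [f] on [K], including its
   own. *)
pose F : set_system 'rV[R]_N := fun A =>
  exists2 y0, K y0 & forall y, K y -> f y0 <= f y -> A y.
have FF : Filter F.
  split.
  - by exists x0.
  - move=> A B [a Ka HA] [b Kb HB]; have [ab|ba] := leP (f a) (f b).
      by exists b => // y Ky by_; split; [apply: HA => //; exact: le_trans by_|exact: HB].
    by exists a => // y Ky ay; split; [exact: HA|apply: HB => //; apply: le_trans (ltW ba) ay].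
  - by move=> A B AB [a Ka HA]; exists a => // y Ky ay; apply/AB/HA.
move/compact_near_coveringP/(_ _ F (fun y x => K x -> f x < f y) FF): cK => H.
have [x Kx|y0 Ky0 Hy0] := H; last by have := Hy0 _ Ky0 (lexx _) _ Ky0 Ky0; rewrite ltxx.
have [y1 Ky1 xy1] := up x Kx.
have [|d d0 Hd] := uf x Kx (f y1 - f x); first by rewrite subr_gt0.
exists ([set x' | enorm (x' - x) < d], [set y | K y /\ f y1 <= f y]).
  split=> /=; first by apply/nbhs_enormP; exists d.
  by exists y1.
case=> x' y /= [x'd [Ky y1y]] Kx'.
by apply: lt_le_trans y1y; have := Hd x' Kx' x'd; rewrite addrC subrK.
Qed.

Lemma compact_enorm_ball x (r : R) : compact [set y | enorm (y - x) <= r].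
Proof.
have [r0|r0] := ltP r 0.
  rewrite (_ : [set y | _] = set0); first exact: compact0.
  apply/seteqP; split => y //= yr; have := enorm_ge0 (y - x); lra.
apply: bounded_closed_compact.
  exists (r + `|x|); split; first exact: num_real.
  move=> M rM y /= yr; apply: le_trans (ltW rM).
  rewrite -[y](subrK x); apply: (le_trans (ler_normD _ _)); rewrite lerD2r.
  exact: le_trans (norm_le_enorm _) yr.
rewrite (_ : [set y | _] =
   (fun y : 'rV[R]_N => dot y y - 2 * dot x y) @^-1` [set t | t <= r ^+ 2 - dot x x]).
  apply: closed_comp => [y _|]; last exact: closed_le.
  have c1 : {for y, continuous (fun y : 'rV[R]_N => dot y y)}.
    rewrite (_ : (fun y => _) = fun y : 'rV[R]_N => bil 1%:M y y); first exact: continuous_bil.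
    by apply/funext => z; rewrite /bil mulmx1.
  have c2 : {for y, continuous (fun y : 'rV[R]_N => 2 * dot x y)}.
    by apply: continuousM; [exact: cst_continuous|exact: continuous_dot].
  exact: (continuousB c1 c2).
apply/seteqP; split => y /=; rewrite -(ler_sqr (enorm_ge0 _)) ?nnegrE // enorm_sqr;
  rewrite !dotE (dotC y x); lra.
Qed.

End EuclideanTopology.

(** * Quadratic polynomials as test functions *)

Section QuadraticTestFunctions.
Variables (R : realType) (N : nat).
Implicit Types (x v : 'rV[R]_N).

Lemma is_derive_along (f : 'rV[R]_N -> R) x v (L M : R) :
  (forall t : R, f (t *: v + x) = f x + t * L + t ^+ 2 * M) -> is_derive x v f L.
Proof.
move=> H.
have cv : (fun t : R => t^-1 *: ((f \o shift x) (t *: v) - f x)) @ 0^' --> L.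
  have cL : (fun t : R => L + t * M) @ 0^' --> L.
    have : {for 0, continuous (fun t : R => L + t * M)}.
      apply: continuousD; first exact: cst_continuous.
      by apply: continuousM; [exact: cvg_id|exact: cst_continuous].
    rewrite /prop_for /continuous_at /= mul0r addr0; apply: cvg_trans; apply: cvg_app.
    exact: nbhs_dnbhs.
  apply: cvg_trans cL; apply: near_eq_cvg; near=> t.
  have t0 : t != 0 by near: t; exact: nbhs_dnbhs_neq.
  rewrite /= H; rewrite -[RHS]/(t^-1 * (f x + t * L + t ^+ 2 * M - f x)).
  by field.
apply: DeriveDef; first by apply/cvg_ex; exists L.
exact: cvg_lim cv.
Unshelve. all: by end_near.
Qed.

(** This family is closed under partial derivatives, with [H] replaced by 0, so second derivatives
    follow from two uses of [pd_quad]. *)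
Definition quad x0 (c : R) (b : 'rV[R]_N) (H : 'M[R]_N) x : R :=
  c + dot b (x - x0) + 2^-1 * bil H (x - x0) (x - x0).

Variables (x0 b : 'rV[R]_N) (c : R) (H : 'M[R]_N).
Hypothesis HT : H^T = H.

Lemma is_derive_quad x v :
  is_derive x v (quad x0 c b H) (dot b v + bil H (x - x0) v).
Proof.
apply: (@is_derive_along _ _ _ _ (2^-1 * bil H v v)) => t; rewrite /quad.
have -> : t *: v + x - x0 = t *: v + (x - x0) by rewrite addrA.
move: (x - x0) => d; rewrite !(bilDl, bilDr, bilZl, bilZr, dotDr, dotZr) (bilC d v HT).
by field.
Qed.

Lemma pd_quad i : pd i (quad x0 c b H) = quad x0 (b 0 i) (evec R i *m H) 0.
Proof.
apply/funext => x; rewrite /pd (@derive_val _ _ _ _ _ _ _ (is_derive_quad x (evec R i))).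
rewrite dot_delta (bilC _ _ HT) /quad.
by rewrite [bil 0 _ _]/bil mulmx0 dot0l mulr0 addr0.
Qed.

End QuadraticTestFunctions.

Section HessianOfQuadratics.
Variables (R : realType) (N : nat).
Implicit Types (x : 'rV[R]_N).

Lemma continuous_quad x0 (c : R) b (H : 'M[R]_N) : continuous (quad x0 c b H).
Proof.
have shc : continuous (fun x : 'rV[R]_N => x - x0).
  by move=> x; apply: continuousB; [exact: cvg_id|exact: cst_continuous].
move=> x.
have d1 : {for x, continuous (fun y : 'rV[R]_N => dot b (y - x0))}.
  by apply: (continuous_comp (shc x)); exact: continuous_dot.
have b1 : {for x, continuous (fun y : 'rV[R]_N => bil H (y - x0) (y - x0))}.
  by apply: (continuous_comp (shc x) (g := fun y => bil H y y)); exact: continuous_bil.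
have c1 : {for x, continuous (fun=> c : R)} by exact: cst_continuous.
have c2 : {for x, continuous (fun=> 2^-1 : R)} by exact: cst_continuous.
exact: (continuousD (continuousD c1 d1) (continuousM c2 b1)).
Qed.

Lemma pd_pd_quad x0 (c : R) b (H : 'M[R]_N) i j : H^T = H ->
  pd i (pd j (quad x0 c b H)) = fun=> H i j.
Proof.
move=> HT; rewrite pd_quad // pd_quad ?trmx0 //; apply/funext => x.
rewrite /quad /bil !mulmx0 !dot0l mulr0 !addr0 -rowE mxE.
by rewrite -{1}HT mxE.
Qed.

Lemma C2near_quad x0 (c : R) b (H : 'M[R]_N) x : H^T = H -> C2near (quad x0 c b H) x.
Proof.
move=> HT; exists 1 => // y _; split.
- exact: continuous_quad.
- move=> i; split; first by have [] := is_derive_quad x0 b c HT y (evec R i).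
  by rewrite pd_quad //; exact: continuous_quad.
- move=> i j; split; last by rewrite pd_pd_quad //; exact: cst_continuous.
  rewrite pd_quad //.
  by have [] := is_derive_quad x0 (evec R j *m H) (b 0 j) (trmx0 _ _ _) y (evec R i).
Qed.

Lemma hessian_quad x0 (c : R) b (H : 'M[R]_N) x : H^T = H -> hessian (quad x0 c b H) x = H.
Proof. by move=> HT; apply/matrixP => i j; rewrite mxE pd_pd_quad. Qed.

End HessianOfQuadratics.

(** * The map [ThetaG]: ellipticity, boundary and Hausdorff continuity *)

Section Theta.
Variables (R : realType) (N : nat).
Implicit Types (p q : R * 'M[R]_N) (h : 'rV[R]_N -> R).

(** The spectral norm of the difference is below [e], so [q.2] lies below [p.2 + e%:M] in the matrix
    order, and each of the [N] arctangents grows by at most [e]. *)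
Lemma Gop_pdist p q (e : R) : SN p -> SN q -> pdist q p < e -> Gop q.2 <= Gop p.2 + N%:R * e.
Proof.
move=> Sp Sq; rewrite /pdist /pnorm gt_max => /andP[q1 sn] /=.
have e0 : 0 <= e by apply: le_trans (ltW q1).
apply: le_trans (Gop_shift_le Sp e0); apply: Gop_le => //.
  exact: scalar_shift_sym.
move=> x; have ST : (q.2 - p.2)^T = q.2 - p.2 by rewrite linearB /= Sp Sq.
have [+ _] := specnorm_lt x ST sn; rewrite bil_shift /bil mulmxBr dotDl dotNl; lra.
Qed.

Lemma Gop_pdistC p q (e : R) : SN p -> SN q -> pdist q p < e -> Gop p.2 <= Gop q.2 + N%:R * e.
Proof.
move=> Sp Sq; rewrite /pdist /pnorm gt_max => /andP[q1 sn] /=.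
have e0 : 0 <= e by apply: le_trans (ltW q1).
apply: le_trans (Gop_shift_le Sq e0); apply: Gop_le => //.
  exact: scalar_shift_sym.
move=> x; have ST : (q.2 - p.2)^T = q.2 - p.2 by rewrite linearB /= Sp Sq.
have [_] := specnorm_lt x ST sn; rewrite bil_shift /bil mulmxBr dotDl dotNl; lra.
Qed.

Lemma le_of_all_eps (a b : R) : (forall e, 0 < e -> a <= b + N%:R * e) -> a <= b.
Proof.
move=> H; rewrite leNgt; apply/negP => ba.
have N1 : 0 < N%:R + 1 :> R by rewrite ltr_wpDl.
have e0 : 0 < (a - b) / (N%:R + 1) by rewrite divr_gt0 // subr_gt0.
have := H _ e0; have : ((a - b) / (N%:R + 1)) * (N%:R + 1) = a - b by rewrite divfK ?gt_eqF.
move: (_ / _) e0 => t t0; lra.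
Qed.

Lemma ThetaG_closed h x : closedS (ThetaG h x).
Proof.
split=> [p []//|p Sp H]; split=> //; apply: le_of_all_eps => e e0.
have [q [Sq hq] qp] := H e e0.
exact: le_trans hq (Gop_pdist Sp Sq qp).
Qed.

Lemma ThetaG_boundary h x :
  boundaryS (ThetaG h x) `<=` [set p | SN p /\ Gop p.2 = h x].
Proof.
move=> p [Sp H]; split=> //; apply/eqP; rewrite eq_le; apply/andP; split.
  apply: le_of_all_eps => e e0; have [_ [q [Sq nq] qp]] := H e e0.
  apply: (le_trans (Gop_pdistC Sp Sq qp)); rewrite lerD2r leNgt; apply/negP => hq.
  by apply: nq; split => //; exact: ltW.
have [_] := ThetaG_closed h x; move=> /(_ p Sp) [|//] e e0.
by have [] := H e e0.
Qed.

Lemma psd_bil (P : 'M[R]_N) x : psd P -> 0 <= bil P x x.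
Proof.
move=> [_ /(_ x^T)]; rewrite trmxK; congr (_ <= _); rewrite mxE; apply: eq_bigr => k _.
by rewrite [x^T _ _]mxE.
Qed.

Lemma Gop_scalar (t : R) : Gop (t%:M : 'M[R]_N) = N%:R * atan t.
Proof.
rewrite /Gop; under eq_bigr do rewrite eig_scalar.
by rewrite sumr_const card_ord mulr_natl.
Qed.

Lemma ThetaG_proper (Om : set 'rV[R]_N) h (k : nat) : (1 <= k <= N)%N ->
  (forall x, Om x -> (N%:R - 2 * k%:R) * pi / 2 < h x /\
                     h x < (N%:R - 2 * (k%:R - 1)) * pi / 2) ->
  proper_elliptic_map Om (ThetaG h).
Proof.
move=> /andP[k1 kN] hI x /hI[hlo hhi].
have pi0 : 0 < pi :> R := pi_gt0 R.
have N0 : 0 < N%:R :> R by rewrite ltr0n (leq_trans k1 kN).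
have k1r : 1 <= k%:R :> R by rewrite ler1n.
have kNr : k%:R <= N%:R :> R by rewrite ler_nat.
have kp : 1 * pi <= k%:R * pi :> R by rewrite ler_pM2r.
have kp' : k%:R * pi <= N%:R * pi :> R by rewrite ler_pM2r.
have hN : h x < N%:R * (pi / 2) by lra.
have hN' : - (N%:R * (pi / 2)) < h x by lra.
have symS (t : R) : (t%:M : 'M[R]_N)^T = t%:M by rewrite tr_scalar_mx.
split.
- exact: ThetaG_closed.
- have t0 : 0 < (N%:R * (pi / 2) - h x) / N%:R by rewrite divr_gt0 // subr_gt0.
  have [M M0 HM] := atan_near_pihalf t0.
  exists (0, M%:M); split => /=; first exact: symS.
  rewrite Gop_scalar; have := ler_wpM2l (ltW N0) (HM M (lexx _)).
  by rewrite mulrBr [X in _ - X]mulrC divfK ?gt_eqF //; lra.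
- have t0 : 0 < (N%:R * (pi / 2) + h x) / N%:R / 2.
    by rewrite !divr_gt0 //; lra.
  have [M M0 HM] := atan_near_pihalf t0.
  move=> TE; have : ThetaG h x (0, (- M)%:M) by rewrite TE; exact: symS.
  move=> [_] /=; rewrite Gop_scalar atanN.
  have := ler_wpM2l (ltW N0) (HM M (lexx _)); rewrite mulrBr.
  have -> : N%:R * ((N%:R * (pi / 2) + h x) / N%:R / 2) = (N%:R * (pi / 2) + h x) / 2.
    by field; rewrite gt_eqF.
  lra.
- move=> p q [Sp Gp] [_ Pq]; have [Sq _] := Pq.
  have ST : (p.2 + q.2)^T = p.2 + q.2 by rewrite linearD /= Sp Sq.
  split; first exact: ST.
  apply: (le_trans Gp); apply: (Gop_le Sp ST) => y.
  by have := psd_bil y Pq; rewrite /bil mulmxDr dotDl; lra.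
Qed.

(** Adding [(eta / 2)%:M] moves a point by at most [eta / 2] and raises the phase enough to cross
    the change of [h]. The constant of [Gop_strict] at [x] serves both inclusions, because its
    hypothesis tolerates a phase down to [h x - c]. *)
Lemma ThetaG_hausdorff (Om : set 'rV[R]_N) h (k : nat) : open Om ->
  {within Om, continuous h} -> (1 <= k <= N)%N ->
  (forall x, Om x -> (N%:R - 2 * k%:R) * pi / 2 < h x /\
                     h x < (N%:R - 2 * (k%:R - 1)) * pi / 2) ->
  hausdorff_continuous Om (ThetaG h).
Proof.
move=> oOm hc kN hI x Ox eta eta0; have [hlo hhi] := hI x Ox.
have e0 : 0 < eta / 2 by rewrite divr_gt0.
have [c c0 Hc] := Gop_strict kN hlo hhi e0.
have [d d0 Hd] := continuous_enorm oOm hc Ox c0.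
exists d => // y Oy; rewrite enormC => /Hd; rewrite ltr_norml => /andP[h1 h2].
have shift a b : (forall A : 'M[R]_N, A^T = A -> h a <= Gop A -> h b <= Gop (A + (eta / 2)%:M)) ->
    (exc (ThetaG h a) (ThetaG h b) <= (eta / 2)%:E)%E.
  move=> H; apply: ge_ereal_sup => _ [p [Sp hp] <-].
  apply: ereal_inf_le; exists (pdist p (p.1, p.2 + (eta / 2)%:M))%:E.
    exists (p.1, p.2 + (eta / 2)%:M); last by [].
    by split; [exact: scalar_shift_sym|exact: H].
  rewrite lee_fin /pdist /pnorm /= subrr normr0 opprD addrA subrr add0r ge_max ltW //=.
  have -> : - (eta / 2)%:M = (- (eta / 2))%:M :> 'M[R]_N by rewrite raddfN.
  apply: (le_trans (specnorm_scalar _ _)).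
  by rewrite normrN gtr0_norm.
apply: (@le_lt_trans _ _ (eta / 2)%:E); last by rewrite lte_fin; lra.
rewrite /hausdorff_dist ge_max; apply/andP; split; apply: shift => A AT hA.
  have hA' : h x - c <= Gop A by apply: le_trans hA; rewrite gerBl ltW.
  by apply: le_trans (Hc A AT hA'); rewrite -lerBlDl ltW.
have hA' : h x - c <= Gop A by apply: le_trans hA; rewrite lerBlDr -lerBlDl; lra.
by apply: le_trans (Hc A AT hA'); rewrite lerDl ltW.
Qed.

End Theta.

(** * The comparison principle *)

Section Comparison.
Variables (R : realType) (N : nat).
Implicit Types (x y xi eta ta : 'rV[R]_N) (u v f g h : 'rV[R]_N -> R).

Lemma usc_onD (D : set 'rV[R]_N) f g :
  usc_on D f -> continuous g -> usc_on D (fun x => f x + g x).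
Proof.
move=> uf cg x Dx ep ep0; have ep2 : 0 < ep / 2 by rewrite divr_gt0.
have [d1 d10 H1] := uf x Dx _ ep2.
have /cvgrPdist_lt /(_ _ ep2) /nbhs_enormP[d2 d20 H2] := cg x.
exists (Num.min d1 d2); first by rewrite lt_min d10.
move=> y Dy; rewrite lt_min => /andP[/(H1 _ Dy) h1 /H2].
by rewrite ltr_norml => /andP[h2 h3]; lra.
Qed.

(** Raising the Hessian by [4 * e] adds [2 * e * r ^+ 2] to the paraboloid on the sphere of radius
    [r], twice the permitted error, so the maximum of the difference over the closed ball is
    attained inside. Re-expanding the paraboloid there gives the test function. *)
Lemma touching_paraboloid f xi (r e : R) l (X : 'M[R]_N) : 0 < r -> 0 < e -> X^T = X ->
  usc_on [set y | enorm (y - xi) <= r] f ->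
  (forall ta, enorm ta <= r ->
    f (xi + ta) <= f xi + dot l ta + 2^-1 * bil X ta ta + e * r ^+ 2) ->
  exists y b (rho : R), [/\ enorm (y - xi) < r, 0 < rho &
    forall z, enorm (z - y) < rho -> f z <= quad y (f y) b (X + (4 * e)%:M) z].
Proof.
move=> r0 e0 XT uf Hf; pose K := [set y | enorm (y - xi) <= r].
pose q := quad xi 0 l (X + (4 * e)%:M).
have XeT : (X + (4 * e)%:M)^T = X + (4 * e)%:M by exact: scalar_shift_sym.
have ug : usc_on K (fun y => f y - q y).
  apply: usc_onD => // y; apply: continuousN; exact: continuous_quad.
have K0 : K !=set0 by exists xi; rewrite /K /= subrr enorm0 ltW.
have [y Ky ymax] := usc_max K0 (@compact_enorm_ball R N xi r) ug.
have qE ta : q (xi + ta) = dot l ta + 2^-1 * bil X ta ta + 2 * e * dot ta ta.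
  by rewrite /q /quad (addrC xi ta) addrK bil_shift; field.
have yr : enorm (y - xi) < r.
  have := ymax xi; rewrite /K /= subrr enorm0 => /(_ (ltW r0)).
  have -> : q xi = 0 by rewrite -[xi]addr0 qE dot0r bil0l dot0l !mulr0 !addr0.
  have yE : xi + (y - xi) = y by rewrite addrC subrK.
  have := Hf (y - xi) Ky; have := qE (y - xi); rewrite yE -enorm_sqr => -> h1 h2.
  rewrite -(ltr_sqr (enorm_ge0 _)) ?nnegrE ?(ltW r0) // -(ltr_pM2l e0).
  have : 0 < e * r ^+ 2 by rewrite mulr_gt0 // exprn_gt0.
  by lra.
exists y, (l + (y - xi) *m (X + (4 * e)%:M)), (r - enorm (y - xi)); split => //.
  by rewrite subr_gt0.
move=> z zy; have Kz : K z.
  rewrite /K /= -[z](subrK y) -addrA; apply: (le_trans (enormD _ _)); lra.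
have := ymax z Kz; rewrite /quad.
have -> : q z = q y + dot (l + (y - xi) *m (X + (4 * e)%:M)) (z - y) +
    2^-1 * bil (X + (4 * e)%:M) (z - y) (z - y).
  rewrite /q /quad; have -> : z - xi = (y - xi) + (z - y).
    by apply/rowP => i; rewrite !mxE; ring.
  move: (z - y) (y - xi) => a c; rewrite dotDl -/(bil (X + (4 * e)%:M) c a).
  move: XeT; move: (X + _) => Z ZT.
  by rewrite !(bilDl, bilDr, dotDr) (bilC a c ZT); field.
lra.
Qed.

Lemma visc_sub_quad (Om : set 'rV[R]_N) h u y b (Z : 'M[R]_N) (rho : R) :
  visc_sub Om h u -> Om y -> Z^T = Z -> 0 < rho ->
  (forall z, enorm (z - y) < rho -> u z <= quad y (u y) b Z z) -> h y <= Gop Z.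
Proof.
move=> [_ Hu] Oy ZT r0 Hq.
have qy : quad y (u y) b Z y = u y by rewrite /quad subrr dot0r bil0l mulr0 !addr0.
apply: (Hu y Oy (u y, Z)); exists (quad y (u y) b Z); split => //.
- exact: C2near_quad.
- by exists rho.
- by rewrite hessian_quad // qy.
Qed.

Lemma visc_super_quad (Om : set 'rV[R]_N) h v y b (Z : 'M[R]_N) (rho : R) :
  visc_super Om h v -> Om y -> Z^T = Z -> 0 < rho ->
  (forall z, enorm (z - y) < rho -> quad y (v y) b Z z <= v z) -> Gop Z <= h y.
Proof.
move=> [_ Hv] Oy ZT r0 Hq.
have qy : quad y (v y) b Z y = v y by rewrite /quad subrr dot0r bil0l mulr0 !addr0.
apply: (Hv y Oy (v y, Z)); exists (quad y (v y) b Z); split => //.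
- exact: C2near_quad.
- by exists rho.
- by rewrite hessian_quad // qy.
Qed.

Lemma bounded_closure_coord (Om : set 'rV[R]_N) : bounded_set Om ->
  exists2 L : R, 0 < L & forall x k, closure Om x -> `|x 0 k| <= L.
Proof.
move=> [M [_ HM]]; pose L := Num.max M 0 + 1.
have ML : M < L by rewrite /L; have : M <= Num.max M 0 by [rewrite le_max lexx]; lra.
have L0 : 0 < L by rewrite /L; have : 0 <= Num.max M 0 by [rewrite le_max lexx orbT]; lra.
exists (L + 1); first by lra.
move=> x k cx; have B : nbhs x [set y | enorm (y - x) < 1].
  by apply/nbhs_enormP; exists 1.
have [y [Oy /= yx]] := cx _ B.
have := HM L ML y Oy => /= yL.
have -> : x 0 k = y 0 k - (y - x) 0 k by rewrite !mxE; ring.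
apply: (le_trans (ler_normB _ _)); apply: lerD.
  exact: le_trans (coord_le_norm _ _) yL.
exact: le_trans (coord_le_enorm _ _) (ltW yx).
Qed.

Lemma compact_closure_bounded (Om : set 'rV[R]_N) : bounded_set Om -> compact (closure Om).
Proof.
move=> /bounded_closure_coord[L L0 HL]; apply: bounded_closed_compact; last exact: closed_closure.
exists L; split; first exact: num_real.
move=> M LM x cx; apply: le_trans (ltW LM); apply: mx_norm_le; first exact: ltW.
by move=> k; exact: HL.
Qed.

(* [w] is a Lebesgue number of the cover by balls on which the constant [c] is fixed. *)
Lemma localisation (Om : set 'rV[R]_N) h u v (k : nat) (m e : R) :
  open Om -> bounded_set Om -> {within Om, continuous h} -> (1 <= k <= N)%N ->
  (forall x, Om x -> (N%:R - 2 * k%:R) * pi / 2 < h x /\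
                     h x < (N%:R - 2 * (k%:R - 1)) * pi / 2) ->
  usc_on (closure Om) u -> lsc_on (closure Om) v ->
  (forall x, (closure Om `\` Om) x -> u x <= v x) -> 0 < m -> 0 < e ->
  exists2 w : R, 0 < w & forall xi eta, closure Om xi -> closure Om eta ->
    enorm (eta - xi) < w -> m <= u xi - v eta ->
    exists x (c : R), [/\ 0 < c,
      forall A : 'M[R]_N, A^T = A -> h x - c <= Gop A -> h x + c <= Gop (A + e%:M) &
      forall y, enorm (y - xi) < w \/ enorm (y - eta) < w -> Om y /\ `|h y - h x| < c].
Proof.
move=> oOm bOm hc kN hI uu lv bd m0 e0.
(* With [w] as the parameter tending to 0, the near-covering form of compactness returns a single
   [w] for all [xi]. *)
pose P (w : R) xi := closure Om xi -> forall eta, closure Om eta ->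
    enorm (eta - xi) < w -> m <= u xi - v eta ->
    exists x (c : R), [/\ 0 < c,
      forall A : 'M[R]_N, A^T = A -> h x - c <= Gop A -> h x + c <= Gop (A + e%:M) &
      forall y, enorm (y - xi) < w \/ enorm (y - eta) < w -> Om y /\ `|h y - h x| < c].
suff H : \forall w \near 0^'+, closure Om `<=` P w.
  have [w [w0 Hw]] := filter_ex (filterI (nbhs_right_gt (0 : R)) H).
  by exists w => // xi eta cxi ceta; exact: Hw.
have := compact_closure_bounded bOm => /compact_near_coveringP; apply => x cx.
have m2 : 0 < m / 2 by rewrite divr_gt0.
have [d1 d10 H1] := uu x cx _ m2; have [d2 d20 H2] := lv x cx _ m2.
suff [d d0 Hd] : exists2 d : R, 0 < d & forall xi (w : R), enorm (xi - x) < d ->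
    0 < w < d -> P w xi.
  exists ([set xi | enorm (xi - x) < d], [set w : R | 0 < w < d]); last first.
    by case=> xi w /= [h1 h2]; exact: Hd.
  split => /=; first by apply/nbhs_enormP; exists d.
  near=> w; apply/andP; split; near: w; [exact: nbhs_right_gt|exact: nbhs_right_lt].
pose d3 := Num.min d1 d2.
have d30 : 0 < d3 by rewrite lt_min d10.
have d31 : d3 <= d1 by rewrite ge_min lexx.
have d32 : d3 <= d2 by rewrite ge_min lexx orbT.
have tri (a b c' : 'rV[R]_N) : enorm (a - c') <= enorm (a - b) + enorm (b - c') :> R.
  by apply: le_trans (enormD _ _); rewrite addrA subrK.
(* If u is at most v at [x], semicontinuity excludes nearby pairs with gap [m]; this covers all
   boundary points. Otherwise [x] is interior and [Gop_strict] applies at [h x]. *)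
have [uv|uv] := leP (u x) (v x).
  exists (d3 / 2); first by rewrite divr_gt0.
  move=> xi w xid /andP[w0 wd] cxi eta ceta etaw mu; exfalso.
  have h1 : u xi < u x + m / 2 by apply: H1 => //; lra.
  have h2 : v x - m / 2 < v eta.
    by apply: H2 => //; have := tri eta xi x; lra.
  lra.
have Ox : Om x.
  by apply: contrapT => nO; have := bd x (conj cx nO); rewrite leNgt uv.
have [hlo hhi] := hI x Ox.
have [c c0 Hc] := Gop_strict kN hlo hhi e0.
have [d4 d40 H4] := continuous_enorm oOm hc Ox c0.
have [d5 d50 H5] := open_enorm oOm Ox.
pose d6 := Num.min d4 d5.
have d60 : 0 < d6 by rewrite lt_min d40.
have d64 : d6 <= d4 by rewrite ge_min lexx.
have d65 : d6 <= d5 by rewrite ge_min lexx orbT.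
exists (d6 / 3); first by rewrite divr_gt0.
move=> xi w xid /andP[w0 wd] cxi eta ceta etaw mu.
exists x, c; split => // y Hy.
have yx : enorm (y - x) < d6.
  case: Hy => Hy; first by have := tri y xi x; lra.
  by have := tri y eta x; have := tri eta xi x; lra.
by split; [apply: H5; exact: lt_le_trans d65|apply: H4; exact: lt_le_trans d64].
Unshelve. all: by end_near.
Qed.

Lemma comparison (Om : set 'rV[R]_N) h (k : nat) u v :
  open Om -> bounded_set Om -> {within Om, continuous h} -> (1 <= k <= N)%N ->
  (forall x, Om x -> (N%:R - 2 * k%:R) * pi / 2 < h x /\
                     h x < (N%:R - 2 * (k%:R - 1)) * pi / 2) ->
  usc_on (closure Om) u -> lsc_on (closure Om) v ->
  visc_sub Om h u -> visc_super Om h v ->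
  (forall x, (closure Om `\` Om) x -> u x <= v x) ->
  forall x, Om x -> u x <= v x.
Proof.
move=> oOm bOm hc kN hI uu lv su sv bd xb Oxb; rewrite leNgt; apply/negP => uv.
have N0 : (0 < N)%N by case/andP: kN => k1; apply: leq_trans.
pose D := closure Om; have OD : Om `<=` D := @subset_closure _ Om.
have cD : compact D := compact_closure_bounded bOm.
have [L L0 HL] := bounded_closure_coord bOm.
have D0 : D !=set0 by exists xb; exact: OD.
pose K := N%:R * (L * L); have K0 : 0 <= K by rewrite mulr_ge0 // mulr_ge0 // ltW.
have DK x : D x -> dot x x <= K.
  by move=> Dx; apply: le_trans (ler_norm _) _; apply: dot_le_coord => i; exact: HL.
pose m := (u xb - v xb) / 2.
have m0 : 0 < m by rewrite divr_gt0 // subr_gt0.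
pose eta := m / (K + 1).
have K1 : 0 < K + 1 by lra.
have eta0 : 0 < eta by rewrite divr_gt0.
have etaK : eta * K <= m by rewrite mulrAC ler_pdivrMr // ler_wpM2l ?ltW //; lra.
(* Subtracting [K] makes [s] nonpositive on the closure, so the boundary inequality survives;
   [eta * K] is at most [m], half of the original gap at [xb]. *)
pose s x := eta / 2 * (dot x x - K).
pose uh x := u x + s x.
have s_le0 x : D x -> s x <= 0.
  by move=> /DK xK; rewrite /s pmulr_rle0 ?subr_le0 // divr_gt0.
have s_ge x : - (eta * K) <= s x.
  have : 0 <= eta / 2 * dot x x by rewrite mulr_ge0 ?dot_ge0 // ltW // divr_gt0.
  have : 0 <= eta * K by rewrite mulr_ge0 // ltW.
  by rewrite /s; lra.
have sE : s = quad 0 (- (eta / 2 * K)) 0 eta%:M.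
  apply/funext => x; rewrite /s /quad subr0 dot0l /bil mul_mx_scalar dotZl.
  by field.
have uuh : usc_on D uh.
  by apply: usc_onD => //; rewrite sE; exact: continuous_quad.
have uv' : usc_on D (fun x => - v x).
  move=> x Dx ep ep0; have [d d0 Hd] := lv x Dx ep ep0; exists d => // y Dy yx.
  by have := Hd y Dy yx; lra.
have [x1 Dx1 H1] := usc_max D0 cD uuh; have [x2 Dx2 H2] := usc_max D0 cD uv'.
pose M := uh x1 - v x2.
have HM xi et : D xi -> D et -> uh xi - v et <= M.
  by move=> Dxi Det; have := H1 _ Dxi; have := H2 _ Det; rewrite /M; lra.
have xbm : m <= uh xb - v xb.
  have : u xb - v xb = 2 * m by rewrite /m; field.
  by rewrite /uh; have := s_ge xb; lra.
have bd' x : (D `\` Om) x -> uh x <= v x.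
  move=> Dx; apply: le_trans (bd x Dx); case: Dx => /s_le0 Dx _.
  by rewrite /uh; lra.
have m2 : 0 < m / 2 by rewrite divr_gt0.
have e2 : 0 < eta / 2 by rewrite divr_gt0.
have [w w0 Hw] := localisation oOm bOm hc kN hI uuh lv bd' m2 e2.
(* [w / 2] keeps the touching points inside the localised balls; the last entry and [ep] each cost a
   quarter of the gap [m], which leaves [m / 2]. *)
pose R0 := Num.min (Num.min 1 (w / 2)) (m / 4 / (4 * N%:R * L)).
have N0r : 0 < N%:R :> R by rewrite ltr0n.
have NL0 : 0 < 4 * N%:R * L by rewrite !mulr_gt0.
have R00 : 0 < R0 by rewrite !lt_min ltr01 /= divr_gt0 //= divr_gt0 // divr_gt0.
have R01 : R0 <= 1 by rewrite !ge_min lexx.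
have R0w : R0 <= w / 2 by rewrite !ge_min lexx !orbT.
have R0m : 4 * N%:R * R0 * L <= m / 4.
  have : R0 <= m / 4 / (4 * N%:R * L) by rewrite !ge_min lexx !orbT.
  by rewrite ler_pdivlMr //; congr (_ <= _); ring.
pose ep := Num.min (m / 4) (eta / 18).
have ep0 : 0 < ep by rewrite lt_min; apply/andP; split; rewrite divr_gt0 // ltr0n.
have epm : ep <= m / 4 by rewrite ge_min lexx.
have epe : ep <= eta / 18 by rewrite ge_min lexx orbT.
have Mm : m <= M by apply: le_trans xbm (HM _ _ (OD _ Oxb) (OD _ Oxb)).
(* At distance [w] the remaining penalty [kap / 6 * w ^+ 2] already exceeds [M], so the two points
   are closer than [w]. *)
pose kap := 1 + 6 * M / w ^+ 2.
have w20 : 0 < w ^+ 2 by rewrite exprn_gt0.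
have kw : 0 <= 6 * M / w ^+ 2 by apply: divr_ge0; [rewrite mulr_ge0 // (le_trans (ltW m0))|exact: ltW].
have kap1 : 1 <= kap by rewrite /kap lerDl.
have R0P : 0 < R0 <= 1 by rewrite R00.
have [r [xi [et [l1 [l2 [X [Y [[/andP[r0 rR] Dxi Det XT YT] nearmax t1 t2 XY]]]]]]]] :=
  approximate_sums N0 kap1 D0 HM HL R0P ep0.
have := nearmax xb (OD _ Oxb) => nm.
have pen0 : 0 <= kap / 6 * dot (xi - et) (xi - et).
  by rewrite mulr_ge0 ?dot_ge0 // divr_ge0 // (le_trans ler01).
have fm : m / 2 <= uh xi - v et by clear -nm pen0 xbm R0m epm; lra.
have dist : enorm (et - xi) < w.
  rewrite enormC -(ltr_sqr (enorm_ge0 _)) ?nnegrE ?(ltW w0) // enorm_sqr.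
  have h1 : kap / 6 * dot (xi - et) (xi - et) < M.
    by have := HM xi et Dxi Det; clear -nm xbm R0m epm m0; lra.
  have h2 : M < kap / 6 * w ^+ 2.
    have -> : kap / 6 * w ^+ 2 = w ^+ 2 / 6 + M by rewrite /kap; field; rewrite gt_eqF.
    by rewrite ltrDr divr_gt0.
  have k6 : 0 < kap / 6 by rewrite divr_gt0 // (lt_le_trans ltr01).
  by rewrite -(ltr_pM2l k6); exact: lt_trans h2.
have [x [c [c0 Hc Hball]]] := Hw xi et Dxi Det dist fm.
have rw : r < w by clear -rR R0w w0; lra.
have B1 z : enorm (z - xi) <= r -> Om z.
  by move=> h1; have [] := Hball z; [left; exact: le_lt_trans rw|].
have B2 z : enorm (z - et) <= r -> Om z.
  by move=> h1; have [] := Hball z; [right; exact: le_lt_trans rw|].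
have sub_usc f (z0 : 'rV[R]_N) : usc_on D f -> (forall z, enorm (z - z0) <= r -> Om z) ->
    usc_on [set y | enorm (y - z0) <= r] f.
  move=> uf HO z /HO/OD Dz q q0; have [d d0 Hd] := uf z Dz q q0; exists d => // z' Kz' zz.
  by apply: Hd => //; apply/OD/HO.
have t1' ta : enorm ta <= r ->
   uh (xi + ta) <= uh xi + dot l1 ta + 2^-1 * bil X ta ta + ep * r ^+ 2.
  by move=> tr; apply: t1 => //; apply/OD/B1; rewrite addrC addKr.
have t2' ta : enorm ta <= r ->
   - v (et + ta) <= - v et + dot l2 ta + 2^-1 * bil Y ta ta + ep * r ^+ 2.
  by move=> tr; apply: t2 => //; apply/OD/B2; rewrite addrC addKr.
have [y1 [b1 [rho1 [y1r rho10 Hy1]]]] :=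
  touching_paraboloid r0 ep0 XT (sub_usc _ _ uuh B1) t1'.
have [y2 [b2 [rho2 [y2r rho20 Hy2]]]] :=
  touching_paraboloid r0 ep0 YT (sub_usc _ _ uv' B2) t2'.
(* The shift [4 * ep] comes from [touching_paraboloid]; removing [s], whose Hessian is [eta%:M],
   from [uh] returns to u. *)
pose A := X + (4 * ep - eta)%:M; pose Z := - (Y + (4 * ep)%:M).
have AT : A^T = A by exact: scalar_shift_sym.
have ZT : Z^T = Z by rewrite /Z linearN /= scalar_shift_sym.
have hA : h y1 <= Gop A.
  apply: (visc_sub_quad (b := b1 - eta *: y1) su (B1 _ (ltW y1r)) AT rho10) => z zy.
  have := Hy1 z zy; rewrite /uh /quad /s /A !bil_shift.
  have -> : dot z z = dot y1 y1 + 2 * dot y1 (z - y1) + dot (z - y1) (z - y1).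
    rewrite -{1 2}(subrK y1 z); move: (z - y1) => a; rewrite !dotE (dotC a y1); ring.
  move: (z - y1) => a; rewrite dotDl dotNl dotZl.
  move: (dot y1 y1) (dot y1 a) (bil X a a) (dot b1 a) (dot a a) (u z) (u y1); clear=> *; lra.
have hZ : Gop Z <= h y2.
  apply: (visc_super_quad (b := - b2) sv (B2 _ (ltW y2r)) ZT rho20) => z zy.
  have := Hy2 z zy; rewrite /quad dotNl.
  have -> : bil Z (z - y2) (z - y2) = - bil (Y + (4 * ep)%:M) (z - y2) (z - y2).
    by rewrite /Z /bil mulmxN dotNl.
  move: (bil _ _ _) (dot b2 _) (v y2) (v z); clear=> a1 a2 a3 a4; lra.
have [_ hy1] : Om y1 /\ `|h y1 - h x| < c by apply: Hball; left; exact: lt_trans rw.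
have [_ hy2] : Om y2 /\ `|h y2 - h x| < c by apply: Hball; right; exact: lt_trans rw.
move: hy1 hy2; rewrite !ltr_norml => /andP[h1 _] /andP[_ h2].
have hA' : h x - c <= Gop A by clear -h1 hA; lra.
have step := Hc A AT hA'.
(* In the matrix order this needs [9 * ep] to be at most [eta / 2]: one [ep] bounds X + Y and eight
   come from the two shifts. Hence the [eta / 18] in [ep]. *)
have : Gop (A + (eta / 2)%:M) <= Gop Z.
  apply: Gop_le => //; first exact: scalar_shift_sym.
  move=> z; have -> : bil Z z z = - bil Y z z - 4 * ep * dot z z.
    by rewrite /Z [LHS]/bil mulmxN dotNl -/(bil _ z z) bil_shift; ring.
  rewrite /A !bil_shift; have := XY z.
  have : ep * dot z z <= eta / 18 * dot z z by rewrite ler_wpM2r ?dot_ge0.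
  clear; lra.
clear -step hZ h2; lra.
Qed.

End Comparison.

Theorem theorem6p18 (R : realType) (N : nat) (Om : set 'rV[R]_N)
  (h : 'rV[R]_N -> R) (k : nat) :
  open Om -> bounded_set Om -> connected Om ->
  {within Om, continuous h} ->
  (1 <= k <= N)%N ->
  (forall x, Om x ->
     (N%:R - 2 * k%:R) * pi / 2 < h x /\
     h x < (N%:R - 2 * (k%:R - 1)) * pi / 2) ->
  [/\ proper_elliptic_map Om (ThetaG h),
      hausdorff_continuous Om (ThetaG h),
      (forall x, Om x ->
         boundaryS (ThetaG h x) `<=` [set p | SN p /\ Gop p.2 = h x]) &
      forall u v : 'rV[R]_N -> R,
        usc_on (closure Om) u -> lsc_on (closure Om) v ->
        visc_sub Om h u -> visc_super Om h v ->
        (forall x, (closure Om `\` Om) x -> u x <= v x) ->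
        forall x, Om x -> u x <= v x].
Proof.
move=> oOm bOm _ hc kN hI; split.
- exact: ThetaG_proper hI.
- exact: ThetaG_hausdorff hI.
- by move=> x _; exact: ThetaG_boundary.
- by move=> u v uu lv su sv bd; exact: comparison hI uu lv su sv bd.
Qed.
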